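(* Let $K$ be a field, let $(Q,S)$ be a QP over $K$ whose underlying finite loop-free quiver $Q$ is $2$-acyclic (has no $2$-cycles), and let $k\in Q_0$. Fix a right-equivalence $\varphi:\mu_k(Q,S)\oplus(C,T)\to\widetilde\mu_k(Q,S)$, where $(C,T)$ is a trivial QP, and let $\mathcal M=(M,V)$ and $\mathcal N=(N,W)$ be decorated $\mathcal P(Q,S)$-modules (no finite-dimensionality assumed). Then: (1) the Derksen-Weyman-Zelevinsky mutations with respect to $\varphi$, $\mu_k(\mathcal M)$ and $\mu_k(\mathcal N)$, are isomorphic as decorated $\mathcal P(\mu_k(Q,S))$-modules if and only if the premutations $\widetilde\mu_k(\mathcal M)$ and $\widetilde\mu_k(\mathcal N)$ are isomorphic as decorated $\mathcal P(\widetilde\mu_k(Q,S))$-modules; (2) the premutations $\widetilde\mu_k(\mathcal M)$ and $\widetilde\mu_k(\mathcal N)$ are isomorphic as decorated $\mathcal P(\widetilde\mu_k(Q,S))$-modules if and only if $\mathcal M$ and $\mathcal N$ are isomorphic as decorated $\mathcal P(Q,S)$-modules.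
   Context: **Quivers and potentials.** $K$ is an arbitrary field; modules are left modules. A quiver $Q=(Q_0,Q_1,h,t)$ is finite and loop-free; an arrow $a$ goes from $t(a)$ to $h(a)$. Paths are composed as functions: $c_1c_2\cdots c_d$ is a path if $t(c_i)=h(c_{i+1})$. $e_j$ is the length-$0$ path at $j$. $K\langle Q\rangle$ is the path algebra, $K\langle\langle Q\rangle\rangle$ the complete path algebra (possibly infinite linear combinations of paths), $\mathfrak m$ its ideal generated by the arrows, with the $\mathfrak m$-adic topology. $K^{Q_0}=\prod_{j\in Q_0}K$; a $K^{Q_0}$-ring homomorphism is a $K$-algebra homomorphism fixing all $e_j$. A potential $S$ is a possibly infinite linear combination of cyclic paths of positive length; $(Q,S)$ is a QP. For a cyclic path, $\partial_a(c_1\cdots c_d)=\sum_{i:c_i=a}c_{i+1}\cdots c_dc_1\cdots c_{i-1}$, and for arrows $a,b$ with $h(a)=t(b)$, $\partial_{ba}(c_1\cdots c_d)=\sum_{i:\,c_ic_{i+1}=ba}c_{i+2}\cdots c_dc_1\cdots c_{i-1}$ (indices mod $d$); both are extended linearly and continuously. $J(S)$ is the $\mathfrak m$-adic closure of the two-sided ideal generated by all $\partial_a(S)$, and $\mathcal P(Q,S)=K\langle\langle Q\rangle\rangle/J(S)$. Two potentials are cyclically equivalent if their difference lies in the closure of the span of the elements $c_1\cdots c_d-c_2\cdots c_dc_1$. A decorated $\mathcal P(Q,S)$-module is a pair $(M,V)$ with $M$ a left $\mathcal P(Q,S)$-module and $V$ a left $K^{Q_0}$-module; $M_j=e_jM$,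 and $u_M$ is the action of $u$ on $M$. An isomorphism $(M,V)\to(N,W)$ is a pair consisting of a module isomorphism $M\to N$ and a $K^{Q_0}$-module isomorphism $V\to W$. **Premutation of QPs.** $\widetilde\mu_k(Q)$ has vertex set $Q_0$; its arrows are: the arrows of $Q$ not incident to $k$; an arrow $[ba]:t(a)\to h(b)$ for each pair $a,b\in Q_1$ with $h(a)=k=t(b)$; and an arrow $c^*$ opposite to $c$ for each $c\in Q_1$ incident to $k$. $\widetilde\mu_k(S)=[S]+\sum_{h(a)=k=t(b)}b^*[ba]a^*$, where $[S]$ is obtained from $S$ (replaced if necessary by a cyclically equivalent potential none of whose cycles starts at $k$) by replacing each occurrence of $ba$ with $h(a)=k=t(b)$ by the arrow $[ba]$. $\widetilde\mu_k(Q,S)=(\widetilde\mu_k(Q),\widetilde\mu_k(S))$. **Triangle.** Let $a_1,\dots,a_s$ (resp. $b_1,\dots,b_r$) be the arrows of $Q$ ending (resp. starting) at $k$. Put $M_{\rm in}=\bigoplus_iM_{t(a_i)}$, $M_{\rm out}=\bigoplus_jM_{h(b_j)}$, $\alpha=[(a_1)_M\cdots(a_s)_M]:M_{\rm in}\to M_k$, $\beta=[(b_1)_M\cdots(b_r)_M]^{T}:M_k\to M_{\rm out}$, and $\gamma:M_{\rm out}\to M_{\rm in}$ with $(i,j)$ entry $(\partial_{b_ja_i}(S))_M$. One has $\alpha\gamma=0=\gamma\beta$. Fix a linear retraction $\rho:M_{\rm out}\to\ker\gamma$ of the inclusion and a linear section $\sigma:\ker\alpha/\operatorname{im}\gamma\to\ker\alpha$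 of the projection (chosen arbitrarily for each module). $\iota$ denotes inclusions into $M_{\rm in}$; $p:M_{\rm out}\to\operatorname{coker}\beta$ is the projection (also its restriction $\ker\gamma\to\ker\gamma/\operatorname{im}\beta$); $\overline\gamma:\operatorname{coker}\beta\to M_{\rm in}$ is induced by $\gamma$. **$(\overline M,\overline V)$.** $\overline M_j=M_j$, $\overline V_j=V_j$ for $j\ne k$; $\overline V_k=\ker\beta/(\ker\beta\cap\operatorname{im}\alpha)$; and $\overline M_k$, $\overline\alpha:M_{\rm out}\to\overline M_k$, $\overline\beta:\overline M_k\to M_{\rm in}$ are given by any one of the following (mutually isomorphic) descriptions: (A) $\overline M_k=\frac{\ker\gamma}{\operatorname{im}\beta}\oplus\operatorname{im}\gamma\oplus\frac{\ker\alpha}{\operatorname{im}\gamma}\oplus V_k$, $\overline\alpha=[-p\rho,\,-\gamma,\,0,\,0]^T$, $\overline\beta=[0,\ \iota,\ \iota\sigma,\ 0]$; (B) $\overline M_k=\frac{\ker\gamma}{\operatorname{im}\beta}\oplus\ker\alpha\oplus V_k$, $\overline\alpha=[-p\rho,\,-\gamma,\,0]^T$, $\overline\beta=[0,\ \iota,\ 0]$; (C) $\overline M_k=\operatorname{coker}\beta\oplus\frac{\ker\alpha}{\operatorname{im}\gamma}\oplus V_k$, $\overline\alpha=[-p,\,0,\,0]^T$, $\overline\beta=[\overline\gamma,\ \iota\sigma,\ 0]$. Put $\overline M=\bigoplus_j\overline M_j$, $\overline V=\bigoplus_j\overline V_j$. $\overline M$ is a representation of $\widetilde\mu_k(Q)$: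 arrows $c$ of $Q$ not incident to $k$ act as $c_M$, $[ba]$ acts as $b_Ma_M$, and $(a_i^* )_{\overline M}:\overline M_k\to M_{t(a_i)}$, $(b_j^* )_{\overline M}:M_{h(b_j)}\to\overline M_k$ are the components of $\overline\beta$ and $\overline\alpha$. Let $\eta:K\langle\widetilde\mu_k(Q)\rangle\to\operatorname{End}_K(\overline M)$ be the corresponding action. **The action $\widetilde\eta$ of $A:=K\langle\langle\widetilde\mu_k(Q)\rangle\rangle$ on $\overline M$.** Let $e_{\widehat k}=1-e_k$. For a quiver $Q'$ on $Q_0$, $e_{\widehat k}Q'e_{\widehat k}$ is $Q'$ with $k$ and all arrows incident to $k$ deleted. $\kappa:e_{\widehat k}Ae_{\widehat k}\to K\langle\langle e_{\widehat k}\widetilde\mu_k^2(Q)e_{\widehat k}\rangle\rangle$ is the algebra isomorphism replacing each occurrence of a length-$2$ path $a^*b^*$ ($h(a)=k=t(b)$) by the arrow $[a^*b^*]$. $\psi:K\langle\langle e_{\widehat k}\widetilde\mu_k^2(Q)e_{\widehat k}\rangle\rangle\to e_{\widehat k}K\langle\langle Q\rangle\rangle e_{\widehat k}$ is the unique algebra homomorphism fixing each $e_j$ ($j\neq k$) with $\psi(c)=c$ for $c\in Q_1$ not incident to $k$, $\psi([ba])=ba$, $\psi([a^*b^*])=-\partial_{ba}(S)$. $\widetilde\rho$ is the action $e_{\widehat k}K\langle\langle Q\rangle\rangle e_{\widehat k}\to\operatorname{End}_K(e_{\widehat k}M)$. $\theta:\operatorname{End}_K(e_{\widehat k}M)\to\operatorname{End}_K(\overline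 M)$ sends $f$ to $\overline M\twoheadrightarrow e_{\widehat k}M\xrightarrow{f}e_{\widehat k}M\hookrightarrow\overline M$. Every $u\in A$ is uniquely $u=ze_k+u_{\widehat k}+\sum_iv_ia_i^*+\sum_jb_j^*w_j+\sum_{i,j}b_j^*x_{ij}a_i^*$ with $z\in K$, $u_{\widehat k}\in e_{\widehat k}Ae_{\widehat k}$, $v_i\in e_{\widehat k}Ae_{t(a_i)}$, $w_j\in e_{h(b_j)}Ae_{\widehat k}$, $x_{ij}\in e_{h(b_j)}Ae_{t(a_i)}$. With $\Theta:=\theta\widetilde\rho\psi\kappa$, $$\widetilde\eta(u)=\eta(ze_k)+\Theta(u_{\widehat k})+\sum_i\Theta(v_i)\eta(a_i^* )+\sum_j\eta(b_j^* )\Theta(w_j)+\sum_{i,j}\eta(b_j^* )\Theta(x_{ij})\eta(a_i^* ).$$ This makes $\overline M$ a $\mathcal P(\widetilde\mu_k(Q,S))$-module. The premutation of $\mathcal M$ is the decorated $\mathcal P(\widetilde\mu_k(Q,S))$-module $\widetilde\mu_k(\mathcal M):=(\overline M,\overline V)$. **Reduction and mutation.** A right-equivalence $(Q',S')\to(Q,S)$ of QPs on the same vertex set is a $K^{Q_0}$-ring isomorphism $K\langle\langle Q'\rangle\rangle\to K\langle\langle Q\rangle\rangle$ sending $S'$ to a potential cyclically equivalent to $S$. $(Q',S')\oplus(Q'',S'')$ has arrow set $Q'_1\sqcup Q''_1$ and potential $S'+S''$. A QP is reduced if the degree-$2$ component of its potential is zero, and trivial if its potential $S$ is homogeneous of degree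 $2$ and every arrow is a $K$-linear combination of the $\partial_a(S)$. By the Derksen-Weyman-Zelevinsky splitting theorem every QP $(Q,S)$ with $Q$ loop-free admits a right-equivalence $\varphi:(Q_{\rm red},S_{\rm red})\oplus(Q_{\rm triv},S_{\rm triv})\to(Q,S)$ with first summand reduced and second trivial. For a $\mathcal P(Q,S)$-module $N$, $\varphi^{\#}(N)$ is $N$ with $u\in K\langle\langle Q_{\rm red}\rangle\rangle$ acting by $u\star_\varphi n:=\varphi(u)\cdot n$; it is a $\mathcal P(Q_{\rm red},S_{\rm red})$-module, and $\varphi$ induces an isomorphism $\mathcal P(Q_{\rm red},S_{\rm red})\cong\mathcal P(Q,S)$. Given such a $\varphi$ for $\widetilde\mu_k(Q,S)$, $\mu_k(Q,S):=(\widetilde\mu_k(Q)_{\rm red},\widetilde\mu_k(S)_{\rm red})$ and $\mu_k(\mathcal M):=(\varphi^{\#}(\overline M),\overline V)$. *)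

(* Defs.v *)
From HB Require Import structures.
From mathcomp Require Import all_boot all_algebra.
From mathcomp Require Import boolp functions.

Set Implicit Arguments.
Unset Strict Implicit.
Unset Printing Implicit Defensive.

Import GRing.Theory.
Local Open Scope ring_scope.
Local Open Scope quotient_scope.

Section Subspaces.
Variable K : fieldType.

Record subspace (U : lmodType K) (A : submodClosed U) := Subspace {
  subspace_val :> U;
  subspace_mem : subspace_val \in A }.

Section SubspaceQuotient.
Variables (U : lmodType K) (A : submodClosed U).

HB.instance Definition _ := [isSub for @subspace_val U A].
HB.instance Definition _ := [Choice of subspace A by <:].
HB.instance Definition _ := [SubChoice_isSubLmodule of subspace A by <:].

Definition zmod_of_submod : {pred U} := A.

Lemma zmod_of_submod_closed : zmod_closed zmod_of_submod.
Proof.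
split; first exact: (rpred0 A).
move=> x y xA yA; rewrite -scaleN1r.
exact: (@rpredD _ A _ _ xA (@rpredZ _ _ A _ _ yA)).
Qed.

HB.instance Definition _ :=
  GRing.isZmodClosed.Build U zmod_of_submod zmod_of_submod_closed.

Definition quotient : Type := Quotient.quot zmod_of_submod.

HB.instance Definition _ := GRing.Zmodule.on quotient.
HB.instance Definition _ := EqQuotient.on quotient.

Definition quotient_proj (x : U) : quotient := \pi_quotient x.
Definition quotient_scale (c : K) (q : quotient) : quotient :=
  quotient_proj (c *: repr q).

Lemma quotient_projE x y : (quotient_proj x = quotient_proj y) <-> (x - y \in A).
Proof.
have e := Quotient.idealrBE zmod_of_submod x y.
split=> [h|h]; first by rewrite [_ \in A]e; apply/eqP.
by move: (h : _ \in zmod_of_submod); rewrite e => /eqP.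
Qed.

Lemma quotient_projK q : quotient_proj (repr q) = q.
Proof. exact: reprK. Qed.

Lemma quotient_projB : {morph quotient_proj : x y / x - y}.
Proof. by move=> x y; exact: (raddfB (\pi_(Quotient.quot zmod_of_submod))). Qed.
Lemma quotient_projD : {morph quotient_proj : x y / x + y}.
Proof. by move=> x y; exact: (raddfD (\pi_(Quotient.quot zmod_of_submod))). Qed.

Lemma quotient_scale_proj c x :
  quotient_scale c (quotient_proj x) = quotient_proj (c *: x).
Proof.
apply/quotient_projE; rewrite -scalerBr rpredZ //.
by apply/quotient_projE; rewrite quotient_projK.
Qed.

Lemma quotient_scaleA a b q :
  quotient_scale a (quotient_scale b q) = quotient_scale (a * b) q.
Proof. by rewrite quotient_scale_proj scalerA. Qed.
Lemma quotient_scale1 : left_id 1 quotient_scale.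
Proof. by move=> q; rewrite /quotient_scale scale1r quotient_projK. Qed.
Lemma quotient_scaleDr : right_distributive quotient_scale +%R.
Proof.
move=> c p q; rewrite -[p]quotient_projK -[q]quotient_projK.
by rewrite -quotient_projD !quotient_scale_proj scalerDr quotient_projD.
Qed.
Lemma quotient_scaleDl q : {morph quotient_scale^~ q : a b / a + b}.
Proof. by move=> a b; rewrite /quotient_scale scalerDl quotient_projD. Qed.

HB.instance Definition _ := GRing.Zmodule_isLmodule.Build K quotient
  quotient_scaleA quotient_scale1 quotient_scaleDr quotient_scaleDl.

Lemma quotient_proj_linear : linear quotient_proj.
Proof. by move=> c x y; rewrite quotient_projD -quotient_scale_proj. Qed.
HB.instance Definition _ :=
  GRing.isLinear.Build K U quotient _ quotient_proj quotient_proj_linear.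

End SubspaceQuotient.

Section KernelImage.
Variables (U W : lmodType K) (f : {linear U -> W}).

Definition ker : {pred U} := [pred x | f x == 0].
Definition im : {pred W} := [pred y | `[< exists x, f x = y >] ].

Lemma ker_closed : submod_closed ker.
Proof.
split; first by rewrite inE linear0.
by move=> c x y /eqP fx /eqP fy; rewrite inE linearP fx fy scaler0 addr0.
Qed.
HB.instance Definition _ := GRing.isSubmodClosed.Build K U ker ker_closed.

Lemma im_closed : submod_closed im.
Proof.
split; first by apply/asboolP; exists 0; rewrite linear0.
move=> c _ _ /asboolP[x <-] /asboolP[y <-]; apply/asboolP.
by exists (c *: x + y); rewrite linearP.
Qed.
HB.instance Definition _ := GRing.isSubmodClosed.Build K W im im_closed.
End KernelImage.

Section Within.
Variables (U : lmodType K) (A B : submodClosed U).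

Definition within : {pred subspace A} := [pred x | val x \in B].

Lemma within_closed : submod_closed within.
Proof.
split; first by rewrite inE linear0 rpred0.
by move=> c x y xB yB; rewrite inE linearP rpredD ?rpredZ.
Qed.
HB.instance Definition _ :=
  GRing.isSubmodClosed.Build K (subspace A) within within_closed.
End Within.

End Subspaces.

Arguments within {K U} A B.
Arguments quotient_proj {K U} A x.

Record quiver (I : finType) := Quiver {
  arrow : finType;
  hd : arrow -> I;
  tl : arrow -> I }.

Section Paths.
Variables (I : finType) (Q : quiver I).

Definition loop_free := forall a : arrow Q, hd a != tl a.
Definition two_acyclic := forall a b : arrow Q, ~ (hd a = tl b /\ hd b = tl a).

(* The word (j, [:: c_1; ...; c_d]) stands for e_j c_1 ... c_d; it is a path
   when h(c_1) = j and t(c_i) = h(c_(i+1)).  Thus j is the head of the path. *)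
Definition word := (I * seq (arrow Q))%type.

Fixpoint walk (j : I) (s : seq (arrow Q)) : bool :=
  if s is c :: s' then (hd c == j) && walk (tl c) s' else true.

Definition is_path (w : word) := walk w.1 w.2.
Definition word_tl (w : word) : I := last w.1 (map (@tl I Q) w.2).
Definition cyclic (w : word) :=
  [&& is_path w, word_tl w == w.1 & w.2 != [::]].

Lemma walk_cat j s s' :
  walk j (s ++ s') = walk j s && walk (last j (map (@tl I Q) s)) s'.
Proof. by elim: s j => //= c s IH j; rewrite IH andbA. Qed.

End Paths.

(* The complete path algebra: formal series of words, supported on paths. *)
Section PathAlgebra.
Variables (K : fieldType) (I : finType).

Definition path_supported (Q : quiver I) : {pred (word Q -> K^o)} :=
  fun f => `[< forall w, ~~ is_path w -> f w = 0 >].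
Arguments path_supported Q : clear implicits.

Lemma path_supported_closed Q : submod_closed (path_supported Q).
Proof.
split; first by apply/asboolP.
move=> c f g /asboolP hf /asboolP hg; apply/asboolP => w nw.
have -> : (c *: f + g) w = c * f w + g w by [].
by rewrite hf // hg // mulr0 addr0.
Qed.
HB.instance Definition _ Q := GRing.isSubmodClosed.Build K (word Q -> K^o)
  (path_supported Q) (path_supported_closed Q).

Record cpa (Q : quiver I) := Cpa {
  coef :> word Q -> K^o;
  coef_supported : coef \in path_supported Q }.

HB.instance Definition _ Q := [isSub for @coef Q].
HB.instance Definition _ Q := [Choice of cpa Q by <:].
HB.instance Definition _ Q := [SubChoice_isSubLmodule of cpa Q by <:].

Variable Q : quiver I.
Implicit Types (u v x : cpa Q) (w : word Q) (s : seq (arrow Q)) (j : I).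

Lemma coef0P u w : ~~ is_path w -> u w = 0.
Proof. by have /asboolP := coef_supported u; apply. Qed.

Lemma cpaP u v : (forall j s, walk j s -> u (j, s) = v (j, s)) -> u = v.
Proof.
move=> h; apply/val_inj/funext => -[j s].
by have [/h //|nw] := boolP (walk j s); rewrite [LHS]coef0P // [RHS]coef0P.
Qed.

Lemma coefD u v w : (u + v) w = u w + v w. Proof. by []. Qed.
Lemma coef0 w : (0 : cpa Q) w = 0. Proof. by []. Qed.
Lemma coefN u w : (- u) w = - u w. Proof. by []. Qed.
Lemma coefZ c u w : (c *: u) w = c * u w. Proof. by []. Qed.
Lemma coef_sum (T : Type) (r : seq T) (P : pred T) (F : T -> cpa Q) w :
  (\sum_(i <- r | P i) F i) w = \sum_(i <- r | P i) F i w.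
Proof. by elim/big_rec2: _ => //= i y x _ <-. Qed.

Definition conv (f g : word Q -> K) (w : word Q) : K :=
  \sum_(i < (size w.2).+1)
    f (w.1, take i w.2) * g (word_tl (w.1, take i w.2), drop i w.2).

Lemma conv_nil f g j : conv f g (j, [::]) = f (j, [::]) * g (j, [::]).
Proof. by rewrite /conv big_ord1. Qed.

Lemma conv_cons f g j c s : conv f g (j, c :: s) =
  f (j, [::]) * g (j, c :: s) + conv (fun w => f (j, c :: w.2)) g (tl c, s).
Proof. by rewrite /conv /= big_ord_recl. Qed.

Lemma eq_conv f f' g g' j s :
  (forall s', f (j, s') = f' (j, s')) -> g =1 g' ->
  conv f g (j, s) = conv f' g' (j, s).
Proof. by move=> ef eg; apply: eq_bigr => i _; rewrite /= ef eg. Qed.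

Lemma convDl f f' g w : conv (fun w => f w + f' w) g w = conv f g w + conv f' g w.
Proof. by rewrite -big_split; apply: eq_bigr => i _; rewrite mulrDl. Qed.
Lemma convDr f g g' w : conv f (fun w => g w + g' w) w = conv f g w + conv f g' w.
Proof. by rewrite -big_split; apply: eq_bigr => i _; rewrite mulrDr. Qed.
Lemma convZl c f g w : conv (fun w => c * f w) g w = c * conv f g w.
Proof. by rewrite big_distrr; apply: eq_bigr => i _; rewrite /= mulrA. Qed.
Lemma convZr c f g w : conv f (fun w => c * g w) w = c * conv f g w.
Proof. by rewrite big_distrr; apply: eq_bigr => i _; rewrite /= mulrCA. Qed.

Lemma convA f g h w : conv (conv f g) h w = conv f (conv g h) w.
Proof.
case: w => j s; elim: s j f g h => [|c s IH] j f g h.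
  by rewrite !conv_nil mulrA.
rewrite !conv_cons conv_nil mulrDr mulrA -addrA; congr (_ + _).
rewrite -IH -convZl -convDl; apply: eq_conv => // s' /=.
by rewrite conv_cons.
Qed.

Lemma conv_supported u v : conv u v \in path_supported Q.
Proof.
apply/asboolP => -[j s] nw; apply: big1 => i _ /=.
have [w1|/coef0P->] := boolP (is_path (j, take i s)); last by rewrite mul0r.
rewrite [X in _ * X]coef0P ?mulr0 //; apply: contra nw => w2.
rewrite /is_path /= -[s in walk j s](cat_take_drop i) walk_cat.
by move: w1 w2; rewrite /is_path /= => -> ->.
Qed.

Definition cpa_mul u v : cpa Q := Cpa (conv_supported u v).

(* monomial w is the path w, and 0 when the word w is not a path. *)
Definition monomial_coef w : word Q -> K := fun w' => ((w' == w) && is_path w)%:R.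
Lemma monomial_supported w : monomial_coef w \in path_supported Q.
Proof.
apply/asboolP => w' nw; rewrite /monomial_coef.
by case: eqP => //= <-; rewrite (negbTE nw).
Qed.
Definition monomial w : cpa Q := Cpa (monomial_supported w).

Definition idem j := monomial (j, [::]).
Definition arr (c : arrow Q) := monomial (hd c, [:: c]).

Definition one_coef : word Q -> K := fun w => (w.2 == [::])%:R.
Lemma one_supported : one_coef \in path_supported Q.
Proof. by apply/asboolP => -[j [|c s]]. Qed.
Definition cpa_one : cpa Q := Cpa one_supported.

Lemma cpa_mulA : associative cpa_mul.
Proof. by move=> u v x; apply: cpaP => j s _; rewrite /= convA. Qed.
Lemma cpa_mul1l : left_id cpa_one cpa_mul.
Proof.
move=> u; apply: cpaP => j s _ /=; rewrite /conv big_ord_recl /= take0 drop0 mul1r.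
rewrite big1 ?addr0 // => i _; case: s i => [[]//|c s] i /=.
by rewrite /one_coef /= mul0r.
Qed.
Lemma cpa_mul1r : right_id cpa_one cpa_mul.
Proof.
move=> u; apply: cpaP => j s _ /=.
rewrite /conv big_ord_recr /= take_size drop_size mulr1.
rewrite big1 ?add0r // => i _; rewrite /one_coef /= -size_eq0 size_drop subn_eq0.
by rewrite leqNgt ltn_ord mulr0.
Qed.
Lemma cpa_mulDl : left_distributive cpa_mul +%R.
Proof. by move=> u v x; apply: cpaP => j s _; exact: convDl. Qed.
Lemma cpa_mulDr : right_distributive cpa_mul +%R.
Proof. by move=> u v x; apply: cpaP => j s _; exact: convDr. Qed.

HB.instance Definition _ := GRing.Zmodule_isPzRing.Build (cpa Q)
  cpa_mulA cpa_mul1l cpa_mul1r cpa_mulDl cpa_mulDr.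

Lemma coefM u v w : (u * v) w = conv u v w. Proof. by []. Qed.
Lemma coef_monomial w w' : monomial w w' = ((w' == w) && is_path w)%:R.
Proof. by []. Qed.

Lemma idemM j u w : (idem j * u) w = u w *+ (w.1 == j).
Proof.
rewrite coefM /conv big_ord_recl /= big1 ?addr0 ?take0 ?drop0.
  by rewrite /monomial_coef andbT xpair_eqE eqxx andbT mulr_natl; case: w.
move=> i _; rewrite /monomial_coef andbT xpair_eqE.
by case: w i => i0 [|c s] [i ilt] //=; rewrite andbF mul0r.
Qed.

Lemma idem_arr c : idem (hd c) * arr c = arr c.
Proof.
apply: cpaP => j s _; rewrite idemM coef_monomial xpair_eqE.
by case: (j == hd c).
Qed.

Lemma arrM c u j s : (arr c * u) (j, s) =
  if s is c' :: s' then u (tl c, s') *+ ((c' == c) && (j == hd c)) else 0.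
Proof.
rewrite coefM; case: s => [|c' s]; first by rewrite conv_nil coef_monomial xpair_eqE andbF mul0r.
rewrite conv_cons coef_monomial xpair_eqE andbF mul0r add0r.
rewrite /conv big_ord_recl /= big1 ?addr0.
  rewrite take0 drop0 /monomial_coef /is_path /= eqxx !andbT xpair_eqE eqseq_cons andbT.
  rewrite mulr_natl andbC; case: eqP => [->|] //=.
move=> i _; rewrite /monomial_coef xpair_eqE eqseq_cons.
by case: s i => [[]//|c'' s] i /=; rewrite !andbF mul0r.
Qed.

End PathAlgebra.

Arguments path_supported K {I} Q.
Arguments monomial K {I Q} w.
Arguments idem K {I Q} j.
Arguments arr K {I Q} c.

Section Potentials.
Variables (K : fieldType) (I : finType).
Implicit Type Q : quiver I.

(* The n-th power of the ideal generated by the arrows. *)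
Definition in_mpow Q (n : nat) (u : cpa K Q) :=
  forall w : word Q, (size w.2 < n)%N -> u w = 0.

Definition mclosure Q (X : cpa K Q -> Prop) (u : cpa K Q) :=
  forall n, exists2 v, X v & in_mpow n (u - v).

Definition two_sided_ideal Q (G : cpa K Q -> Prop) (u : cpa K Q) :=
  exists (n : nat) (x g y : 'I_n -> cpa K Q),
    (forall i, G (g i)) /\ u = \sum_i x i * g i * y i.

Definition potential Q (S : cpa K Q) := forall w, S w != 0 -> cyclic w.

(* A QP; quivers are finite and loop-free by convention. *)
Record is_QP Q (S : cpa K Q) : Prop := IsQP {
  QP_loop_free : loop_free Q;
  QP_potential : potential S }.

Section Derivatives.
Variables (Q : quiver I) (S : cpa K Q).

(* The coefficient of the path q in der_a(S) is the sum of S(c), over the pairs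
   of a cycle c = c_1...c_d and an index i such that
   c_i c_(i+1)...c_d c_1...c_(i-1) = a q; such cycles have length |q| + 1. *)
Definition cder_coef (a : arrow Q) : word Q -> K := fun q =>
  if is_path q && (q.1 == tl a) then
    \sum_(j : I) \sum_(c : (size q.2).+1.-tuple (arrow Q))
      \sum_(i < (size q.2).+1 | rot i c == a :: q.2) S (j, val c)
  else 0.

Lemma cder_supported a : cder_coef a \in path_supported K Q.
Proof. by apply/asboolP => w nw; rewrite /cder_coef (negbTE nw). Qed.
Definition cder a : cpa K Q := Cpa (cder_supported a).

(* Same, with c_i c_(i+1) c_(i+2)...c_(i-1) = b a q. *)
Definition cder2_coef (b a : arrow Q) : word Q -> K := fun q =>
  if is_path q && (q.1 == tl a) then
    \sum_(j : I) \sum_(c : (size q.2).+2.-tuple (arrow Q))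
      \sum_(i < (size q.2).+2 | rot i c == b :: a :: q.2) S (j, val c)
  else 0.

Lemma cder2_supported b a : cder2_coef b a \in path_supported K Q.
Proof. by apply/asboolP => w nw; rewrite /cder2_coef (negbTE nw). Qed.
Definition cder2 b a : cpa K Q := Cpa (cder2_supported b a).

Definition jacobian_ideal : cpa K Q -> Prop :=
  mclosure (two_sided_ideal (fun u => exists a, u = cder a)).

Lemma idem_cder2 b a : idem K (tl a) * cder2 b a = cder2 b a.
Proof.
apply: cpaP => j s _; rewrite idemM /= /cder2_coef /=.
by case: (j == tl a); rewrite // andbF.
Qed.

Lemma sum_arr_cder2 k b : is_QP S -> tl b = k ->
  \sum_(a : {a : arrow Q | hd a == k}) arr K (val a) * cder2 b (val a) = cder b.
Proof.
move=> [lf potS] tb; apply: cpaP => j [|a s] w; rewrite coef_sum.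
  rewrite big1; last by move=> a _; exact: arrM.
  rewrite /= /cder_coef /=; case: ifP => // _; symmetry.
  apply: big1 => j' _; apply: big1 => c _; apply: big1 => i /eqP.
  have -> : nat_of_ord i = 0%N by case: i => -[].
  rewrite rot0 => ec; apply/eqP; apply: contraNT (lf b) => /potS.
  rewrite /cyclic /is_path /word_tl /= ec /= andbT andbT.
  by case/andP => /eqP -> /eqP ->.
have /andP[/eqP ha ws] : (hd a == j) && walk (tl a) s := w.
rewrite (eq_bigr (fun x : {a : arrow Q | hd a == k} =>
  if val x == a then cder b (j, a :: s) else 0)).
  rewrite -big_mkcond /=; case: (eqVneq (hd a) k) => hak.
    have ak : hd a == k by apply/eqP.
    by rewrite (big_pred1 (exist _ a ak)) // => x; rewrite -val_eqE.
  rewrite big_pred0.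
    by rewrite /cder_coef /= tb -ha (negbTE hak) andbF.
  by move=> [x /= /eqP hx]; apply/eqP => ex; rewrite -hx ex eqxx in hak.
move=> x _; rewrite [LHS]arrM eq_sym; case: eqP => [ex|//]; rewrite ex.
have hak : hd a = k by rewrite -ex; apply/eqP; exact: (valP x).
have w1 : is_path (tl a, s) by [].
have w2 : is_path (j, a :: s) by [].
rewrite -ha eqxx mulr1n; symmetry.
transitivity (cder2_coef b a (tl a, s)); last by [].
transitivity (cder_coef b (j, a :: s)); first by rewrite -ha.
by rewrite /cder_coef /cder2_coef w1 w2 eqxx tb -ha hak eqxx.
Qed.
End Derivatives.

Definition rot_word Q (w : word Q) : word Q :=
  if w.2 is c :: s then (tl c, rcons s c) else w.

Definition cyclic_span Q (u : cpa K Q) :=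
  exists (n : nat) (x : 'I_n -> K) (c : 'I_n -> word Q),
    (forall i, cyclic (c i)) /\
    u = \sum_i x i *: (monomial K (c i) - monomial K (rot_word (c i))).

Definition cyc_equiv Q (S S' : cpa K Q) := mclosure (@cyclic_span Q) (S - S').

Definition reduced Q (S : cpa K Q) := forall w, size w.2 = 2 -> S w = 0.

Definition trivial Q (S : cpa K Q) :=
  (forall w, S w != 0 -> size w.2 = 2) /\
  (forall c, exists x : arrow Q -> K, arr K c = \sum_a x a *: cder S a).

(* Each path p = g(x_1)...g(x_d) of Q occurring in u becomes the path x_1...x_d
   of Q', where g is such that p determines x_1...x_d; paths not of this form
   are dropped, and an arrow x with g x = None never occurs in the result. *)
Section Relabel.
Variables (Q Q' : quiver I) (g : arrow Q' -> option (seq (arrow Q))).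

Fixpoint expand (s : seq (arrow Q')) : option (seq (arrow Q)) :=
  if s is x :: s' then
    if (g x, expand s') is (Some t, Some t') then Some (t ++ t') else None
  else Some [::].

Variable u : cpa K Q.

Definition relabel_coef : word Q' -> K := fun w =>
  if is_path w then (if expand w.2 is Some s then u (w.1, s) else 0) else 0.

Lemma relabel_supported : relabel_coef \in path_supported K Q'.
Proof. by apply/asboolP => w nw; rewrite /relabel_coef (negbTE nw). Qed.
Definition relabel : cpa K Q' := Cpa relabel_supported.
End Relabel.

Definition quiver_sum Q1 Q2 : quiver I :=
  @Quiver I (arrow Q1 + arrow Q2)%type
    (fun c => match c with inl c => hd c | inr c => hd c end)
    (fun c => match c with inl c => tl c | inr c => tl c end).

Definition cpa_inl Q1 Q2 : cpa K Q1 -> cpa K (quiver_sum Q1 Q2) :=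
  relabel (fun c : arrow (quiver_sum Q1 Q2) =>
    if c is inl c then Some [:: c] else None).
Definition cpa_inr Q1 Q2 : cpa K Q2 -> cpa K (quiver_sum Q1 Q2) :=
  relabel (fun c : arrow (quiver_sum Q1 Q2) =>
    if c is inr c then Some [:: c] else None).

Definition potential_sum Q1 Q2 (S1 : cpa K Q1) (S2 : cpa K Q2) :
  cpa K (quiver_sum Q1 Q2) := cpa_inl Q2 S1 + cpa_inr Q1 S2.

Record right_equivalence Q Q' (S : cpa K Q) (S' : cpa K Q')
    (phi : {rmorphism cpa K Q -> cpa K Q'}) : Prop := RightEquivalence {
  req_scalable : scalable phi;
  req_idem : forall j, phi (idem K j) = idem K j;
  req_bij : bijective phi;
  req_potential : potential (phi S);
  req_cyc : cyc_equiv (phi S) S' }.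

(* Substitution: the series sum_p u(p) f(p_1)...f(p_d), for a path
   p = p_1...p_d.  When every f x lies in the ideal of the arrows and
   f x = e_(h x) (f x) e_(t x), this is the unique algebra homomorphism fixing
   the idempotents and sending each arrow x to f x; only paths p no longer than
   w contribute to the coefficient of w. *)
Section Substitution.
Variables (Q Q' : quiver I) (f : arrow Q -> cpa K Q') (u : cpa K Q).

Definition subst_coef : word Q' -> K := fun w =>
  \sum_(d < (size w.2).+1) \sum_(j : I) \sum_(p : d.-tuple (arrow Q))
    u (j, val p) * (idem K j * \prod_(x <- p) f x : cpa K Q') w.

Lemma subst_supported : subst_coef \in path_supported K Q'.
Proof.
apply/asboolP => w nw; apply: big1 => d _; apply: big1 => j _; apply: big1 => p _.
by rewrite [X in _ * X]coef0P ?mulr0.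
Qed.
Definition subst : cpa K Q' := Cpa subst_supported.
End Substitution.

End Potentials.

Section PremutationQuiver.
Variables (I : finType) (k : I) (Q : quiver I).

Definition in_arrow : finType := {a : arrow Q | hd a == k}.
Definition out_arrow : finType := {b : arrow Q | tl b == k}.
Definition off_arrow : finType := {c : arrow Q | (hd c != k) && (tl c != k)}.

(* Comp b a is the arrow [ba]; InStar a and OutStar b are a^* and b^*.  (For a
   loop-free quiver no arrow is both in in_arrow and in out_arrow.) *)
Inductive premut_arrow :=
  | Old of off_arrow
  | Comp of out_arrow & in_arrow
  | InStar of in_arrow
  | OutStar of out_arrow.

Definition premut_arrow_code (x : premut_arrow) :
    (off_arrow + out_arrow * in_arrow) + (in_arrow + out_arrow) :=
  match x with
  | Old c => inl (inl c)
  | Comp b a => inl (inr (b, a))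
  | InStar a => inr (inl a)
  | OutStar b => inr (inr b)
  end.
Definition premut_arrow_decode
    (x : (off_arrow + out_arrow * in_arrow) + (in_arrow + out_arrow)) :=
  match x with
  | inl (inl c) => Old c
  | inl (inr (b, a)) => Comp b a
  | inr (inl a) => InStar a
  | inr (inr b) => OutStar b
  end.
Lemma premut_arrow_codeK : cancel premut_arrow_code premut_arrow_decode.
Proof. by case. Qed.
HB.instance Definition _ := Finite.copy premut_arrow (can_type premut_arrow_codeK).

Definition premut_quiver : quiver I :=
  @Quiver I premut_arrow
    (fun x => match x with
      | Old c => hd (val c)
      | Comp b a => hd (val b)
      | InStar a => tl (val a)
      | OutStar b => k
      end)
    (fun x => match x with
      | Old c => tl (val c)
      | Comp b a => tl (val a)
      | InStar a => k
      | OutStar b => hd (val b)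
      end).

End PremutationQuiver.

Section PremutationPotential.
Variables (K : fieldType) (I : finType) (k : I).

(* For a series u of paths neither starting nor ending at k, bracket k u is
   obtained by replacing each occurrence of ba, with h(a) = k = t(b), by the
   arrow [ba]. *)
Definition bracket (Q : quiver I) : cpa K Q -> cpa K (premut_quiver k Q) :=
  relabel (fun x : arrow (premut_quiver k Q) => match x with
    | Old c => Some [:: val c]
    | Comp b a => Some [:: val b; val a]
    | _ => None
    end).

Variables (Q : quiver I).
Notation mQ := (premut_quiver k Q).

(* premut_potential expects a potential none of whose cycles starts at k, i.e.
   some S0 cyclically equivalent to the given S; the derivatives of S and S0
   coincide, so that gamma and psi below may be formed with S itself. *)
Definition no_start_at (S : cpa K Q) := forall w, S w != 0 -> w.1 != k.

Definition premut_potential (S : cpa K Q) : cpa K mQ :=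
  bracket S + \sum_(b : out_arrow k Q) \sum_(a : in_arrow k Q)
    arr K (OutStar b : arrow mQ) * arr K (Comp b a : arrow mQ)
      * arr K (InStar a : arrow mQ).

(* The algebra of the quiver mu_k(mu_k Q) with k deleted is identified with the
   series supported on paths of mu_k(mu_k Q) which avoid k; those paths have
   only arrows of the form Old or Comp.  An arrow Comp y x with y = a^* and
   x = b^* is [a^*b^*]; there are no other arrows y, x with h(x) = k = t(y). *)
Definition psi_arrow (S : cpa K Q) (x : arrow (premut_quiver k mQ)) : cpa K Q :=
  match x with
  | Old c =>
      match val c with
      | Old c' => arr K (val c')
      | Comp b a => arr K (val b) * arr K (val a)
      | _ => 0
      end
  | Comp y x =>
      match val y, val x with
      | InStar a, OutStar b => - cder2 S (val b) (val a)
      | _, _ => 0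
      end
  | _ => 0
  end.

Definition kappa : cpa K mQ -> cpa K (premut_quiver k mQ) := @bracket mQ.
Definition psi (S : cpa K Q) : cpa K (premut_quiver k mQ) -> cpa K Q :=
  subst (psi_arrow S).

End PremutationPotential.

(* The factors v, w of u = v c + ... and u = c w + ..., for an arrow c. *)
Section ArrowDivision.
Variables (K : fieldType) (I : finType) (Q : quiver I).
Variables (c : arrow Q) (u : cpa K Q).

Definition rdiv_coef : word Q -> K := fun w => u (w.1, rcons w.2 c).
Lemma rdiv_supported : rdiv_coef \in path_supported K Q.
Proof.
apply/asboolP => -[j s] nw; apply: coef0P; apply: contra nw.
by rewrite /is_path /= -cats1 walk_cat => /andP[].
Qed.
Definition rdiv : cpa K Q := Cpa rdiv_supported.

Definition ldiv_coef : word Q -> K := fun w =>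
  if w.1 == tl c then u (hd c, c :: w.2) else 0.
Lemma ldiv_supported : ldiv_coef \in path_supported K Q.
Proof.
apply/asboolP => -[j s]; rewrite /ldiv_coef /=; case: eqP => // -> nw.
by apply: coef0P; rewrite /is_path /= eqxx.
Qed.
Definition ldiv : cpa K Q := Cpa ldiv_supported.
End ArrowDivision.

Section Representations.
Variables (K : fieldType) (I : finType).

(* The underlying data of a decorated module: a K-space acted upon by the
   complete path algebra, and a K-space acted upon by K^(Q_0).  is_dmod states
   that these are a left P(Q,S)-module, i.e. a left module over the complete
   path algebra annihilated by J(S), and a left K^(Q_0)-module.  Isomorphisms
   of decorated modules only involve the two actions, not the potential. *)
Record drep (Q : quiver I) := DRep {
  space : lmodType K;
  act : cpa K Q -> space -> space;
  deco : lmodType K;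
  dact : {ffun I -> K} -> deco -> deco }.

Record is_dmod (Q : quiver I) (S : cpa K Q) (M : drep Q) : Prop := IsDmod {
  act_linear : forall u, linear (@act Q M u);
  act_linear_l : forall m, linear (fun u => @act Q M u m);
  act_one : forall m, @act Q M 1 m = m;
  act_mul : forall u v m, @act Q M (u * v) m = act u (act v m);
  act_jacobian : forall u, jacobian_ideal S u -> forall m, @act Q M u m = 0;
  dact_linear : forall l, linear (@dact Q M l);
  dact_add : forall l l' v, @dact Q M (l + l') v = dact l v + dact l' v;
  dact_mul : forall l l' v, @dact Q M (l * l') v = dact l (dact l' v);
  dact_const : forall c v, @dact Q M [ffun=> c] v = c *: v }.

Record dmod (Q : quiver I) (S : cpa K Q) := Dmod {
  dmod_rep :> drep Q;
  dmodP : is_dmod S dmod_rep }.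

Definition disomorphic (Q : quiver I) (M N : drep Q) : Prop :=
  (exists f : {linear space M -> space N},
     bijective f /\ forall u m, f (act u m) = act u (f m)) /\
  (exists g : {linear deco M -> deco N},
     bijective g /\ forall l v, g (dact l v) = dact l (g v)).

Section Operators.
Variables (Q : quiver I) (S : cpa K Q) (M : dmod S).

Definition mact (u : cpa K Q) : space M -> space M := act u.
HB.instance Definition _ u := GRing.isLinear.Build K (space M) (space M) _
  (mact u) (act_linear (dmodP M) u).

Definition vact (l : {ffun I -> K}) : deco M -> deco M := dact l.
HB.instance Definition _ l := GRing.isLinear.Build K (deco M) (deco M) _
  (vact l) (dact_linear (dmodP M) l).

Lemma mactM u v m : mact (u * v) m = mact u (mact v m).
Proof. exact: (act_mul (dmodP M)). Qed.

Lemma mact_sum (T : Type) (r : seq T) (F : T -> cpa K Q) m :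
  mact (\sum_(i <- r) F i) m = \sum_(i <- r) mact (F i) m.
Proof.
have L := act_linear_l (dmodP M) m.
pose phi : {linear cpa K Q -> space M} := HB.pack (fun u => mact u m)
  (GRing.isLinear.Build K (cpa K Q) (space M) _ (fun u => mact u m) L).
exact: (raddf_sum phi).
Qed.

Lemma mact_cder b m : mact (cder S b) m = 0.
Proof.
apply: (act_jacobian (dmodP M)) => n; exists (cder S b).
  exists 1, (fun=> 1), (fun=> cder S b), (fun=> 1); split; first by exists b.
  by rewrite big_ord1 mul1r mulr1.
by move=> w _; rewrite subrr.
Qed.

(* M_j = e_j M *)
Definition at_vertex (j : I) : submodClosed (space M) := im (mact (idem K j)).

Lemma im_mact e u m : e * u = u -> mact u m \in im (mact e).
Proof. by move=> eu; apply/asboolP; exists (mact u m); rewrite -[LHS]mactM eu. Qed.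

(* The direct sum of the M_(g a), for a in F. *)
Section DirectSum.
Variables (F : finType) (g : F -> I).
Definition dsum : {pred {ffun F -> space M}} :=
  fun x => `[< forall a, x a \in at_vertex (g a) >].
Lemma dsum_closed : submod_closed dsum.
Proof.
split; first by apply/asboolP => a; rewrite ffunE rpred0.
move=> c x y /asboolP hx /asboolP hy; apply/asboolP => a.
by rewrite !ffunE rpredD ?rpredZ.
Qed.
HB.instance Definition _ := GRing.isSubmodClosed.Build K {ffun F -> space M}
  dsum dsum_closed.
End DirectSum.

End Operators.
End Representations.

Arguments mact {K I Q S} M u m.
Arguments vact {K I Q S} M l v.
Arguments at_vertex {K I Q S} M j.
Arguments dsum {K I Q S} M {F} g.

Section Premutation.
Variables (K : fieldType) (I : finType) (Q : quiver I) (S : cpa K Q).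
Variables (qpS : is_QP S) (k : I) (M : dmod S).
Notation mQ := (premut_quiver k Q).
Notation Mk := (subspace (at_vertex M k)).

Definition M_in := subspace (dsum M (fun a : in_arrow k Q => tl (val a))).
Definition M_out := subspace (dsum M (fun b : out_arrow k Q => hd (val b))).
HB.instance Definition _ := GRing.Lmodule.on M_in.
HB.instance Definition _ := GRing.Lmodule.on M_out.

Definition alpha_fun (x : M_in) : space M :=
  \sum_(a : in_arrow k Q) mact M (arr K (val a)) (val x a).
Lemma alpha_mem x : alpha_fun x \in at_vertex M k.
Proof.
apply: rpred_sum => a _; apply: im_mact.
have ha : hd (val a) = k := eqP (valP a).
by rewrite -[in idem K _]ha idem_arr.
Qed.
Definition alpha (x : M_in) : Mk := Subspace (alpha_mem x).
Lemma alpha_linear : linear alpha.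
Proof.
move=> c x y; apply: val_inj; rewrite linearP /= scaler_sumr -big_split.
by apply: eq_bigr => a _; rewrite !ffunE linearP.
Qed.
HB.instance Definition _ := GRing.isLinear.Build K M_in Mk _ alpha alpha_linear.

Definition beta_fun (m : Mk) : {ffun out_arrow k Q -> space M} :=
  [ffun b => mact M (arr K (val b)) (val m)].
Lemma beta_mem m : beta_fun m \in dsum M (fun b : out_arrow k Q => hd (val b)).
Proof. by apply/asboolP => b; rewrite ffunE; apply: im_mact; rewrite idem_arr. Qed.
Definition beta (m : Mk) : M_out := Subspace (beta_mem m).
Lemma beta_linear : linear beta.
Proof.
move=> c x y; apply: val_inj; apply/ffunP => b.
by rewrite linearP !ffunE /= linearP.
Qed.
HB.instance Definition _ := GRing.isLinear.Build K Mk M_out _ beta beta_linear.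

Definition gamma_fun (y : M_out) : {ffun in_arrow k Q -> space M} :=
  [ffun a => \sum_(b : out_arrow k Q) mact M (cder2 S (val b) (val a)) (val y b)].
Lemma gamma_mem y : gamma_fun y \in dsum M (fun a : in_arrow k Q => tl (val a)).
Proof.
apply/asboolP => a; rewrite ffunE; apply: rpred_sum => b _.
by apply: im_mact; rewrite idem_cder2.
Qed.
Definition gamma (y : M_out) : M_in := Subspace (gamma_mem y).
Lemma gamma_linear : linear gamma.
Proof.
move=> c x y; apply: val_inj; apply/ffunP => a.
rewrite linearP !ffunE /= scaler_sumr -big_split.
by apply: eq_bigr => b _; rewrite !ffunE linearP.
Qed.
HB.instance Definition _ := GRing.isLinear.Build K M_out M_in _ gamma gamma_linear.

Lemma alpha_gamma y : alpha (gamma y) = 0.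
Proof.
apply: val_inj; rewrite /= /alpha_fun.
under eq_bigr => a _ do rewrite /= ffunE linear_sum.
rewrite exchange_big big1 // => b _.
rewrite (eq_bigr (fun a : in_arrow k Q =>
  mact M (arr K (val a) * cder2 S (val b) (val a)) (val y b))); last first.
  by move=> a _; rewrite [RHS]mactM.
rewrite -[LHS]mact_sum sum_arr_cder2 ?mact_cder //.
exact/eqP/(valP b).
Qed.

Lemma gamma_mem_ker y : gamma y \in ker alpha.
Proof. by rewrite inE; apply/eqP; exact: alpha_gamma. Qed.

Definition ker_gamma := subspace (ker gamma).
Definition ker_alpha := subspace (ker alpha).
Definition ker_gamma_mod := quotient (within (ker gamma) (im beta)).
Definition ker_alpha_mod := quotient (within (ker alpha) (im gamma)).
Definition coker_beta := quotient (im beta).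
HB.instance Definition _ := GRing.Lmodule.on ker_gamma.
HB.instance Definition _ := GRing.Lmodule.on ker_alpha.
HB.instance Definition _ := GRing.Lmodule.on ker_gamma_mod.
HB.instance Definition _ := GRing.Lmodule.on ker_alpha_mod.
HB.instance Definition _ := GRing.Lmodule.on coker_beta.

Record splitting := Splitting {
  rho : {linear M_out -> ker_gamma};
  rhoK : forall x : ker_gamma, rho (val x) = x;
  sigma : {linear ker_alpha_mod -> ker_alpha};
  sigmaK : forall x, quotient_proj _ (sigma x) = x }.

Definition idem_fun : {ffun I -> K} := [ffun j => (j == k)%:R].
Definition V_k := subspace (im (vact M idem_fun)).
HB.instance Definition _ := GRing.Lmodule.on V_k.

Record bar_triangle := BarTriangle {
  bar_Mk : lmodType K;
  bar_alpha : M_out -> bar_Mk;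
  bar_beta : bar_Mk -> M_in }.

Definition gamma_im (y : M_out) : subspace (im gamma) :=
  @Subspace _ _ (im gamma) (gamma y) (asboolT (ex_intro _ y erefl)).
Definition gamma_ker (y : M_out) : ker_alpha := Subspace (gamma_mem_ker y).
Definition gamma_bar (q : coker_beta) : M_in := gamma (repr q).

Inductive description := DescA | DescB | DescC.

Definition bar_of (d : description) (s : splitting) : bar_triangle :=
  match d with
  | DescA => @BarTriangle
      (ker_gamma_mod * subspace (im gamma) * ker_alpha_mod * V_k)%type
      (fun y => (- quotient_proj _ (rho s y), - gamma_im y, 0, 0))
      (fun x => val x.1.1.2 + val (sigma s x.1.2))
  | DescB => @BarTriangle
      (ker_gamma_mod * ker_alpha * V_k)%type
      (fun y => (- quotient_proj _ (rho s y), - gamma_ker y, 0))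
      (fun x => val x.1.2)
  | DescC => @BarTriangle
      (coker_beta * ker_alpha_mod * V_k)%type
      (fun y => (- quotient_proj _ y, 0, 0))
      (fun x => gamma_bar x.1.1 + val (sigma s x.1.2))
  end.

(* e_{\hat k} M is the direct sum of the M_j for j != k. *)
Definition idem_hat (Q' : quiver I) : cpa K Q' := 1 - idem K k.
Definition M_hat := subspace (im (mact M (idem_hat Q))).
HB.instance Definition _ := GRing.Lmodule.on M_hat.
Definition to_hat (m : space M) : M_hat :=
  @Subspace _ _ (im (mact M (idem_hat Q)))
    (mact M (idem_hat Q) m) (asboolT (ex_intro _ m erefl)).

Section Action.
Variable B : bar_triangle.

Definition M_bar := (M_hat * bar_Mk B)%type.
HB.instance Definition _ := GRing.Lmodule.on M_bar.

Definition out_inj_fun (b : out_arrow k Q) (m : space M) :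
    {ffun out_arrow k Q -> space M} :=
  [ffun b' => if b' == b then mact M (idem K (hd (val b))) m else 0].
Lemma out_inj_mem b m :
  out_inj_fun b m \in dsum M (fun b : out_arrow k Q => hd (val b)).
Proof.
apply/asboolP => b'; rewrite ffunE; case: eqP => [->|_]; last exact: rpred0.
by apply/asboolP; exists m.
Qed.
Definition out_inj b m : M_out := Subspace (out_inj_mem b m).

Definition eta_arrow (x : arrow mQ) (m : M_bar) : M_bar :=
  match x with
  | Old c => (to_hat (mact M (arr K (val c)) (val m.1)), 0)
  | Comp b a => (to_hat (mact M (arr K (val b)) (mact M (arr K (val a)) (val m.1))), 0)
  | InStar a => (to_hat (val (bar_beta m.2) a), 0)
  | OutStar b => (0, bar_alpha B (out_inj b (val m.1)))
  end.
Definition eta_idem_k (z : K) (m : M_bar) : M_bar := (0, z *: m.2).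

Definition Theta (u : cpa K mQ) (m : M_bar) : M_bar :=
  (to_hat (mact M (psi S (kappa u)) (val m.1)), 0).

(* The components z, u_{\hat k}, v_a, w_b, x_(b,a) of u, such that
   u = z e_k + u_{\hat k} + sum_a v_a a^* + sum_b b^* w_b
       + sum_(a,b) b^* x_(b,a) a^*. *)
Section Components.
Variable u : cpa K mQ.
Definition comp_z : K := u (k, [::]).
Definition comp_hat : cpa K mQ := idem_hat mQ * u * idem_hat mQ.
Definition comp_v (a : in_arrow k Q) : cpa K mQ :=
  idem_hat mQ * rdiv (InStar a : arrow mQ) u.
Definition comp_w (b : out_arrow k Q) : cpa K mQ :=
  ldiv (OutStar b : arrow mQ) u * idem_hat mQ.
Definition comp_x (b : out_arrow k Q) (a : in_arrow k Q) : cpa K mQ :=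
  ldiv (OutStar b : arrow mQ) (rdiv (InStar a : arrow mQ) u).
End Components.

Definition eta_tilde (u : cpa K mQ) (m : M_bar) : M_bar :=
  eta_idem_k (comp_z u) m + Theta (comp_hat u) m
  + \sum_(a : in_arrow k Q) Theta (comp_v u a) (eta_arrow (InStar a) m)
  + \sum_(b : out_arrow k Q) eta_arrow (OutStar b) (Theta (comp_w u b) m)
  + \sum_(a : in_arrow k Q) \sum_(b : out_arrow k Q)
      eta_arrow (OutStar b) (Theta (comp_x u b a) (eta_arrow (InStar a) m)).
End Action.

Definition V_bar_k := quotient (within (ker beta) (im alpha)).
HB.instance Definition _ := GRing.Lmodule.on V_bar_k.
Definition V_hat := subspace (im (vact M (1 - idem_fun))).
HB.instance Definition _ := GRing.Lmodule.on V_hat.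
Definition V_bar := (V_hat * V_bar_k)%type.
HB.instance Definition _ := GRing.Lmodule.on V_bar.
Definition V_bar_act (l : {ffun I -> K}) (v : V_bar) : V_bar :=
  (@Subspace _ _ (im (vact M (1 - idem_fun)))
     (vact M (1 - idem_fun) (vact M l (val v.1)))
     (asboolT (ex_intro _ (vact M l (val v.1)) erefl)),
   l k *: v.2).

Definition premutation (d : description) (s : splitting) : drep K mQ :=
  @DRep K I mQ (M_bar (bar_of d s)) (@eta_tilde (bar_of d s)) V_bar V_bar_act.

End Premutation.

(* phi^# on the underlying module, with unchanged decoration. *)
Definition reduction (K : fieldType) (I : finType) (Q1 Q2 Q : quiver I)
    (phi : cpa K (quiver_sum Q1 Q2) -> cpa K Q) (M : drep K Q) : drep K Q1 :=
  @DRep K I Q1 (space M) (fun u m => act (phi (cpa_inl Q2 u)) m)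
    (deco M) (@dact K I Q M).

(* Main.v *)
(* Part (2).  A decorated module and its premutation carry the same data away
   from [k]: the action of [e_{\hat k} K<<Q>> e_{\hat k}] on [M_hat], the kernel
   of [alpha] in [M_in] and the image of [beta] in [M_out].  Conversely a triangle
   [A -> X -> B] is determined up to isomorphism by its composite, the kernel of
   the first map, the image of the second, and the dimension of the kernel of the
   second modulo the image of the first.  For [X = M_k] the last datum is
   [V_bar_k], and for [X = bar_Mk] it is [V_k], so both sides of the equivalence
   amount to an isomorphism of the data away from [k] together with isomorphisms
   of [V_bar_k], [V_k] and of the rest of the decoration.

   Part (1).  Every series over [Q_red + C] is a series over [Q_red] plus a series
   of paths through arrows of [C]; as [(C, T)] is trivial, [phi] maps the latter
   into [J(mu S)].  Hence a linear map commuting with the action of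
   [phi(K<<Q_red>>)] commutes with the whole action once [J(mu S)] is known to act
   as zero.  For the generators [p * r * q] this is a computation with the cyclic
   derivatives [r]; the passage to the closure cannot be done in [End(M_bar)],
   which carries no topology, and is done in the path algebra instead: the
   elements [u] whose matrix of components equals [L_r y_s + x_r R_s] modulo
   [J(S)], for some unknown series [x_r] and [y_s], form a closed subspace because
   path algebras are linearly compact. *)

From HB Require Import structures.
From mathcomp Require Import all_boot all_algebra.
From mathcomp Require Import boolp classical_sets functions.
Require Import Defs.

Set Implicit Arguments.
Unset Strict Implicit.
Unset Printing Implicit Defensive.

Import GRing.Theory.
Local Open Scope ring_scope.

(** * Linear algebra *)

(** Since no dimension is assumed finite, complements, sections and lifts come from Zorn's lemma,
    and the isomorphisms of [V_k] and [V_bar_k] are carried along as maps rather than as equal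
    dimensions. The descriptions A, B, C and the splittings enter only through [dual_triangle], so
    that the two modules may use different ones. The main obstacle in part (1) is that the composite
    [chi] of [psi] and [kappa] is multiplicative only across a cut at a vertex other than [k]: a cut
    at [k] separates a^* from b^*. In a product p r q with r the derivative at a^* or b^*, one cut
    lies at [k]; the neighbouring star is pulled across that cut, and [psi] turns the resulting sum
    into a derivative of S. What remains is the term in which p or q is trivial at [k], the origin
    of the corrections L_r y_s and x_r R_s. Having no 2-cycles forces the cycles of S to have length
    at least 3, so that the values of [psi] on arrows lie in the arrow ideal; it also keeps the
    premuted quiver loop-free, whence the inverse of phi is continuous. *)

Section LinearAlgebra.
Variable K : fieldType.
Implicit Types U W X A B : lmodType K.

Definition lin_of U W (f : U -> W) (L : linear f) : {linear U -> W} :=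
  HB.pack f (GRing.isLinear.Build K U W _ f L).

Lemma linear_bundle U W (f : U -> W) : linear f -> exists g : {linear U -> W}, g =1 f.
Proof. by move=> L; exists (lin_of L). Qed.

Lemma mem_im U W (f : {linear U -> W}) x : f x \in im f.
Proof. by apply/asboolP; exists x. Qed.

(** A maximal subspace [C] meeting [A] only in 0 is a complement of [A], and [r] is the projection
    along [C]. *)
Lemma retraction U (A : submodClosed U) :
  exists r : {linear U -> U}, (forall u, r u \in A) /\ {in A, r =1 id}.
Proof.
(* [P] does not ask for 0, so that the union of the empty chain satisfies it; [C0] recovers 0 from
   maximality. *)
pose P (X : set U) := (forall c x y, X x -> X y -> X (c *: x + y)) /\
  (forall x, X x -> x \in A -> x = 0).
have [C [[Clin CA] Cmax]] : exists C, P C /\ forall D : set U, (C `<` D)%classic -> ~ P D.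
  apply: Zorn_bigcup => F FP Ftot; split; last first.
    by move=> x [X FX Xx]; apply: (FP _ FX).2.
  move=> c x y [X FX Xx] [Y FY Yy].
  have [XY|YX] := Ftot _ _ FX FY.
    by exists Y => //; apply: (FP _ FY).1 => //; apply: XY.
  by exists X => //; apply: (FP _ FX).1 => //; apply: YX.
have C0 : C 0.
  apply: contrapT => nC0; apply: (Cmax (C `|` [set 0])%classic).
    by split=> [x|/(_ 0)]; [left | move=> h; apply/nC0/h; right].
  have CN x : ~ C x.
    by move=> Cx; apply: nC0; rewrite -[0](addNr x) -[- x]scaleN1r; exact: Clin.
  split; last by move=> x [/CN|].
  by move=> c x y [/CN//|->] [/CN//|->]; right; rewrite scaler0 add0r.
have CD x y : C x -> C y -> C (x + y).
  by move=> Cx Cy; rewrite -[x]scale1r; exact: Clin.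
have CZ c x : C x -> C (c *: x) by move=> Cx; rewrite -[_ *: x]addr0; exact: Clin.
have CB x y : C x -> C y -> C (x - y).
  by move=> Cx Cy; apply: CD => //; rewrite -scaleN1r; apply: CZ.
(* If [u] were outside [A + C], then [C + K u] would be strictly larger than [C] and still meet [A]
   only in 0. *)
have dec u : exists a, a \in A /\ C (u - a).
  apply: contrapT => nex; apply: (Cmax [set x | exists c, C (x - c *: u)]%classic).
    split=> [x Cx|/(_ u) h]; first by exists 0; rewrite scale0r subr0.
    apply: nex; exists 0; rewrite rpred0 subr0; split=> //; apply: h.
    by exists 1; rewrite scale1r subrr.
  split=> [c x y [d Cx] [e Cy]|x [c Cx] xA].
    exists (c * d + e); rewrite scalerDl -scalerA opprD addrACA -scalerBr.
    exact: Clin.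
  have [c0|cN0] := eqVneq c 0; first by apply: CA => //; rewrite c0 scale0r subr0 in Cx.
  case: nex; exists (c^-1 *: x); split; first exact: rpredZ.
  have := CZ (- c^-1) _ Cx; rewrite scalerBr !scaleNr scalerA mulVf // scale1r.
  by rewrite opprK addrC.
have uni u a a' : a \in A -> a' \in A -> C (u - a) -> C (u - a') -> a = a'.
  move=> aA a'A Ca Ca'; apply/eqP; rewrite -subr_eq0; apply/eqP; apply: CA.
    have -> : a - a' = (u - a') - (u - a) by rewrite opprB [RHS]addrC addrA subrK.
    exact: CB.
  by rewrite -scaleN1r rpredD ?rpredZ.
have [r rP] := choice dec.
have rlin : linear r.
  move=> c x y; apply: (uni (c *: x + y)); first exact: (rP _).1.
  - by rewrite rpredD ?rpredZ ?(rP _).1.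
  - exact: (rP _).2.
  rewrite opprD addrACA -scalerBr; apply: CD; last exact: (rP _).2.
  by apply: CZ; exact: (rP _).2.
exists (lin_of rlin); split=> [u|u uA]; first exact: (rP _).1.
by apply: (uni u) => //; rewrite ?(rP _).1 ?subrr //; exact: (rP _).2.
Qed.

(** Preimages are chosen arbitrarily for the projection onto [im f]; removing their component in
    [ker f] makes the choice linear, because [x - r x] depends only on [f x]. *)
Lemma generalized_inverse U W (f : {linear U -> W}) :
  exists g : {linear W -> U}, forall x, f (g (f x)) = f x.
Proof.
have [r [rk rid]] := retraction (ker f).
have [q [qi qid]] := retraction (im f).
have fq w : exists u, f u = q w by apply/asboolP/qi.
have [h hP] := choice fq.
have rh x y : f x = f y -> x - r x = y - r y.
  move=> e; have /rid : x - y \in ker f by rewrite inE linearB e subrr.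
  rewrite linearB /= => e'; apply/eqP.
  by rewrite subr_eq -addrA [- r y + _]addrC e' addrC subrK.
have glin : linear (fun w => h w - r (h w)).
  move=> c w w'; rewrite (rh _ (c *: h w + h w')); last by rewrite linearP !hP linearP.
  by rewrite linearP /= opprD addrACA scalerBr.
exists (lin_of glin) => x /=; rewrite linearB /= hP qid ?mem_im //.
by have := rk (h (f x)); rewrite inE => /eqP ->; rewrite subr0.
Qed.

Lemma linear_section U W (f : {linear U -> W}) : (forall w, exists u, f u = w) ->
  exists g : {linear W -> U}, cancel g f.
Proof.
move=> fs; have [g gP] := generalized_inverse f; exists g => w.
by have [u <-] := fs w; exact: gP.
Qed.

Lemma inverse_linear U W (f : {linear U -> W}) (g : W -> U) :
  cancel f g -> cancel g f -> linear g.
Proof. by move=> fK gK c x y; apply: (can_inj fK); rewrite linearP !gK. Qed.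

Lemma quotient_iso U W U' W' (p : {linear U -> W}) (p' : {linear U' -> W'})
    (f : {linear U -> U'}) :
  (forall w, exists u, p u = w) -> (forall w, exists u, p' u = w) ->
  bijective f -> (forall u, p u = 0 <-> p' (f u) = 0) ->
  exists g : {linear W -> W'}, bijective g.
Proof.
move=> ps ps' [f' fK f'K] ke.
have [s sK] := linear_section ps; have [s' s'K] := linear_section ps'.
have L' := inverse_linear fK f'K.
pose g w := p' (f (s w)); have gL : linear g by move=> c x y; rewrite /g !linearP.
exists (lin_of gL); exists (fun w => p (f' (s' w))) => w /=.
  apply/eqP; rewrite -subr_eq0 -{2}(sK w) -linearB; apply/eqP/ke.
  by rewrite linearB /= f'K linearB s'K subrr.
apply/eqP; rewrite -subr_eq0 -{2}(s'K w) -linearB /=; apply/eqP.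
rewrite -[s' w]f'K -linearB; apply/ke.
by rewrite linearB sK f'K subrr.
Qed.

(* With [s] a section of [p], the map is forced on [im alpha + im s]; it is
   extended by lifting [fB \o beta] along [beta'], which is possible because
   [fB] maps [im beta] into [im beta']. *)
Lemma triangle_iso A B A' B' X X' W W'
    (alpha : {linear A -> X}) (beta : {linear X -> B})
    (alpha' : {linear A' -> X'}) (beta' : {linear X' -> B'})
    (p : {linear subspace (ker beta) -> W})
    (p' : {linear subspace (ker beta') -> W'})
    (fA : {linear A -> A'}) (fB : {linear B -> B'}) (g : {linear W -> W'}) :
  bijective fA -> bijective fB -> bijective g ->
  (forall w, exists x, p x = w) -> (forall x, p x = 0 <-> val x \in im alpha) ->
  (forall w, exists x, p' x = w) -> (forall x, p' x = 0 <-> val x \in im alpha') ->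
  (forall a, fB (beta (alpha a)) = beta' (alpha' (fA a))) ->
  (forall a, alpha a = 0 <-> alpha' (fA a) = 0) ->
  (forall b, b \in im beta <-> fB b \in im beta') ->
  exists2 f : {linear X -> X'}, bijective f &
    (forall a, f (alpha a) = alpha' (fA a)) /\ (forall x, beta' (f x) = fB (beta x)).
Proof.
move=> [fA' fAK fA'K] [fB' fBK fB'K] [g' gK g'K] ps pk ps' pk' eAB eA eB.
have [s sK] := linear_section ps; have [s' s'K] := linear_section ps'.
have bs w : beta (val (s w)) = 0.
  by have := subspace_mem (s w); rewrite inE => /eqP.
have bs' w : beta' (val (s' w)) = 0.
  by have := subspace_mem (s' w); rewrite inE => /eqP.
pose iota (y : A * W) := alpha y.1 + val (s y.2).
pose kappa (y : A * W) := alpha' (fA y.1) + val (s' (g y.2)).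
have iL : linear iota.
  by move=> c x y; rewrite /iota !linearP /= scalerDr addrACA.
have kL : linear kappa.
  by move=> c x y; rewrite /kappa !linearP /= scalerDr addrACA.
have [I IE] := linear_bundle iL; have [Kp KE] := linear_bundle kL.
(* A relation [alpha a + s w = 0] puts [s w] in [im alpha], so [w = p (s w) = 0], and only the
   condition [alpha a = 0] is left to be transported by [eA]. *)
have ik y : I y = 0 <-> Kp y = 0.
  have sub0 (V V' : lmodType K) (f : {linear V -> V'}) (v : subspace (ker f)) (u : V) :
      u + val v = 0 -> val v = - u.
    by move/eqP; rewrite addrC addr_eq0 => /eqP.
  rewrite IE KE; split=> /[dup] /sub0 e.
    have w0 : y.2 = 0.
      rewrite -[LHS]sK; apply/pk; rewrite e; apply/asboolP.
      by exists (- y.1); rewrite linearN.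
    rewrite /iota /kappa w0 !linear0 !addr0; exact: (eA _).1.
  have w0 : y.2 = 0.
    apply: (can_inj gK); rewrite linear0 -[LHS]s'K; apply/pk'; rewrite e; apply/asboolP.
    by exists (- fA y.1); rewrite linearN.
  rewrite /iota /kappa w0 !linear0 !addr0; exact: (eA _).2.
have [j jP] := generalized_inverse I; have [t tP] := generalized_inverse beta'.
have hL : linear (fun x => x - I (j x)).
  by move=> c x y; rewrite [j _]linearP [I _]linearP opprD addrACA -scalerBr.
have [h hE] := linear_bundle hL; pose f x := Kp (j x) + t (fB (beta (h x))).
have fL : linear f.
  move=> c x y; rewrite /f [h _]linearP [j _]linearP !linearP.
 by rewrite scalerDr addrACA.
have bI y : beta (I y) = beta (alpha y.1) by rewrite IE /iota linearD /= bs addr0.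
have bK y : beta' (Kp y) = fB (beta (I y)).
  by rewrite bI KE /kappa linearD /= bs' addr0 eAB.
(* [j] is only a generalized inverse: [j (I y)] and [y] differ by an element of the kernel of [I],
   which [ik] identifies with the kernel of [Kp]. *)
have fI y : f (I y) = Kp y.
  rewrite /f hE jP subrr !linear0 addr0; apply/eqP; rewrite -subr_eq0 -linearB.
  by apply/eqP/ik; rewrite linearB jP subrr.
have bf x : beta' (f x) = fB (beta x).
  have /asboolP[x' e] : fB (beta (h x)) \in im beta' by apply/eB/mem_im.
  by rewrite /f linearD bK -e tP e -linearD -linearD hE addrC subrK.
have kI x : beta x = 0 -> exists y, x = I y.
  move=> bx; have xk : x \in ker beta by rewrite inE bx.
  pose x0 := Subspace xk.
  have : p (x0 - s (p x0)) = 0 by rewrite linearB sK subrr.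
  move/pk => /asboolP[a e]; exists (a, p x0); rewrite IE /iota /= e.
  by rewrite linearB /= subrK.
have kK x : beta' x = 0 -> exists y, x = Kp y.
  move=> bx; have xk : x \in ker beta' by rewrite inE bx.
  pose x0 := Subspace xk.
  have : p' (x0 - s' (p' x0)) = 0 by rewrite linearB s'K subrr.
  move/pk' => /asboolP[a e]; exists (fA' a, g' (p' x0)); rewrite KE /kappa /= fA'K g'K e.
  by rewrite linearB /= subrK.
have [F fE] := linear_bundle fL.
have finj : injective f.
  move=> x y e; apply/eqP; rewrite -subr_eq0; apply/eqP.
  have fz : f (x - y) = 0 by rewrite -fE linearB !fE e subrr.
  have : beta (x - y) = 0 by apply: (can_inj fBK); rewrite -bf fz !linear0.
  by case/kI => z ez; move: fz; rewrite ez fI => /ik.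
have fsur x' : exists x, f x = x'.
  have /eB/asboolP[x ex] : fB (fB' (beta' x')) \in im beta' by rewrite fB'K mem_im.
  have /kK[y ey] : beta' (x' - f x) = 0 by rewrite linearB bf ex fB'K subrr.
  by exists (x + I y); rewrite -fE linearD !fE fI -ey addrC subrK.
have [f' f'K] := choice fsur.
exists F; first by exists f' => x; rewrite ?fE //; apply: finj; rewrite f'K.
split=> [a|x]; last by rewrite fE bf.
by have := fI (a, 0); rewrite IE KE /iota /kappa /= !linear0 !addr0 fE.
Qed.

End LinearAlgebra.

(** * Continuous linear maps of complete path algebras *)

Section Topology.
Variables (K : fieldType) (I : finType).
Implicit Types Q : quiver I.

Notation tail j s := (last j (map (@tl I _) s)).

Lemma in_mpowS Q n m (u : cpa K Q) : (n <= m)%N -> in_mpow m u -> in_mpow n u.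
Proof. by move=> le hu w ltw; apply: hu; apply: leq_trans le. Qed.

Lemma in_mpow0 Q n : in_mpow n (0 : cpa K Q). Proof. by []. Qed.

Lemma in_mpowP Q n c (u v : cpa K Q) :
  in_mpow n u -> in_mpow n v -> in_mpow n (c *: u + v).
Proof. by move=> hu hv w lw; rewrite coefD coefZ hu // hv // mulr0 addr0. Qed.

Lemma in_mpowD Q n (u v : cpa K Q) : in_mpow n u -> in_mpow n v -> in_mpow n (u + v).
Proof. by rewrite -{2}[u]scale1r; exact: in_mpowP. Qed.

Lemma in_mpowZ Q n c (u : cpa K Q) : in_mpow n u -> in_mpow n (c *: u).
Proof. by move=> hu; rewrite -[_ *: u]addr0; exact: in_mpowP. Qed.

Lemma in_mpowN Q n (u : cpa K Q) : in_mpow n u -> in_mpow n (- u).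
Proof. by rewrite -scaleN1r; exact: in_mpowZ. Qed.

Lemma in_mpow_sum Q n (T : Type) (r : seq T) (P : pred T) (F : T -> cpa K Q) :
  (forall i, P i -> in_mpow n (F i)) -> in_mpow n (\sum_(i <- r | P i) F i).
Proof.
by move=> h; elim/big_ind: _ => // u v; exact: in_mpowD.
Qed.

Lemma in_mpowM Q n m (u v : cpa K Q) :
  in_mpow n u -> in_mpow m v -> in_mpow (n + m) (u * v).
Proof.
move=> hu hv w lw; rewrite coefM; apply: big1 => i _.
have [li|li] := ltnP i n.
  by rewrite hu ?mul0r //= size_take_min gtn_min li.
rewrite [X in _ * X]hv ?mulr0 //= size_drop ltn_subLR; last by rewrite -ltnS.
by apply: (leq_trans lw); rewrite leq_add2r.
Qed.

Lemma in_mpowMl Q n (u v : cpa K Q) : in_mpow n v -> in_mpow n (u * v).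
Proof. by rewrite -[n]add0n; apply: in_mpowM => w. Qed.

Lemma in_mpowMr Q n (u v : cpa K Q) : in_mpow n u -> in_mpow n (u * v).
Proof. by move=> hu; rewrite -[n]addn0; apply: in_mpowM => // w. Qed.

Lemma in_mpow_eq0 Q (u : cpa K Q) : (forall n, in_mpow n u) -> u = 0.
Proof. by move=> h; apply: cpaP => j s _; rewrite (h (size s).+1) /=. Qed.

Lemma in_mpow_prod Q Q' (f : arrow Q -> cpa K Q') s :
  (forall x, in_mpow 1 (f x)) -> in_mpow (size s) (\prod_(x <- s) f x).
Proof.
move=> hf; elim: s => [|c s IH] /=; first by move=> w.
by rewrite big_cons -add1n; apply: in_mpowM.
Qed.

Lemma in_mpow_monomial Q (w : word Q) : in_mpow (size w.2) (monomial K w).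
Proof.
move=> w' lw; rewrite coef_monomial; case: eqP lw => // ->.
by rewrite ltnn.
Qed.

(* Continuity is for the [m]-adic topologies. *)
Definition clin Q Q' (F : cpa K Q -> cpa K Q') :=
  linear F /\ (forall n, exists N, forall u, in_mpow N u -> in_mpow n (F u)).

Definition closed_subspace Q (X : cpa K Q -> Prop) :=
  [/\ X 0, (forall c u v, X u -> X v -> X (c *: u + v)) & forall u, mclosure X u -> X u].

Lemma clin0 Q Q' (F : cpa K Q -> cpa K Q') : clin F -> F 0 = 0.
Proof. by case=> /linear_bundle[G GE] _; rewrite -GE linear0. Qed.

Lemma eq_clin Q Q' (F G : cpa K Q -> cpa K Q') : F =1 G -> clin F -> clin G.
Proof. by move/funext ->. Qed.

Lemma clin_id Q : clin (@id (cpa K Q)).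
Proof. by split=> // n; exists n. Qed.

Lemma clin_cst0 Q Q' : clin (fun _ : cpa K Q => 0 : cpa K Q').
Proof. by split=> [c u v|n]; [rewrite scaler0 addr0 | exists 0%N => u _; exact: in_mpow0]. Qed.

Lemma clin_comp Q1 Q2 Q3 (F : cpa K Q2 -> cpa K Q3) (G : cpa K Q1 -> cpa K Q2) :
  clin F -> clin G -> clin (fun u => F (G u)).
Proof.
move=> [LF hF] [LG hG]; split=> [c u v|n]; first by rewrite LG LF.
by have [m hm] := hF n; have [p hp] := hG m; exists p => u /hp/hm.
Qed.

Lemma clinP Q Q' c (F G : cpa K Q -> cpa K Q') :
  clin F -> clin G -> clin (fun u => c *: F u + G u).
Proof.
move=> [LF hF] [LG hG]; split=> [d u v|n].
  by rewrite LF LG !scalerDr !scalerA mulrC addrACA.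
have [m hm] := hF n; have [p hp] := hG n; exists (maxn m p) => u hu.
by apply: in_mpowP; [apply: hm | apply: hp]; apply: in_mpowS hu; rewrite leq_max leqnn ?orbT.
Qed.

Lemma clinD Q Q' (F G : cpa K Q -> cpa K Q') :
  clin F -> clin G -> clin (fun u => F u + G u).
Proof.
by move=> hF hG; apply: eq_clin (clinP 1 hF hG) => u; rewrite scale1r.
Qed.

Lemma clinB Q Q' (F G : cpa K Q -> cpa K Q') :
  clin F -> clin G -> clin (fun u => F u - G u).
Proof.
by move=> hF hG; apply: eq_clin (clinP (-1) hG hF) => u; rewrite scaleN1r addrC.
Qed.

Lemma clin_sum Q Q' (T : Type) (r : seq T) (F : T -> cpa K Q -> cpa K Q') :
  (forall i, clin (F i)) -> clin (fun u => \sum_(i <- r) F i u).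
Proof.
move=> h; elim: r => [|i r IH].
  by apply: eq_clin (clin_cst0 Q Q') => u; rewrite big_nil.
by apply: eq_clin (clinD (h i) IH) => u; rewrite big_cons.
Qed.

Lemma scaleMl Q c (u v : cpa K Q) : (c *: u) * v = c *: (u * v).
Proof. by apply: cpaP => j s _; rewrite coefM coefZ -convZl. Qed.

Lemma scaleMr Q c (u v : cpa K Q) : u * (c *: v) = c *: (u * v).
Proof. by apply: cpaP => j s _; rewrite coefM coefZ -convZr. Qed.

Lemma clinMl Q (x : cpa K Q) : clin (fun u => x * u).
Proof.
split=> [c u v|n]; first by rewrite mulrDr scaleMr.
by exists n => u; exact: in_mpowMl.
Qed.

Lemma clinMr Q (x : cpa K Q) : clin (fun u => u * x).
Proof.
split=> [c u v|n]; first by rewrite mulrDl scaleMl.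
by exists n => u; exact: in_mpowMr.
Qed.

Definition truncation Q n (u : cpa K Q) : cpa K Q :=
  \sum_(d < n) \sum_(j : I) \sum_(p : d.-tuple (arrow Q)) (u (j, val p) : K) *: monomial K (j, val p).

Lemma big_tuple_pick (T : finType) (s : seq T) d (F : seq T -> K) :
  \sum_(p : d.-tuple T) (if s == val p then F (val p) else 0) =
  if size s == d then F s else 0.
Proof.
have [<-|ne] := eqVneq.
  by rewrite -big_mkcond (big_pred1 (in_tuple s)).
by rewrite big1 // => p _; case: (s =P _) => // e; rewrite e size_tuple eqxx in ne.
Qed.

Lemma big_word_pick Q n (j : I) (s : seq (arrow Q)) (F : word Q -> K) :
  \sum_(d < n) \sum_(i : I) \sum_(p : d.-tuple (arrow Q))
     (if (j, s) == (i, val p) then F (i, val p) else 0) =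
  if (size s < n)%N then F (j, s) else 0.
Proof.
transitivity (\sum_(d < n) if size s == d then F (j, s) else 0).
  apply: eq_bigr => d _; rewrite (bigD1 j) //= [X in _ + X]big1 ?addr0.
    rewrite -[RHS](big_tuple_pick s d (fun p => F (j, p))).
    by apply: eq_bigr => p _; rewrite xpair_eqE eqxx.
  by move=> i ne; apply: big1 => p _; rewrite xpair_eqE eq_sym (negbTE ne).
rewrite -big_mkcond /=; have [lt|ge] := ltnP.
  by rewrite (big_pred1 (Ordinal lt)) // => d; rewrite /= -val_eqE eq_sym.
by rewrite big_pred0 // => d; apply/eqP => e; move: ge; rewrite e leqNgt ltn_ord.
Qed.

Lemma coef_truncation Q n (u : cpa K Q) w :
  truncation n u w = if (size w.2 < n)%N then u w else 0.
Proof.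
case: w => j s; rewrite -(big_word_pick n j s u) coef_sum; apply: eq_bigr => d _.
rewrite coef_sum; apply: eq_bigr => i _; rewrite coef_sum; apply: eq_bigr => p _.
rewrite coefZ coef_monomial; case: eqP => [<-|_]; last by rewrite mulr0.
by have [_|/coef0P ->] := boolP (is_path _); rewrite ?mulr1 ?mul0r.
Qed.

Lemma truncationP Q n (u : cpa K Q) : in_mpow n (u - truncation n u).
Proof. by move=> w lw; rewrite coefD coefN coef_truncation lw subrr. Qed.

Lemma subspace_sum Q (X : cpa K Q -> Prop) (T : Type) (r : seq T) (F : T -> cpa K Q) :
  closed_subspace X -> (forall i, X (F i)) -> X (\sum_(i <- r) F i).
Proof.
case=> X0 XP _ h; elim/big_ind: _ => // u v; rewrite -{2}[u]scale1r; exact: XP.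
Qed.

(** The truncations of [u] are finite combinations of the paths in its support, and their images
    converge to [F u]. Restricting to the support allows induction on the cycles of a potential. *)
Lemma clin_ind Q Q' (F : cpa K Q -> cpa K Q') (X : cpa K Q' -> Prop) (u : cpa K Q) :
  clin F -> closed_subspace X ->
  (forall w, u w != 0 -> is_path w -> X (F (monomial K w))) -> X (F u).
Proof.
move=> cF cX h; have [X0 XP Xcl] := cX; have [LF CF] := cF; apply: Xcl => n.
have [N hN] := CF n; have [G GE] := linear_bundle LF.
exists (F (truncation N u)); last by rewrite -!GE -linearB GE; apply/hN/truncationP.
rewrite -GE linear_sum; apply: subspace_sum => // d.
rewrite linear_sum; apply: subspace_sum => // j.
rewrite linear_sum; apply: subspace_sum => // p.
rewrite linearZ GE /= -[_ *: _]addr0; have [u0|un0] := eqVneq (u (j, val p)) 0.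
  by rewrite u0 scale0r addr0.
apply: XP => //; apply: h => //; apply: contraNT un0.
by move/coef0P ->.
Qed.

Lemma closed_subspace0 Q : closed_subspace (fun u : cpa K Q => u = 0).
Proof.
split=> // [c u v -> ->|u cu]; first by rewrite scaler0 addr0.
by apply: in_mpow_eq0 => n; have [v -> ] := cu n; rewrite subr0.
Qed.

Lemma clin_eq Q Q' (F G : cpa K Q -> cpa K Q') (u : cpa K Q) : clin F -> clin G ->
  (forall w, u w != 0 -> is_path w -> F (monomial K w) = G (monomial K w)) -> F u = G u.
Proof.
move=> cF cG h; apply/eqP; rewrite -subr_eq0; apply/eqP.
apply: (clin_ind (F := fun u => F u - G u) (X := fun v => v = 0)) => [||w uw pw].
- exact: clinB.
- exact: closed_subspace0.
- by rewrite h // subrr.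
Qed.

Lemma monomial0 Q (w : word Q) : ~~ is_path w -> monomial K w = 0.
Proof.
move=> nw; apply: cpaP => j s _; rewrite coef_monomial (negbTE nw) andbF.
by [].
Qed.

Lemma idem_monomial Q j (w : word Q) : idem K j * monomial K w = if w.1 == j then monomial K w else 0.
Proof.
case: w => i' s'; apply: cpaP => i s _; rewrite idemM coef_monomial /= xpair_eqE.
have [<-|ne] := eqVneq i' j.
  by rewrite coef_monomial xpair_eqE; case: (i == i').
have [->|//] := eqVneq i j.
by rewrite eq_sym (negbTE ne).
Qed.

Lemma idem_idem Q i j : idem K i * idem K j = (if j == i then idem K j else 0) :> cpa K Q.
Proof. exact: idem_monomial. Qed.

Lemma monomial_cons Q j c (s : seq (arrow Q)) :
  monomial K (j, c :: s) = if hd c == j then arr K c * monomial K (tl c, s) else 0.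
Proof.
case: eqP => [hc|/eqP hc]; last by rewrite monomial0 // /is_path /= (negbTE hc).
apply: cpaP => i t wt; rewrite arrM coef_monomial xpair_eqE /is_path /= hc eqxx /=.
case: t wt => [|x t] /=; first by rewrite andbF.
rewrite /monomial_coef xpair_eqE eqxx eqseq_cons => _ /=.
by case: (i == j); case: (x == c); rewrite ?mulr1n ?mulr0n ?andbT ?andbF.
Qed.

Lemma idem_sum Q : \sum_j idem K j = 1 :> cpa K Q.
Proof.
apply: cpaP => i s _; rewrite coef_sum; transitivity (one_coef K (i, s)) => //.
rewrite (bigD1 i) //= big1 ?addr0 => [|j ne].
  by rewrite /monomial_coef /one_coef xpair_eqE eqxx andbT.
by rewrite /monomial_coef xpair_eqE eq_sym (negbTE ne).
Qed.

Lemma monomial_cat Q j (s s' : seq (arrow Q)) : walk j s ->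
  monomial K (j, s ++ s') = monomial K (j, s) * monomial K (tail j s, s').
Proof.
elim: s j => [|c s IH] j /=; first by rewrite idem_monomial eqxx.
case/andP=> /eqP <- ws; rewrite !monomial_cons eqxx IH //.
exact: mulrA.
Qed.

Lemma monomial_idem Q (w : word Q) : monomial K w * idem K (word_tl w) = monomial K w.
Proof.
have [pw|npw] := boolP (is_path w); last by rewrite monomial0 // mul0r.
by case: w pw => j s ws; rewrite -[RHS](f_equal (fun s => monomial K (j, s)) (cats0 s)) monomial_cat.
Qed.

Lemma monomial_idem0 Q (w : word Q) j : j != word_tl w -> monomial K w * idem K j = 0.
Proof. by move=> ne; rewrite -monomial_idem -mulrA idem_idem (negbTE ne) mulr0. Qed.

Lemma monomialM0 Q (w w' : word Q) :
  w'.1 != word_tl w -> monomial K w * monomial K w' = 0.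
Proof.
move=> ne; have -> : monomial K w' = idem K w'.1 * monomial K w' by rewrite idem_monomial eqxx.
by rewrite mulrA monomial_idem0 // mul0r.
Qed.

Lemma monomialM Q (w w' : word Q) : monomial K w * monomial K w' =
  if is_path w && (w'.1 == word_tl w) then monomial K (w.1, w.2 ++ w'.2) else 0.
Proof.
have [pw|/monomial0 ->] := boolP (is_path w); last by rewrite mul0r.
case: eqP => [e|/eqP]; last exact: monomialM0.
by case: w w' pw e => j s [j' s'] ws /= ->; rewrite monomial_cat.
Qed.

Lemma arr_idem Q (c : arrow Q) : arr K c * idem K (tl c) = arr K c.
Proof. exact: (monomial_idem (hd c, [:: c])). Qed.

Lemma in_mpow_arr Q (c : arrow Q) : in_mpow 1 (arr K c).
Proof. exact: (@in_mpow_monomial Q (hd c, [:: c])). Qed.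

Lemma monomial_prod Q j (s : seq (arrow Q)) : walk j s ->
  monomial K (j, s) = idem K j * \prod_(x <- s) arr K x.
Proof.
elim: s j => [|c s IH] j /=; first by rewrite big_nil mulr1.
case/andP=> /eqP <- ws; rewrite monomial_cons eqxx IH // big_cons.
by rewrite !mulrA idem_arr arr_idem.
Qed.

End Topology.

Local Notation tail j s := (last j (map (@tl _ _) s)).

(** * Homomorphisms and cyclic derivatives *)

Section Homomorphisms.
Variables (K : fieldType) (I : finType).
Implicit Types Q : quiver I.

Record alg_hom Q Q' (h : cpa K Q -> cpa K Q') : Prop := AlgHom {
  hom_clin : clin h;
  hom_mul : forall u v, h (u * v) = h u * h v;
  hom_idem : forall j, h (idem K j) = idem K j;
  hom_arr : forall x, in_mpow 1 (h (arr K x)) }.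

Lemma hom_monomial Q Q' (h : cpa K Q -> cpa K Q') (w : word Q) : alg_hom h -> is_path w ->
  h (monomial K w) = idem K w.1 * \prod_(x <- w.2) h (arr K x).
Proof.
move=> hh; case: w => j s; rewrite /is_path /=; elim: s j => [|c s IH] j /=; first by rewrite big_nil mulr1 (hom_idem hh).
case/andP=> /eqP <- ws; rewrite monomial_cons eqxx (hom_mul hh) IH // big_cons !mulrA.
rewrite -(hom_idem hh (tl c)) -(hom_mul hh) arr_idem; congr (_ * _).
by rewrite -{1}(idem_arr K c) (hom_mul hh) (hom_idem hh).
Qed.

Lemma hom_mpow Q Q' (h : cpa K Q -> cpa K Q') n (u : cpa K Q) : alg_hom h ->
  in_mpow n u -> in_mpow n (h u).
Proof.
move=> hh hu; apply: (clin_ind (X := @in_mpow _ _ _ n) (hom_clin hh)).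
  split=> [|c v v'|v cv]; [exact: in_mpow0 | exact: in_mpowP |].
  move=> w lw; have [v' hv' hd] := cv n.
  by rewrite -(subrK v' v) coefD hd // hv' // addr0.
move=> w uw pw; apply: (@in_mpowS _ _ _ n (size w.2)).
  by rewrite leqNgt; apply: contra uw => /hu ->.
rewrite hom_monomial //; apply: in_mpowMl; exact/in_mpow_prod/(hom_arr hh).
Qed.

Record admissible Q Q' (f : arrow Q -> cpa K Q') : Prop := Admissible {
  adm_mpow : forall x, in_mpow 1 (f x);
  adm_hd : forall x, idem K (hd x) * f x = f x;
  adm_tl : forall x, f x * idem K (tl x) = f x }.

Section Substitution.
Variables (Q Q' : quiver I) (f : arrow Q -> cpa K Q').

Lemma clin_subst : clin (subst f).
Proof.
split=> [c u v|n]; last first.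
  exists n => u hu w lw; apply: big1 => d _; apply: big1 => j _; apply: big1 => p _.
  by rewrite hu ?mul0r //= size_tuple (leq_trans (ltn_ord d)).
apply: cpaP => i t _; rewrite coefD coefZ.
have E x : subst f x (i, t) = \sum_(d < (size t).+1) \sum_(j : I)
  \sum_(p : d.-tuple (arrow Q)) x (j, val p) * (idem K j * \prod_(x <- p) f x) (i, t) by [].
rewrite !E big_distrr -big_split; apply: eq_bigr => d _.
rewrite /= big_distrr -big_split; apply: eq_bigr => j _.
rewrite /= big_distrr -big_split; apply: eq_bigr => p _.
by rewrite /= mulrA -mulrDl.
Qed.

Hypothesis fP : admissible f.

Lemma subst_monomial w : is_path w ->
  subst f (monomial K w) = idem K w.1 * \prod_(x <- w.2) f x.
Proof.
case: w => j s pw; apply: cpaP => i t _ /=; rewrite /subst_coef.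
pose F (w : word Q) := (idem K w.1 * \prod_(x <- w.2) f x : cpa K Q') (i, t).
rewrite -[LHS]/(\sum_(d < (size t).+1) \sum_(j0 : I) \sum_(p : d.-tuple (arrow Q))
  monomial K (j, s) (j0, val p) * F (j0, val p)).
transitivity (if (size s < (size t).+1)%N then F (j, s) else 0).
  rewrite -big_word_pick; apply: eq_bigr => d _; apply: eq_bigr => j' _.
  apply: eq_bigr => p _; rewrite coef_monomial pw andbT eq_sym.
  by case: eqP => _; rewrite ?mul1r ?mul0r.
(* A path longer than the target word contributes nothing, since its image lies in a higher power of
   the arrow ideal. *)
case: ltnP => // lt; symmetry.
have h : in_mpow (size s) (idem K j * \prod_(x <- s) f x).
  exact/in_mpowMl/in_mpow_prod/(adm_mpow fP).
exact: h.
Qed.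

Lemma prod_adm_tl j s : walk j s ->
  idem K j * \prod_(x <- s) f x = idem K j * \prod_(x <- s) f x * idem K (tail j s).
Proof.
elim: s j => [|c s IH] j /=; first by rewrite big_nil mulr1 idem_idem eqxx.
case/andP=> /eqP <- ws; rewrite big_cons mulrA (adm_hd fP).
by rewrite -(adm_tl fP c) -!mulrA IH // !mulrA.
Qed.

Lemma substM u v : subst f (u * v) = subst f u * subst f v.
Proof.
pose G u v := subst f (u * v).
apply: (@clin_eq K I Q Q' (fun u => subst f (u * v)) (fun u => subst f u * subst f v)).
- exact: clin_comp clin_subst (clinMr v).
- exact: clin_comp (clinMr _) clin_subst.
move=> [j s] _ ws.
apply: (@clin_eq K I Q Q' (fun v => subst f (monomial K (j, s) * v))
  (fun v => subst f (monomial K (j, s)) * subst f v)).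
- exact: clin_comp clin_subst (clinMl _).
- exact: clin_comp (clinMl _) clin_subst.
move=> [i t] _ wt; rewrite monomialM ws /=.
rewrite [X in _ = X * _]subst_monomial // [X in _ = _ * X]subst_monomial //= prod_adm_tl //.
rewrite /word_tl /= mulrA -[X in _ = X * _]mulrA idem_idem.
case: eqP => [e|_]; last by rewrite mulr0 mul0r (clin0 clin_subst).
rewrite e -prod_adm_tl // subst_monomial /= ?big_cat ?mulrA //.
by rewrite /is_path /= walk_cat -e; apply/andP.
Qed.

Lemma subst_hom : alg_hom (subst f).
Proof.
have fA x : subst f (arr K x) = f x.
  rewrite subst_monomial /= ?big_seq1 ?(adm_hd fP) //.
  by rewrite /is_path /= eqxx.
split=> [||j|x].
- exact: clin_subst.
- exact: substM.
- by rewrite subst_monomial //= big_nil mulr1.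
- by rewrite fA; exact: adm_mpow.
Qed.

Lemma subst_arr x : subst f (arr K x) = f x.
Proof.
rewrite subst_monomial /= ?big_seq1 ?(adm_hd fP) //.
by rewrite /is_path /= eqxx.
Qed.

End Substitution.

Lemma walk_split Q j (s : seq (arrow Q)) i c0 : walk j s -> (i < size s)%N ->
  let c := nth c0 s i in
  [/\ walk j (take i s), hd c = tail j (take i s), walk (tl c) (drop i.+1 s)
    & tail (tl c) (drop i.+1 s) = tail j s].
Proof.
move=> ws li /=; have e : s = take i s ++ nth c0 s i :: drop i.+1 s.
  by rewrite -drop_nth // cat_take_drop.
have ts : tail j s = tail j (take i s ++ nth c0 s i :: drop i.+1 s) by rewrite -e.
by move: ws; rewrite ts [in walk _ _]e walk_cat map_cat last_cat => /andP[-> /=] /andP[/eqP -> ->].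
Qed.

(* [ins c u v] is the sum of [q v p] over the decompositions [u = p c q]; thus
   [ins c S 1] is the cyclic derivative, and [ins c u v] are the terms of the
   Leibniz rule. *)
Section Insertion.
Variables (Q : quiver I) (c : arrow Q).

Definition ins_word (v : cpa K Q) (w : word Q) : cpa K Q :=
  \sum_(i < size w.2) if nth c w.2 i == c then
    monomial K (tl c, drop i.+1 w.2) * v * monomial K (w.1, take i w.2) else 0.

(** An occurrence of [c] lies in [s] or in [s']; the factor not containing it is absorbed into the
    inserted series, on the left of [v] for [s'] and on the right for [s]. *)
Lemma ins_word_cat v j s s' : walk j (s ++ s') ->
  ins_word v (j, s ++ s') = ins_word (monomial K (tail j s, s') * v) (j, s)
    + ins_word (v * monomial K (j, s)) (tail j s, s').
Proof.
rewrite walk_cat => /andP[ws ws'].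
rewrite /ins_word /= size_cat big_split_ord /=; congr (_ + _); apply: eq_bigr => i _.
  have [_ _ w1 t1] := walk_split c ws (ltn_ord i).
  rewrite nth_cat ltn_ord; case: eqP => // e; rewrite e in w1 t1.
  rewrite takel_cat 1?ltnW // drop_cat; case: ltnP => [_|ge].
    by rewrite monomial_cat // t1 !mulrA.
  have es : i.+1 = size s by apply/eqP; rewrite eqn_leq ge ltn_ord.
  rewrite -t1 es subnn drop0 drop_size -[monomial K (tl c, [::])]/(idem K (tl c)) mulrA.
  by rewrite idem_monomial eqxx.
rewrite -addnS nth_cat take_cat drop_cat !ltnNge !leq_addr /= !addKn.
by rewrite monomial_cat // !mulrA.
Qed.

Lemma in_mpow_ins_word n v w : in_mpow n v -> in_mpow (n + (size w.2).-1) (ins_word v w).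
Proof.
move=> hv; apply: in_mpow_sum => i _; case: ifP => _; last by move=> w'.
have -> : (size w.2).-1 = (size (drop i.+1 w.2) + size (take i w.2))%N.
  have h m : (i < m)%N -> m.-1 = (m - i.+1 + i)%N by case: m => // m im; rewrite subSS subnK.
  by rewrite size_drop size_take ltn_ord -h.
rewrite addnA; apply: in_mpowM (@in_mpow_monomial K I Q (w.1, take i w.2)).
by rewrite addnC; apply: in_mpowM => //; exact: (@in_mpow_monomial K I Q (tl c, drop i.+1 w.2)).
Qed.

Variables (u v : cpa K Q).

(** Removing one arrow from a word of length d leaves terms of length at least d - 1, so only words
    with d at most [size w.2 + 1] contribute to the coefficient of [w]. *)
Definition ins_coef : word Q -> K := fun w =>
  \sum_(d < (size w.2).+2) \sum_(j : I) \sum_(p : d.-tuple (arrow Q))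
    u (j, val p) * ins_word v (j, val p) w.
Lemma ins_supported : ins_coef \in path_supported K Q.
Proof.
apply/asboolP => w nw; apply: big1 => d _; apply: big1 => j _; apply: big1 => p _.
by rewrite [X in _ * X]coef0P ?mulr0.
Qed.
Definition ins : cpa K Q := Cpa ins_supported.

End Insertion.

Section InsertionTheory.
Variables (Q : quiver I) (c : arrow Q).

Lemma insE u v w : ins c u v w =
  \sum_(d < (size w.2).+2) \sum_(j : I) \sum_(p : d.-tuple (arrow Q))
    u (j, val p) * ins_word c v (j, val p) w.
Proof. by []. Qed.

Lemma clin_ins_l v : clin (fun u => ins c u v).
Proof.
split=> [e u u'|n]; last first.
  exists n.+1 => u hu w lw; apply: big1 => d _; apply: big1 => j _; apply: big1 => p _.
  rewrite hu ?mul0r //= size_tuple; apply: leq_trans (ltn_ord d) _.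
  by rewrite ltnS.
apply: cpaP => i t _; rewrite coefD coefZ !insE big_distrr -big_split.
apply: eq_bigr => d _; rewrite /= big_distrr -big_split; apply: eq_bigr => j _.
rewrite /= big_distrr -big_split; apply: eq_bigr => p _.
by rewrite /= mulrA -mulrDl.
Qed.

Lemma clin_ins_word w : clin (fun v => ins_word c v w).
Proof.
apply: clin_sum => i; case: (_ == c); last exact: clin_cst0.
exact: (clin_comp (clinMr _) (clinMl _)).
Qed.

Lemma clin_ins_r u : clin (fun v => ins c u v).
Proof.
split=> [e v v'|n]; last first.
  exists n => v hv w lw; apply: big1 => d _; apply: big1 => j _; apply: big1 => p _.
  have -> : ins_word c v (j, val p) w = 0; last by rewrite mulr0.
  exact: (in_mpow_ins_word c hv (ltn_addr _ lw)).
apply: cpaP => i t _; rewrite coefD coefZ !insE big_distrr -big_split.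
apply: eq_bigr => d _; rewrite /= big_distrr -big_split; apply: eq_bigr => j _.
rewrite /= big_distrr -big_split; apply: eq_bigr => p _.
by rewrite (clin_ins_word _).1 coefD coefZ mulrDr mulrCA.
Qed.

Lemma ins_monomial w v : is_path w -> ins c (monomial K w) v = ins_word c v w.
Proof.
case: w => j s pw; apply: cpaP => i t _; rewrite insE /=.
pose F (w : word Q) := ins_word c v w (i, t).
rewrite -[LHS]/(\sum_(d < (size t).+2) \sum_(j0 : I) \sum_(p : d.-tuple (arrow Q))
  monomial K (j, s) (j0, val p) * F (j0, val p)).
transitivity (if (size s < (size t).+2)%N then F (j, s) else 0).
  rewrite -big_word_pick; apply: eq_bigr => d _; apply: eq_bigr => j' _.
  apply: eq_bigr => p _; rewrite coef_monomial pw andbT eq_sym.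
  by case: eqP => _; rewrite ?mul1r ?mul0r.
case: ltnP => // lt; symmetry.
have v0 : in_mpow 0 v by [].
have h := @in_mpow_ins_word Q c 0 v (j, s) v0; apply: (h (i, t)) => /=.
by case: (size s) lt.
Qed.

(** By continuity in [u] and in [v] it suffices to take two paths. Composable ones are the case of
    [ins_word_cat]; for the others every term contains the product of their mismatched ends. *)
Lemma insM u v x : ins c (u * v) x = ins c u (v * x) + ins c v (x * u).
Proof.
apply: (@clin_eq K I Q Q (fun u => ins c (u * v) x)
  (fun u => ins c u (v * x) + ins c v (x * u))).
- exact: clin_comp (clin_ins_l x) (clinMr v).
- apply: clinD (clin_ins_l _) _.
  exact: clin_comp (clin_ins_r _) (clinMl _).
move=> [j s] _ ws.
apply: (@clin_eq K I Q Q (fun v => ins c (monomial K (j, s) * v) x)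
  (fun v => ins c (monomial K (j, s)) (v * x) + ins c v (x * monomial K (j, s)))).
- exact: clin_comp (clin_ins_l x) (clinMl _).
- apply: clinD (clin_ins_l _).
  exact: clin_comp (clin_ins_r _) (clinMr _).
move=> [i t] _ wt; rewrite monomialM ws /= !ins_monomial //.
case: eqP => [e|/eqP ne].
  have w2 : walk j (s ++ t) by rewrite walk_cat; apply/andP; split=> //; rewrite -[last _ _]e.
  by rewrite ins_monomial // ins_word_cat // -[last _ _]e.
rewrite (clin0 (clin_ins_l x)) /ins_word !big1 ?addr0 // => l _; case: eqP => // el.
  by rewrite -!mulrA monomialM0 ?mulr0.
have [_ _ _ e] := walk_split c ws (ltn_ord l); rewrite el in e.
by rewrite mulrA monomialM0 ?mul0r //= /word_tl e.
Qed.

Lemma ins_idem j v : ins c (idem K j) v = 0.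
Proof. by rewrite ins_monomial // /ins_word big_ord0. Qed.

Lemma ins_arr x v : ins c (arr K x) v = if x == c then idem K (tl c) * v * idem K (hd x) else 0.
Proof. by rewrite ins_monomial ?/is_path /= ?eqxx // /ins_word big_ord1. Qed.

End InsertionTheory.

(** * Cyclic derivatives of potentials *)

Section CyclicDerivative.
Variable Q : quiver I.
Implicit Types (S : cpa K Q) (c : arrow Q).

Lemma cder_rot S c t : walk (tl c) t -> cder S c (tl c, t) =
  \sum_(i < (size t).+1) \sum_j S (j, rotr i (c :: t)).
Proof.
move=> wt; rewrite /= /cder_coef /is_path /= wt eqxx /=.
under eq_bigr => j _ do (under eq_bigr => p _ do rewrite big_mkcond; rewrite exchange_big).
rewrite exchange_big; apply: eq_bigr => i _; apply: eq_bigr => j _.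
transitivity (if size (rotr i (c :: t)) == (size t).+1 then S (j, rotr i (c :: t)) else 0).
  rewrite -(big_tuple_pick _ _ (fun s => S (j, s))); apply: eq_bigr => p _.
  by rewrite (can2_eq (@rotK i _) (@rotrK i _)) eq_sym.
by rewrite size_rotr eqxx.
Qed.

Lemma clin_cder c : clin (fun S => cder S c).
Proof.
split=> [e u v|n]; last first.
  exists n.+1 => u hu [j t] lw; rewrite /= /cder_coef; case: ifP => // _.
  apply: big1 => j' _; apply: big1 => p _; apply: big1 => i _.
  by rewrite hu //= size_tuple.
apply: cpaP => i t wt; have [ei|ne] := eqVneq i (tl c); last first.
  by rewrite coefD coefZ /= /cder_coef /= (negbTE ne) andbF mulr0 addr0.
rewrite ei in wt *; rewrite coefD coefZ !cder_rot // big_distrr -big_split; apply: eq_bigr => l _.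
by rewrite /= big_distrr -big_split; apply: eq_bigr.
Qed.

(** On a cycle [s], the rotation by [l] starts with [c] exactly when the letter at [l] is [c], and
    then its remainder is the path after [l] followed by the path before [l]. Closing up needs equal
    endpoints, hence the restriction to potentials. *)
Lemma cder_ins S c : potential S -> cder S c = ins c S 1.
Proof.
move=> pS; apply: (clin_eq (clin_cder c) (clin_ins_l c 1)) => -[j s] /pS.
case/and3P=> ws; rewrite /word_tl /= => /eqP ts _ _.
rewrite ins_monomial //; apply: cpaP => i t wt.
have [ei|ne] := eqVneq i (tl c); last first.
  rewrite {1}/cder /= /cder_coef /= (negbTE ne) andbF /ins_word coef_sum big1 // => l _.
  case: eqP => // el; have [w1 _ w2 t2] := walk_split c ws (ltn_ord l); rewrite el in w2 t2.
  rewrite mulr1 monomialM; case: ifP => // _.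
  by rewrite coef_monomial xpair_eqE (negbTE ne).
rewrite ei in wt *; rewrite cder_rot //.
transitivity (\sum_(l < (size t).+1) ((rot l s == c :: t)%:R : K)).
  apply: eq_bigr => l _; rewrite (bigD1 j) //= big1 ?addr0.
    rewrite /monomial_coef xpair_eqE eqxx ws andbT.
    by rewrite (can2_eq (@rotK l _) (@rotrK l _)) eq_sym.
  by move=> j' ne; rewrite /monomial_coef xpair_eqE (negbTE ne).
rewrite /ins_word coef_sum /=.
have [es|ne] := eqVneq (size s) (size t).+1; last first.
  rewrite !big1 // => l _.
    case: eqP => // el; have [w1 _ w2 t2] := walk_split c ws (ltn_ord l); rewrite el in w2 t2.
    rewrite mulr1 monomialM; case: ifP => // _.
    rewrite coef_monomial xpair_eqE eqxx /=; case: eqP => // et.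
    case/eqP: ne; rewrite et size_cat size_drop size_take ltn_ord.
    by case: (size s) l {el w1 w2 t2 et} => [[]//|m l]; rewrite subSS subnK // -ltnS.
  by case: eqP => // /(congr1 size) /eqP; rewrite size_rot /= (negbTE ne).
rewrite -es; apply: eq_bigr => l _.
have [w1 _ w2 t2] := @walk_split _ j s l c ws (ltn_ord l).
rewrite /rot (drop_nth c) // cat_cons eqseq_cons.
case: eqP => // el; rewrite el in w2 t2; rewrite mulr1 monomialM /word_tl /is_path /= t2 ts w2 eqxx /=.
rewrite /monomial_coef xpair_eqE eqxx /= eq_sym.
by rewrite /is_path /= ?walk_cat ?w2 ?t2 ?ts ?w1 ?andbT.
Qed.

Lemma closed_potential : closed_subspace (@potential K I Q).
Proof.
split=> [w|e u v pu pv w|u cu w uw]; first by rewrite coef0 eqxx.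
  have [|/pu //] := eqVneq (u w) 0; have [|/pv //] := eqVneq (v w) 0.
  by rewrite coefD coefZ => -> ->; rewrite mulr0 addr0 eqxx.
have [v pv uv] := cu (size w.2).+1; apply: pv; apply: contraNN uw => /eqP v0.
by rewrite -(subrK v u) coefD uv // v0 addr0.
Qed.

Lemma potential_monomial (w : word Q) : cyclic w -> potential (monomial K w).
Proof.
by move=> cw w'; rewrite coef_monomial; have [->|] := eqVneq w' w; rewrite //= eqxx.
Qed.

(** By the Leibniz rule, [ins c (u * v) 1] is symmetric in [u] and [v]; here [u] is the first arrow
    of the cycle and [v] the rest. *)
Lemma cder_rot_word c (w : word Q) : cyclic w ->
  cder (monomial K w - monomial K (rot_word w)) c = 0.
Proof.
case: w => j [|x s]; rewrite /cyclic /is_path /word_tl //= ?andbF // andbT.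
case/andP=> /andP[/eqP hx ws] /eqP ts.
have w1 : walk (tl x) (rcons s x) by rewrite -cats1 walk_cat ws /= ts hx eqxx.
have p1 : potential (monomial K (j, x :: s)).
  by apply: potential_monomial; rewrite /cyclic /is_path /word_tl /= hx ws ts !eqxx.
have p2 : potential (monomial K (tl x, rcons s x)).
  apply: potential_monomial; rewrite /cyclic /is_path /word_tl /= w1.
  by rewrite map_rcons last_rcons eqxx; case: (s).
have [L LE] := linear_bundle (clin_cder c).1.
rewrite -LE linearB !LE /rot_word /= !cder_ins //.
rewrite monomial_cons hx eqxx -cats1 monomial_cat // ts monomial_cons hx eqxx /=.
rewrite -[monomial K (tl x, [::])]/(idem K (tl x)) arr_idem !insM.
by rewrite !mul1r !mulr1 [X in _ - X]addrC subrr.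
Qed.

End CyclicDerivative.

Lemma cder_cyc_equiv Q (S S' : cpa K Q) c : cyc_equiv S S' -> cder S c = cder S' c.
Proof.
move=> h; have [L LE] := linear_bundle (clin_cder c).1.
apply/eqP; rewrite -subr_eq0 -!LE -linearB !LE; apply/eqP.
have [_ C] := clin_cder c; apply: in_mpow_eq0 => n; have [N hN] := C n.
have [v [m [x [w [cw ->]]]] /hN] := h N.
rewrite -!LE linearB linear_sum big1 ?subr0 // => i _.
by rewrite linearZ LE /= cder_rot_word ?scaler0.
Qed.

Lemma Midem Q j (u : cpa K Q) w : (u * idem K j) w = u w *+ (word_tl w == j).
Proof.
case: w => i s; rewrite coefM /conv big_ord_recr /= big1 ?add0r => [|l _].
  rewrite take_size drop_size /monomial_coef xpair_eqE eqxx !andbT mulr_natr.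
  by rewrite /word_tl /=.
rewrite /monomial_coef xpair_eqE -size_eq0 size_drop subn_eq0 leqNgt ltn_ord.
by rewrite andbF mulr0.
Qed.

(** Idempotents are fixed, so the image of a cycle at j is fixed by e_j on both sides; as it lies in
    the arrow ideal, it has no trivial path. *)
Lemma hom_potential Q Q' (h : cpa K Q -> cpa K Q') S : alg_hom h ->
  potential S -> potential (h S).
Proof.
move=> hh pS; apply: (clin_ind (hom_clin hh)); first exact: closed_potential.
move=> w /pS /and3P[pw /eqP tw w0] _ [i t] ut.
have e1 : idem K w.1 * h (monomial K w) = h (monomial K w).
  by rewrite -{1}(hom_idem hh) -(hom_mul hh) idem_monomial eqxx.
have e2 : h (monomial K w) * idem K w.1 = h (monomial K w).
  by rewrite -{1}(hom_idem hh) -(hom_mul hh) -tw monomial_idem.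
apply/and3P; split.
- by apply: contraNT ut => /coef0P ->.
- move: ut; rewrite -e1 idemM /=; have [->|_] := eqVneq i w.1; last by rewrite eqxx.
  by rewrite mulr1n -e2 Midem; have [//|_] := eqVneq (word_tl _) w.1; rewrite eqxx.
- apply: contraNneq ut => t0; apply/eqP.
  have h1 : in_mpow 1 (h (monomial K w)).
    apply: (hom_mpow hh); apply: (@in_mpowS _ _ _ 1 (size w.2)).
      by case: (w.2) w0.
    exact: in_mpow_monomial.
  by apply: h1; rewrite t0.
Qed.

Lemma ins_hom_monomial Q Q' (h : cpa K Q -> cpa K Q') c x0 j s x : alg_hom h -> walk j s ->
  ins c (h (monomial K (j, s))) x = \sum_(i < size s)
    ins c (h (arr K (nth x0 s i)))
      (h (monomial K (tl (nth x0 s i), drop i.+1 s)) * x * h (monomial K (j, take i s))).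
Proof.
move=> hh; elim: s j x => [|y s IH] j x /=.
  by rewrite big_ord0 (hom_idem hh) ins_idem.
case/andP=> /eqP <- ws; rewrite monomial_cons eqxx (hom_mul hh) insM IH // big_ord_recl /=.
rewrite drop0 -[monomial K (hd y, [::])]/(idem K (hd y)) (hom_idem hh); congr (_ + _).
  rewrite -{1}(idem_arr K y) (hom_mul hh) (hom_idem hh) insM ins_idem add0r.
  by [].
apply: eq_bigr => i _; congr (ins _ _ _).
by rewrite monomial_cons eqxx (hom_mul hh) !mulrA.
Qed.

(** Chain rule: [c] can only be found inside the image of some arrow [a] of a cycle, and what
    surrounds it is the image of the rest of the cycle, which is a term of the derivative at [a]. *)
Lemma cder_hom Q Q' (h : cpa K Q -> cpa K Q') S c : alg_hom h -> potential S ->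
  cder (h S) c = \sum_a ins c (h (arr K a)) (h (cder S a)).
Proof.
move=> hh pS; have ch := hom_clin hh.
apply: (clin_eq (F := fun S => cder (h S) c)
  (G := fun S => \sum_a ins c (h (arr K a)) (h (cder S a)))) => [||[j s] /pS cw ws].
- exact: clin_comp (clin_cder c) ch.
- apply: clin_sum => a; apply: clin_comp (clin_ins_r _ _) _.
  exact: clin_comp ch (clin_cder a).
have pm := potential_monomial cw.
rewrite cder_ins; last exact: hom_potential.
case: s ws cw pm => [|x0 s] ws cw pm; first by case/and3P: cw.
rewrite (ins_hom_monomial c x0 1 hh ws).
transitivity (\sum_a \sum_(i < size (x0 :: s)) if nth x0 (x0 :: s) i == a then
  ins c (h (arr K a)) (h (monomial K (tl a, drop i.+1 (x0 :: s)))
    * h (monomial K (j, take i (x0 :: s)))) else 0); last first.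
  apply: eq_bigr => a _; rewrite cder_ins // ins_monomial //.
  have [L LE] := linear_bundle (clin_comp (clin_ins_r c (h (arr K a))) ch).1.
  rewrite -LE linear_sum; apply: eq_bigr => i _.
  rewrite (set_nth_default a) //; case: eqP => _; last by rewrite linear0.
  by rewrite LE mulr1 (hom_mul hh).
rewrite exchange_big; apply: eq_bigr => i _.
rewrite -big_mkcond (big_pred1 (nth x0 (x0 :: s) i)) ?mulr1 //.
Qed.

End Homomorphisms.

(** * Division by an arrow and bracketing *)

Section Division.
Variables (K : fieldType) (I : finType) (Q : quiver I).
Implicit Types (u v : cpa K Q) (c : arrow Q).

Lemma clin_ldiv c : clin (ldiv c : cpa K Q -> cpa K Q).
Proof.
split=> [e u v|n]; last first.
  by exists n.+1 => u hu w lw; rewrite /= /ldiv_coef; case: ifP => // _; apply: hu.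
apply: cpaP => j s _; rewrite coefD coefZ /= /ldiv_coef /=.
by case: ifP => // _; rewrite mulr0 addr0.
Qed.

Lemma clin_rdiv c : clin (rdiv c : cpa K Q -> cpa K Q).
Proof.
split=> [e u v|n]; last first.
  by exists n.+1 => u hu w lw; rewrite /= /rdiv_coef; apply: hu; rewrite /= size_rcons.
by apply: cpaP => j s _; rewrite coefD coefZ.
Qed.

(** The leading [c] of a product is taken from [u], unless [u] contributes its trivial path at the
    head of [c]. This second term is the source of the corrections in [solvable_in] and, in its
    mirror image [rdivM], in [solvable_out]. *)
Lemma ldivM c u v : ldiv c (u * v) = ldiv c u * v + (u (hd c, [::]) : K) *: ldiv c v.
Proof.
apply: cpaP => j s _; rewrite coefD coefZ.
have [->|ne] := eqVneq j (tl c); last first.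
  have z x t : ldiv c x (j, t) = 0 by rewrite /= /ldiv_coef /= (negbTE ne).
  by rewrite coefM !z mulr0 addr0 /conv big1 // => i _; rewrite z mul0r.
have e x t : ldiv c x (tl c, t) = x (hd c, c :: t) by rewrite /= /ldiv_coef /= eqxx.
rewrite !e !coefM conv_cons addrC; congr (_ + _).
by apply: eq_conv => // t; rewrite e.
Qed.

Lemma rdivM c u v : rdiv c (u * v) = u * rdiv c v + (v (tl c, [::]) : K) *: rdiv c u.
Proof.
apply: cpaP => j s _; rewrite coefD coefZ.
have e x t : rdiv c x (j, t) = x (j, rcons t c) by [].
rewrite !e !coefM /conv /= big_ord_recr /= take_size drop_size.
rewrite /word_tl /= map_rcons last_rcons mulrC; congr (_ + _).
rewrite size_rcons; apply: eq_bigr => i _.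
have li : (i <= size s)%N by rewrite -ltnS.
by rewrite -cats1 takel_cat // cats1 drop_rcons.
Qed.

Lemma ldiv_idem c j : ldiv c (idem K j) = 0.
Proof.
apply: cpaP => i s _; rewrite /= /ldiv_coef /=; case: ifP => // _.
by rewrite /monomial_coef xpair_eqE andbF.
Qed.

Lemma rdiv_idem c j : rdiv c (idem K j) = 0.
Proof.
apply: cpaP => i s _; rewrite /= /rdiv_coef /= /monomial_coef xpair_eqE.
by case: s => [|x s]; rewrite andbF.
Qed.

Lemma ldiv_arr c x : ldiv c (arr K x) = if x == c then idem K (tl c) else 0.
Proof.
apply: cpaP => j s _; rewrite /= /ldiv_coef /= /monomial_coef xpair_eqE eqseq_cons.
rewrite /is_path /= eqxx !andbT [c == x]eq_sym; have [->|ne] := eqVneq x c.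
  by rewrite eqxx coef_monomial xpair_eqE; case: (j == tl c) => //; rewrite andbT.
by rewrite andbF; case: ifP.
Qed.

Lemma rdiv_arr c x : rdiv c (arr K x) = if x == c then idem K (hd c) else 0.
Proof.
apply: cpaP => j s _; rewrite /= /rdiv_coef /= /monomial_coef xpair_eqE.
rewrite -[[:: x]]/(rcons [::] x) eqseq_rcons /is_path /= eqxx !andbT [c == x]eq_sym.
have [->|ne] := eqVneq x c.
  by rewrite andbT coef_monomial xpair_eqE andbT.
by rewrite !andbF.
Qed.

Lemma coef_arr_nil c j : arr K c (j, [::]) = 0.
Proof. by rewrite coef_monomial xpair_eqE andbF. Qed.

Lemma cpa_ldivE u :
  u = \sum_j (u (j, [::]) : K) *: idem K j + \sum_c arr K c * ldiv c u.
Proof.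
apply: cpaP => j s ws; rewrite coefD !coef_sum.
case: s ws => [_|c s wcs].
  rewrite [X in _ + X]big1 => [|c _]; last by rewrite arrM.
  rewrite (bigD1 j) // big1 ?addr0 => [|i ne].
    by rewrite coefZ coef_monomial eqxx mulr1 [RHS]addr0.
  by rewrite coefZ coef_monomial xpair_eqE eq_sym (negbTE ne) mulr0.
have /andP[/eqP hc ws] : (hd c == j) && walk (tl c) s by [].
rewrite [X in X + _]big1 ?add0r => [|i _].
  rewrite (bigD1 c) // big1 ?addr0 => [|x ne]; last by rewrite arrM eq_sym (negbTE ne).
  by rewrite arrM -hc !eqxx mulr1n /= /ldiv_coef eqxx [RHS]addr0.
by rewrite coefZ coef_monomial xpair_eqE andbF mulr0.
Qed.

Lemma Marr c u j s : (u * arr K c) (j, rcons s c) = u (j, s) *+ (word_tl (j, s) == hd c).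
Proof. by rewrite -[LHS]/(rdiv c (u * arr K c) (j, s)) rdivM rdiv_arr eqxx coef_arr_nil scale0r addr0 Midem. Qed.

Lemma Marr0 c x u j s : x != c -> (u * arr K x) (j, rcons s c) = 0.
Proof.
move=> ne; rewrite -[LHS]/(rdiv c (u * arr K x) (j, s)) rdivM rdiv_arr (negbTE ne).
by rewrite mulr0 add0r coef_arr_nil scale0r.
Qed.

Lemma cpa_rdivE u :
  u = \sum_j (u (j, [::]) : K) *: idem K j + \sum_c rdiv c u * arr K c.
Proof.
apply: cpaP => j s; rewrite coefD !coef_sum.
case/lastP: s => [_|s c ws].
  rewrite [X in _ + X]big1 => [|c _]; last by rewrite coefM conv_nil coef_arr_nil mulr0.
  rewrite (bigD1 j) // big1 ?addr0 => [|i ne].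
    by rewrite coefZ coef_monomial eqxx mulr1 [RHS]addr0.
  by rewrite coefZ coef_monomial xpair_eqE eq_sym (negbTE ne) mulr0.
rewrite [X in X + _]big1 ?add0r => [|i _].
  rewrite (bigD1 c) // big1 ?addr0 => [|x ne]; last exact: Marr0.
  rewrite Marr; move: ws; rewrite -cats1 walk_cat /= andbT eq_sym => /andP[_ /eqP <-].
  by rewrite eqxx mulr1n cats1 [RHS]addr0.
by rewrite coefZ coef_monomial xpair_eqE; case: (s) => [|x t]; rewrite andbF mulr0.
Qed.

End Division.

(** * Replacing the length-2 paths through [k] by composite arrows *)

Section Bracket.
Variables (K : fieldType) (I : finType) (k : I) (Q : quiver I).
Notation mQ := (premut_quiver k Q).
Notation br := (@bracket K I k Q).

Definition bracket_arrow (x : arrow mQ) : option (seq (arrow Q)) :=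
  match x with
  | Old c => Some [:: val c]
  | Comp b a => Some [:: val b; val a]
  | _ => None
  end.

Lemma bracketE (u : cpa K Q) j t : walk j t -> br u (j, t) =
  if expand bracket_arrow t is Some s then u (j, s) else 0.
Proof. by move=> wt; rewrite /= /relabel_coef /is_path /= wt. Qed.

Lemma size_expand_bracket t s : expand bracket_arrow t = Some s -> (size s <= (size t).*2)%N.
Proof.
elim: t s => [|x t IH] s /=; first by case=> <-.
case: x => [c|b a|a|b] //=; case: (expand _ t) IH => // s' IH [<-] /=.
  by rewrite doubleS; apply: leqW; rewrite ltnS IH.
by rewrite doubleS !ltnS IH.
Qed.

Lemma expand_bracket_tl j t s : expand bracket_arrow t = Some s -> tail j s = tail j t.
Proof.
elim: t s j => [|x t IH] s j /=; first by case=> <-.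
by case: x => [c|b a|a|b] //=; case: (expand _ t) IH => // s' IH [<-] /=; apply: IH.
Qed.

Lemma clin_bracket : clin br.
Proof.
split=> [e u v|n].
  apply: cpaP => j t wt; rewrite coefD coefZ !bracketE //.
  by case: (expand _ t) => [s|]; rewrite ?mulr0 ?addr0.
(* A composite arrow stands for two arrows, so a word of length less than n expands to length less
   than 2n. *)
exists n.*2 => u hu [j t] lw; rewrite /= /relabel_coef; case: ifP => // _.
case e: (expand _ t) => [s|//]; apply: hu => /=.
by apply: leq_ltn_trans (size_expand_bracket e) _; rewrite ltn_double.
Qed.

#[local] Arguments coef : simpl never.

Lemma bracket_idem j : br (idem K j) = idem K j.
Proof.
apply: cpaP => i [|x t] wt; rewrite bracketE //.
rewrite [RHS]coef_monomial xpair_eqE andbF.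
by case: x wt => [c|b a|a|b] //= _; case: (expand _ t) => //= s;
  rewrite coef_monomial xpair_eqE andbF.
Qed.

Lemma bracket_idemM j u : br (idem K j * u) = idem K j * br u.
Proof.
apply: cpaP => i t wt; rewrite idemM !bracketE //.
by case: (expand _ t) => [s|]; rewrite ?mul0rn // idemM.
Qed.

Lemma bracketM_idem j u : br (u * idem K j) = br u * idem K j.
Proof.
apply: cpaP => i t wt; rewrite Midem !bracketE //.
by case e: (expand _ t) => [s|]; rewrite ?mul0rn // Midem /word_tl /= (expand_bracket_tl i e).
Qed.

Lemma bracket_off (c : off_arrow k Q) u :
  br (arr K (val c) * u) = arr K (Old c : arrow mQ) * br u.
Proof.
apply: cpaP => j t wt; rewrite bracketE // [RHS]arrM.
case: t wt => [|x t] /=; first by rewrite arrM.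
case/andP=> /eqP hx wt; case: x hx wt => [c'|b a|a|b] //= hx wt; last first.
  case: (expand _ t) => [s|//]; rewrite arrM /=.
  by case: eqP => // e; have := valP c; rewrite /= -e (eqP (valP b)) eqxx andbF.
have -> : (Old c' == Old c :> arrow mQ) = (val c' == val c).
  by apply/eqP/eqP => [[->]|/val_inj ->].
case: (val c' =P val c) => [/val_inj e|ne] /=; last first.
  by case: (expand _ t) => [s|//]; rewrite arrM; case: (val c' =P val c).
rewrite e in hx wt *; rewrite bracketE //=.
by case: (expand _ t) => [s|]; rewrite ?arrM ?eqxx ?mul0rn.
Qed.

Lemma bracket_comp (b : out_arrow k Q) (a : in_arrow k Q) u :
  br (arr K (val b) * (arr K (val a) * u)) = arr K (Comp b a : arrow mQ) * br u.
Proof.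
have ab : tl (val b) = hd (val a) by rewrite (eqP (valP a)) (eqP (valP b)).
apply: cpaP => j t wt; rewrite bracketE // [RHS]arrM.
case: t wt => [|x t] /=; first by rewrite arrM.
case/andP=> /eqP hx wt; case: x hx wt => [c|b' a'|a'|b'] //= hx wt.
  case: (expand _ t) => [s|//]; rewrite arrM /=.
  by case: eqP => // e; have := valP c; rewrite /= e (eqP (valP b)) eqxx andbF.
have -> : (Comp b' a' == Comp b a :> arrow mQ) = (val b' == val b) && (val a' == val a).
  apply/eqP/andP => [[-> ->]//|[/eqP/val_inj -> /eqP/val_inj ->]] //.
case: (val b' =P val b) => [/val_inj e|ne] /=; last first.
  by case: (expand _ t) => [s|//]; rewrite arrM; case: (val b' =P val b).
case: (val a' =P val a) => [/val_inj e'|ne'] /=; last first.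
  case: (expand _ t) => [s|//]; rewrite arrM arrM.
  by case: (val a' =P val a) => //; rewrite ?mul0rn.
rewrite e e' in hx wt *; rewrite bracketE //=.
case: (expand _ t) => [s|]; rewrite ?mul0rn // !arrM !eqxx ab eqxx /=.
by rewrite mulr1n.
Qed.

Hypothesis lfQ : loop_free Q.

(** No arrow of [mQ] expands to a word whose leftmost letter has head [k]; for a composite arrow
    this uses that there are no loops. *)
Lemma bracket_in (a : arrow Q) u : hd a = k -> br (arr K a * u) = 0.
Proof.
move=> ha; apply: cpaP => j t wt; rewrite bracketE // coef0.
case: t wt => [|x t] /=; first by rewrite arrM.
case: x => [c|b a'|a'|b] //= _; case: (expand _ t) => [s|//]; rewrite arrM.
  by case: eqP => // e; have := valP c; rewrite /= e ha eqxx.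
case: eqP => // e; have := lfQ a.
by rewrite ha -e (eqP (valP b)) eqxx.
Qed.

(** A path with both ends different from [k] is cut at its vertices other than [k]: each visit to
    [k] is a factor [b a], and without loops two visits are never adjacent. *)
Lemma bracket_monomial_ind (P : word Q -> Prop) :
  (forall j, j != k -> P (j, [::])) ->
  (forall (c : off_arrow k Q) s, walk (tl (val c)) s -> tail (tl (val c)) s != k ->
     P (tl (val c), s) -> P (hd (val c), val c :: s)) ->
  (forall (b : out_arrow k Q) (a : in_arrow k Q) s, walk (tl (val a)) s ->
     tail (tl (val a)) s != k ->
     P (tl (val a), s) -> P (hd (val b), val b :: val a :: s)) ->
  forall j s, walk j s -> j != k -> tail j s != k -> P (j, s).
Proof.
move=> P0 Poff Pcomp j s; have [n] := ubnP (size s).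
elim: n j s => // n IH j [|c s] /=; first by move=> _ _ jk _; exact: P0.
rewrite ltnS => sn /andP[/eqP <- ws] hck tk.
have [tck|tck] := eqVneq (tl c) k.
  case: s sn ws tk => [|a s] /=; first by rewrite tck eqxx.
  move=> sn /andP[/eqP ha ws] tk.
  have oc : tl c == k by apply/eqP.
  have ia : hd a == k by rewrite ha.
  have := Pcomp (exist _ c oc) (exist _ a ia) s ws tk; apply; apply: IH => //.
    exact: ltnW.
  by have := lfQ a; rewrite ha tck eq_sym.
have oc : (hd c != k) && (tl c != k) by rewrite hck.
by have := Poff (exist _ c oc) s ws tk; apply; apply: IH.
Qed.

End Bracket.

(** * The composite of psi and kappa *)

Section DerivativeBounds.
Variables (K : fieldType) (I : finType) (Q : quiver I) (S : cpa K Q).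

Lemma in_mpow_cder n c : in_mpow n.+1 S -> in_mpow n (cder S c).
Proof.
move=> hS [j t] lw; rewrite /= /cder_coef; case: ifP => // _.
apply: big1 => j' _; apply: big1 => p _; apply: big1 => i _.
by rewrite hS //= size_tuple.
Qed.

Lemma idem_cder c : idem K (tl c) * cder S c = cder S c.
Proof.
apply: cpaP => j s _; rewrite idemM /= /cder_coef /=.
by case: (j == tl c); rewrite // andbF.
Qed.

Lemma cder_idem c : potential S -> cder S c * idem K (hd c) = cder S c.
Proof.
move=> pS; apply: (clin_eq (F := fun S => cder S c * idem K (hd c)) (G := fun S => cder S c)).
- exact: (clin_comp (clinMr (idem K (hd c))) (clin_cder K c)).
- exact: clin_cder.
move=> [j s] /pS cw ws; rewrite cder_ins; last exact: potential_monomial.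
rewrite ins_monomial // /ins_word mulr_suml; apply: eq_bigr => i _.
case: eqP => [e|_]; last by rewrite mul0r.
have [_ h _ _] := walk_split c ws (ltn_ord i); rewrite e in h.
by rewrite -mulrA h (monomial_idem _ (j, take i s)).
Qed.

(** Reading a cycle from [b] and then removing the next letter [a] reduces second derivatives to
    first ones. *)
Lemma cder2_ldiv b a : hd a = tl b -> cder2 S b a = ldiv a (cder S b).
Proof.
move=> ab; apply: cpaP => j s _; rewrite /= /ldiv_coef /cder2_coef /is_path /=.
case: eqP => [->|_]; last by rewrite andbF.
by rewrite /cder_coef /is_path /= ab !eqxx andbT.
Qed.

Lemma cder2_idem b a : potential S -> hd a = tl b -> cder2 S b a * idem K (hd b) = cder2 S b a.
Proof.
move=> pS ab; rewrite !cder2_ldiv // -{2}(cder_idem b pS) ldivM ldiv_idem scaler0 addr0.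
by [].
Qed.

End DerivativeBounds.

(** [rcons s x] is a rotation of [x :: s], so both sums run over all rotations of the same cyclic
    word. *)
Lemma sum_rotr (V : nmodType) (T : Type) (F : seq T -> V) (x : T) (s : seq T) :
  \sum_(i < (size s).+1) F (rotr i (rcons s x)) = \sum_(i < (size s).+1) F (rotr i (x :: s)).
Proof.
rewrite -rot1_cons big_ord_recl [RHS]big_ord_recr addrC; congr (_ + _).
  apply: eq_bigr => i _; congr F; rewrite /rotr size_rot /= -rotD addn1; last exact: leq_subr.
  by rewrite /bump add1n subSS -subSn // ltnW.
by rewrite /rotr subn0 rot_size subSnn.
Qed.

#[local] Arguments coef : simpl never.

(** The coefficient of [q b] on the left counts the rotations of [b a q] and on the right those of
    [a q b], the same cyclic word. This mirror image of [sum_arr_cder2] yields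
    [gamma \o beta = 0]. *)
Lemma cder_sum_cder2 (K : fieldType) (I : finType) (Q : quiver I) (S : cpa K Q) k a :
  potential S -> loop_free Q -> hd a = k ->
  \sum_(b : out_arrow k Q) cder2 S (val b) a * arr K (val b) = cder S a.
Proof.
move=> pS lf ha; have ab (b : out_arrow k Q) : hd a = tl (val b) by rewrite ha (eqP (valP b)).
apply: cpaP => j t wt; rewrite -(cder_idem a pS) Midem coef_sum /word_tl /=.
have [ja|ne] := eqVneq j (tl a); last first.
  rewrite -idem_cder idemM (negbTE ne) mul0rn big1 // => b _.
  by rewrite -idem_cder2 -mulrA idemM (negbTE ne).
rewrite ja in wt *; case/lastP: t wt => [_|q b wt].
  rewrite eq_sym (negbTE (lf a)) big1 // => b _.
  by rewrite coefM conv_nil coef_arr_nil mulr0.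
move: (wt); rewrite map_rcons last_rcons -cats1 walk_cat /= andbT => /andP[wq /eqP hb].
have [tb|ntb] := eqVneq (tl b) (hd a); last first.
  rewrite big1 // => x _; rewrite cats1 Marr0 //.
  by apply: contraNneq ntb => <-; rewrite (ab x).
have tbk : tl b == k by rewrite tb ha.
rewrite cats1 (bigD1 (exist _ b tbk)) // big1 => [|x ne]; last first.
  by rewrite Marr0 //; apply: contraNneq ne => e; apply/eqP/val_inj.
rewrite Marr /word_tl /= -hb eqxx !mulr1n addr0 cder2_ldiv //.
rewrite -[LHS]/(ldiv_coef _ _ _) /ldiv_coef eqxx.
have w2 : walk (tl b) (a :: q) by rewrite /= tb eqxx.
rewrite -tb cder_rot // cder_rot //.
by rewrite size_rcons; symmetry; exact: (sum_rotr (fun s => \sum_j0 S (j0, s)) b (a :: q)).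
Qed.

Section IdemHat.
Variables (K : fieldType) (I : finType) (k : I) (Q : quiver I).
Notation hat := (idem_hat K k Q).

Lemma hat_hat : hat * hat = hat.
Proof. by rewrite {1}/idem_hat mulrBl mul1r /idem_hat mulrBr mulr1 idem_idem eqxx subrr subr0. Qed.

Lemma monomial_hat (w : word Q) :
  monomial K w * hat = if word_tl w == k then 0 else monomial K w.
Proof.
rewrite /idem_hat mulrBr mulr1; case: eqP => [<-|/eqP ne].
  by rewrite monomial_idem subrr.
by rewrite monomial_idem0 ?subr0 // eq_sym.
Qed.

Lemma hat_monomial (w : word Q) :
  hat * monomial K w = if w.1 == k then 0 else monomial K w.
Proof. by rewrite /idem_hat mulrBl mul1r idem_monomial; case: eqP; rewrite ?subrr ?subr0. Qed.

Lemma hat_idem j : hat * idem K j = if j == k then 0 else idem K j.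
Proof. exact: hat_monomial. Qed.

Lemma idem_hatM j : idem K j * hat = if j == k then 0 else idem K j.
Proof. exact: monomial_hat. Qed.

End IdemHat.

Section Chi.
Variables (K : fieldType) (I : finType) (Q : quiver I) (S : cpa K Q) (k : I).
Hypotheses (lfQ : loop_free Q) (acQ : two_acyclic Q) (pS : potential S).
Notation mQ := (premut_quiver k Q).

Lemma in_mpow3_potential : in_mpow 3 S.
Proof.
move=> [j s] /= ls; apply/eqP; apply: contraLR ls => /pS /and3P[].
case: s => [|a [|b [|c s]]] //; rewrite /is_path /word_tl /=.
  by move=> /andP[/eqP <- _] /eqP e; have := lfQ a; rewrite e eqxx.
move=> /and3P[/eqP ha /eqP hb _] /eqP tb.
by case: (@acQ a b); rewrite ha hb tb.
Qed.

Lemma premut_loop_free : loop_free mQ.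
Proof.
case=> [c|b a|a|b] /=.
- exact: lfQ.
- apply/eqP => e; case: (@acQ (val b) (val a)); split=> //.
  by rewrite (eqP (valP a)) (eqP (valP b)).
- by have := lfQ (val a); rewrite (eqP (valP a)) eq_sym.
- by have := lfQ (val b); rewrite (eqP (valP b)) eq_sym.
Qed.

Lemma hd_out (b : out_arrow k Q) : hd (val b) != k.
Proof. by have := lfQ (val b); rewrite (eqP (valP b)). Qed.

Lemma tl_in (a : in_arrow k Q) : tl (val a) != k.
Proof. by have := lfQ (val a); rewrite (eqP (valP a)) eq_sym. Qed.

Lemma in_out (a : in_arrow k Q) (b : out_arrow k Q) : hd (val a) = tl (val b).
Proof. by rewrite (eqP (valP a)) (eqP (valP b)). Qed.

(** The cycles of [S] have length at least 3, so a second derivative has no constant term and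
    substituting it for an arrow converges. *)
Lemma admissible_psi : admissible (psi_arrow (k := k) S).
Proof.
have off (x : arrow mQ) : (hd x != k) && (tl x != k) ->
  (exists c, x = Old c) \/ exists b a, x = Comp b a.
  case: x => [c|b a|a|b] /=; [by left; exists c | by right; exists b, a | |];
  by rewrite eqxx ?andbF.
split.
- case=> [[x xP]|y x|y|x] //=.
    case: (off x xP) => [[c ->]|[b [a ->]]] /=; first exact: in_mpow_arr.
    apply: in_mpowMl; exact: in_mpow_arr.
  case: (val y) => // a; case: (val x) => // b; apply: in_mpowN; rewrite cder2_ldiv; last exact: in_out.
  move=> [j t] lw; rewrite -[LHS]/(ldiv_coef _ _ _) /ldiv_coef; case: ifP => // _.
  exact: (in_mpow_cder (val b) in_mpow3_potential).
- case=> [[x xP]|y x|y|x] //=; rewrite ?mulr0 //.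
    case: (off x xP) => [[c ->]|[b [a ->]]] /=; first exact: idem_arr.
    by rewrite mulrA idem_arr.
  case: y => -[c|b' a'|a|b] //= _; rewrite ?mulr0 //; case: x => -[c|b' a'|a1|b] //= _; rewrite ?mulr0 //.
  by rewrite mulrN idem_cder2.
- case=> [[x xP]|y x|y|x] //=; rewrite ?mul0r //.
    case: (off x xP) => [[c ->]|[b [a ->]]] /=; first exact: arr_idem.
    by rewrite -mulrA arr_idem.
  case: y => -[c|b' a'|a|b] //= _; rewrite ?mul0r //; case: x => -[c|b' a'|a1|b] //= _; rewrite ?mul0r //.
  by rewrite mulNr cder2_idem //; exact: in_out.
Qed.

(** Taken on the whole algebra of [mQ] and not only on the corner away from [k]: [kappa] drops the
    paths of positive length with an end at [k]. The price is that [chi] is not multiplicative in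
    general. *)
Definition chi (u : cpa K mQ) : cpa K Q := psi S (kappa u).

Lemma psiM (u v : cpa K (premut_quiver k mQ)) : psi S (u * v) = psi S u * psi S v.
Proof. exact: substM admissible_psi _ _. Qed.

Lemma clin_chi : clin chi.
Proof. exact: clin_comp (clin_subst _) (clin_bracket _ _ _). Qed.

Lemma chi_idemM j u : chi (idem K j * u) = idem K j * chi u.
Proof.
rewrite /chi /kappa bracket_idemM psiM; congr (_ * _).
by rewrite /psi (hom_idem (subst_hom admissible_psi)).
Qed.

Lemma chi_old c u : chi (arr K (Old c : arrow mQ) * u) = arr K (val c) * chi u.
Proof.
pose o : off_arrow k mQ := exist _ (Old c : arrow mQ) (valP c).
by rewrite /chi /kappa (bracket_off o) psiM /psi (subst_arr admissible_psi).
Qed.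

Lemma chi_comp b a u : chi (arr K (Comp b a : arrow mQ) * u) =
  arr K (val b) * (arr K (val a) * chi u).
Proof.
have oP : (hd (Comp b a : arrow mQ) != k) && (tl (Comp b a : arrow mQ) != k).
  by rewrite /= hd_out tl_in.
pose o : off_arrow k mQ := exist _ (Comp b a : arrow mQ) oP.
by rewrite /chi /kappa (bracket_off o) psiM /psi (subst_arr admissible_psi) mulrA.
Qed.

Lemma chi_stars a b u :
  chi (arr K (InStar a : arrow mQ) * (arr K (OutStar b : arrow mQ) * u)) =
  - cder2 S (val b) (val a) * chi u.
Proof.
pose y : out_arrow k mQ := exist _ (InStar a : arrow mQ) (eqxx k).
pose x : in_arrow k mQ := exist _ (OutStar b : arrow mQ) (eqxx k).
by rewrite /chi /kappa (bracket_comp y x) psiM /psi (subst_arr admissible_psi).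
Qed.

Lemma chi_outstar b u : chi (arr K (OutStar b : arrow mQ) * u) = 0.
Proof.
rewrite /chi /kappa (bracket_in premut_loop_free) //.
exact: clin0 (clin_subst _).
Qed.

Lemma chi_idem j : chi (idem K j) = idem K j.
Proof. by rewrite /chi /kappa bracket_idem /psi (hom_idem (subst_hom admissible_psi)). Qed.

Lemma chiM_word j s v : walk j s -> tail j s != k ->
  chi (monomial K (j, s) * v) = chi (monomial K (j, s)) * chi v.
Proof.
have [n] := ubnP (size s); elim: n j s => // n IH j [|x s] /=.
  by move=> _ _ _; rewrite chi_idemM -[monomial _ _]/(idem K j) chi_idem.
rewrite ltnS => sn /andP[/eqP <- ws] tk; rewrite !monomial_cons eqxx -!mulrA.
case: x ws tk => [c|b a|a|b] ws tk.
- by rewrite !chi_old IH // mulrA.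
- by rewrite !chi_comp IH // !mulrA.
(* The word cannot stop after a^*, whose tail is [k], and the only arrows of [mQ] with head [k] are
   the b^*; so the two stars are consumed together. *)
- case: s sn ws tk => [|y s] /=; first by rewrite eqxx.
  move=> sn /andP[hy ws] tk; rewrite !monomial_cons hy -!mulrA.
  case: y hy ws tk => [c|b a'|a'|b] /= hy ws tk.
  + by have := valP c; rewrite /= hy.
  + by have := hd_out b; rewrite hy.
  + by have := tl_in a'; rewrite hy.
  by rewrite !chi_stars IH ?mulrA // ltnW.
- by rewrite !chi_outstar mul0r.
Qed.

(** No path of [u] has its tail at [k], so the cut between the factors never separates an a^* from
    the b^* that follows it. *)
Lemma chiM u v : u * idem_hat K k mQ = u -> chi (u * v) = chi u * chi v.
Proof.
move=> <-; apply: (clin_eq (F := fun u => chi (u * idem_hat K k mQ * v))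
  (G := fun u => chi (u * idem_hat K k mQ) * chi v)).
- exact: (clin_comp clin_chi (clin_comp (clinMr _) (clinMr _))).
- exact: (clin_comp (clinMr _) (clin_comp clin_chi (clinMr _))).
move=> [j s] _ ws; rewrite monomial_hat /word_tl /=.
by case: eqP => [_|/eqP ne]; rewrite ?chiM_word // mul0r (clin0 clin_chi) mul0r.
Qed.

(** A bracketed series contains no stars, and on the remaining arrows [chi] replaces [[ba]] by [b a]
    again. It shows that every series of [Q] away from [k] is a value of [chi]. *)
Lemma chi_bracket v : idem_hat K k Q * v * idem_hat K k Q = v -> chi (bracket k v) = v.
Proof.
move=> <-; pose e := idem_hat K k Q.
apply: (clin_eq (F := fun v => chi (bracket k (e * v * e))) (G := fun v => e * v * e)).
- apply: (clin_comp clin_chi (clin_comp (clin_bracket _ _ _) _)).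
  exact: (clin_comp (clinMr e) (clinMl e)).
- exact: (clin_comp (clinMr e) (clinMl e)).
move=> [j s] _ ws; rewrite hat_monomial /=; case: eqP => [_|/eqP nj].
  by rewrite mul0r (clin0 (clin_bracket _ _ _)) (clin0 clin_chi).
rewrite monomial_hat /word_tl /=; case: eqP => [_|/eqP nt].
  by rewrite (clin0 (clin_bracket _ _ _)) (clin0 clin_chi).
apply: (bracket_monomial_ind lfQ (P := fun w => chi (bracket k (monomial K w)) = monomial K w))
  ws nj nt => [i _|c {}s ws _ IH|b a {}s ws _ IH].
- by rewrite -[monomial K (i, [::])]/(idem K i) bracket_idem chi_idem.
- by rewrite monomial_cons eqxx (bracket_off c) chi_old IH.
- by rewrite !monomial_cons eqxx (in_out a b) eqxx bracket_comp chi_comp IH.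
Qed.

End Chi.

(** * Linear compactness *)

Section LinearCompactness.
Variable K : fieldType.

Definition vanishes (W : eqType) (s : seq W) (f : W -> K^o) := forall w, w \in s -> f w = 0.

Section Separation.
Variables (W : eqType) (J : (W -> K^o) -> Prop).
Hypotheses (J0 : J 0) (JP : forall c x y, J x -> J y -> J (c *: x + y)).

Definition near_to (s : seq W) : {pred (W -> K^o)} :=
  [pred u | `[< exists2 x, J x & vanishes s (u - x) >] ].

Lemma near_to_closed s : submod_closed (near_to s).
Proof.
split; first by apply/asboolP; exists 0 => // w _; rewrite subrr.
move=> c u v /asboolP[x Jx ux] /asboolP[y Jy vy]; apply/asboolP.
exists (c *: x + y); first exact: JP.
move=> w ws; have -> : (c *: u + v - (c *: x + y)) w = c * (u - x) w + (v - y) w.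
  rewrite -![(_ + _) w]/(_ w + _ w) -![(- _) w]/(- _ w) -![(_ *: _) w]/(_ * _ w).
  by rewrite mulrBr opprD addrACA.
by rewrite ux // vy // mulr0 addr0.
Qed.
HB.instance Definition _ s := GRing.isSubmodClosed.Build K (W -> K^o) (near_to s) (near_to_closed s).

(** The analogue of Hahn-Banach for the product topology. If [v] is not in [near_to s], subtracting
    a retraction onto this subspace leaves a nonzero vector, and one of its coordinates is the
    functional; it only sees [s]. *)
Lemma separation v : (forall s, exists2 x, J x & vanishes s (v - x)) \/
  exists l : {linear (W -> K^o) -> K^o}, [/\ forall x, J x -> l x = 0,
    exists s, forall f, vanishes s f -> l f = 0 & l v <> 0].
Proof.
case: (pselect (forall s, exists2 x, J x & vanishes s (v - x))) => [|/existsNP[s nv]]; [by left|right].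
have [r [rN rid]] := retraction (near_to s).
have near u : vanishes s u -> u \in near_to s.
  by move=> us; apply/asboolP; exists 0 => //; rewrite subr0.
have nearJ x : J x -> x \in near_to s by move=> Jx; apply/asboolP; exists x => // w _; rewrite subrr.
have [w vw] : exists w, (v - r v) w <> 0.
  apply/existsNP => vr; apply: nv; have /asboolP := rN v.
  by rewrite (_ : r v = v) //; apply/esym/eqP; rewrite -subr_eq0; apply/eqP/funext.
have lL : linear (fun u => (u - r u) w : K^o).
  move=> c x y; rewrite linearP -![(_ + _) w]/(_ w + _ w) -![(- _) w]/(- _ w).
  rewrite -![(_ + _) w]/(_ w + _ w) -![(_ *: _) w]/(_ * _ w) -[_ *: _]/(_ * _).
  by rewrite mulrBr opprD addrACA.
have [l lE] := linear_bundle lL; exists l; split; last by rewrite lE.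
  by move=> x Jx; rewrite lE rid ?subrr //; apply: nearJ.
by exists s => f fs; rewrite lE rid ?subrr //; apply: near.
Qed.

End Separation.

Section ClosedImage.
Variables (W1 W2 : eqType) (F : {linear (W1 -> K^o) -> (W2 -> K^o)}).
Hypothesis Fc : forall w, exists s, forall f, vanishes s f -> F f w = 0.
Variable J : (W2 -> K^o) -> Prop.
Hypotheses (J0 : J 0) (JP : forall c x y, J x -> J y -> J (c *: x + y)).

(** The continuous dual of the quotient by [J]: continuity means dependence on finitely many
    coordinates. *)
Definition annihilator : {pred ((W2 -> K^o) -> K^o)} :=
  [pred l | `[< [/\ linear l, exists s, forall f, vanishes s f -> l f = 0 & forall x, J x -> l x = 0] >] ].

Lemma annihilator_closed : submod_closed annihilator.
Proof.
split.
  apply/asboolP; split=> //; last by exists [::].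
  by move=> c x y; rewrite -![(0 : _ -> _) _]/(0 : K^o) scaler0 addr0.
move=> c l m /asboolP[lL [s ls] lJ] /asboolP[mL [t mt] mJ]; apply/asboolP.
have E x : (c *: l + m) x = c *: l x + m x by [].
split.
- by move=> d x y; rewrite !E lL mL !scalerDr !scalerA addrACA [c * d]mulrC.
- exists (s ++ t) => f fst; rewrite E ls ?mt ?scaler0 ?addr0 // => w ws; apply: fst;
  by rewrite mem_cat ws ?orbT.
- by move=> x Jx; rewrite E lJ // mJ // scaler0 addr0.
Qed.
HB.instance Definition _ := GRing.isSubmodClosed.Build K ((W2 -> K^o) -> K^o) annihilator annihilator_closed.

Definition annL : lmodType K := subspace annihilator.

Lemma Fc_seq (t : seq W2) : exists s, forall f, vanishes s f -> vanishes t (F f).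
Proof.
elim: t => [|w t [s IH]]; first by exists [::].
have [s' Fs] := Fc w; exists (s' ++ s) => f fs w'; rewrite inE => /orP[/eqP->|].
  by apply: Fs => x xs; apply: fs; rewrite mem_cat xs.
by apply: IH => x xs; apply: fs; rewrite mem_cat xs orbT.
Qed.

(* Duality: [F] is the transpose of [l |-> l \o F], and a functional on the
   annihilator of [J] that vanishes on the kernel of this map extends. *)
Lemma closed_image v :
  (forall u, (forall s, exists2 x, J x & vanishes s (u - x)) -> J u) ->
  (forall s, exists f, exists2 x, J x & vanishes s (v - F f - x)) ->
  exists f, J (v - F f).
Proof.
move=> Jc vF.
have lL (l : annL) : linear (val l) by have /asboolP[] := valP l.
have lc (l : annL) : exists s, forall f, vanishes s f -> val l f = 0 by have /asboolP[] := valP l.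
have lJ (l : annL) x : J x -> val l x = 0 by have /asboolP[_ _] := valP l; apply.
have TL : linear (fun l : annL => (fun f => val l (F f)) : (W1 -> K^o) -> K^o).
  by move=> c l m; apply: funext => f; rewrite linearP.
have eL : linear (fun l : annL => val l v : K^o) by move=> c l m; rewrite linearP.
have [T TE] := linear_bundle TL; have [e eE] := linear_bundle eL.
have [h hT] := generalized_inverse T.
have eT l : e (h (T l)) = e l.
  apply/eqP; rewrite eq_sym -subr_eq0 -linearB; apply/eqP.
  have : T (l - h (T l)) = 0 by rewrite linearB hT subrr.
  rewrite TE eE => /(fun H f => congr1 (fun g : (W1 -> K^o) -> K^o => g f) H) /= T0.
  set m : annL := l - h (T l) in T0 *.
  have [M ME] := linear_bundle (lL m).
  have [s ms] := lc m; have [f [x Jx vfx]] := vF s.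
  have : M (v - F f - x) = 0 by rewrite ME; exact: ms.
  rewrite linearB linearB !ME (lJ _ _ Jx) subr0 => /eqP; rewrite subr_eq0 => /eqP vE.
  by rewrite -[LHS]/(val m v) vE; exact: T0.
pose coord (w : W1) : (W1 -> K^o) -> K^o := fun f => f w.
(* [e \o h] extends evaluation at [v] to all functionals on the source; its values on the coordinate
   functionals are the coordinates of the solution. *)
pose y : W1 -> K^o := fun w => e (h (coord w)).
exists y; have [|[l [l1 l2 l3]]] := separation J0 JP (v - F y); first exact: Jc.
have lA : (l : _ -> K^o) \in annihilator by apply/asboolP; split=> //; exact: linearP.
pose m : annL := Subspace lA.
have [t lt] := l2; have [s Fs] := Fc_seq t.
pose u := undup s.
pose delta (w : W1) : W1 -> K^o := fun w' => (w' == w)%:R.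
(* As [m \o F] depends on finitely many coordinates, it is a finite combination of coordinate
   functionals, and on those evaluation at [y] agrees with [e \o h]. *)
have Tm f : val m (F f) = \sum_(w <- u) f w * val m (F (delta w)).
  have d0 : vanishes s (f - \sum_(w <- u) f w *: delta w).
    move=> w ws; rewrite -[LHS]/(f w - (\sum_(x <- u) f x *: delta x) w).
    have -> : (\sum_(x <- u) f x *: delta x) w = \sum_(x <- u) f x * delta x w.
      by elim/big_rec2: _ => // x a b _ <-.
    have wu : w \in u by rewrite mem_undup.
    rewrite (bigD1_seq w) ?undup_uniq //= /delta eqxx mulr1 big1 ?addr0 ?subrr // => x /negbTE.
    by rewrite eq_sym => ->; rewrite mulr0.
  have := lt _ (Fs _ d0); rewrite -[val m]/(l : _ -> _) linearB linearB => /eqP; rewrite subr_eq0 => /eqP ->.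
  rewrite 2!linear_sum; apply: eq_bigr => w _; by rewrite 2!linearZ.
have TmE : T m = \sum_(w <- u) val m (F (delta w)) *: coord w.
  rewrite TE; apply: funext => f; rewrite Tm.
  have -> : (\sum_(x <- u) val m (F (delta x)) *: coord x) f = \sum_(x <- u) val m (F (delta x)) * f x.
    by elim/big_rec2: _ => // x a b _ <-.
  by apply: eq_bigr => w _; rewrite mulrC.
case: l3; rewrite linearB; apply/eqP; rewrite subr_eq0; apply/eqP.
have -> : l v = e m by rewrite eE.
rewrite -eT TmE 2!linear_sum -[l (F y)]/(val m (F y)) Tm; apply: eq_bigr => w _.
by rewrite 2!linearZ /= mulrC.
Qed.

End ClosedImage.
End LinearCompactness.

(** * Jacobian ideals and derivatives of the premuted potential *)

Section Jacobian.
Variables (K : fieldType) (I : finType) (Q : quiver I).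
Implicit Types (u v z : cpa K Q) (G : cpa K Q -> Prop).

Lemma closed_mclosure G : G 0 -> (forall c u v, G u -> G v -> G (c *: u + v)) ->
  closed_subspace (mclosure G).
Proof.
move=> G0 GP; split=> [n|c u v Gu Gv n|u cu n]; first by exists 0; rewrite ?subrr //; exact: in_mpow0.
  have [u' Gu' uu] := Gu n; have [v' Gv' vv] := Gv n.
  exists (c *: u' + v'); first exact: GP.
  rewrite (_ : _ - _ = c *: (u - u') + (v - v')); first exact: in_mpowP.
  by rewrite scalerBr opprD addrACA.
have [v Gv uv] := cu n; have [w Gw vw] := Gv n; exists w => //.
by rewrite -(subrK v u) -addrA; apply: in_mpowD.
Qed.

Lemma mclosure_map G z u (F : cpa K Q -> cpa K Q) : clin F -> (forall v, G v -> G (F v)) ->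
  mclosure G u -> mclosure G (F u).
Proof.
move=> [FL Fc] FG Gu n; have [N FN] := Fc n; have [v Gv uv] := Gu N.
exists (F v); first exact: FG.
have [f fE] := linear_bundle FL; rewrite -!fE -linearB fE; exact: FN.
Qed.

Lemma two_sided_ideal_gen G p g q : G g -> two_sided_ideal G (p * g * q).
Proof. by move=> Gg; exists 1, (fun=> p), (fun=> g), (fun=> q); rewrite big_ord1. Qed.

Lemma two_sided_idealP G c u v :
  two_sided_ideal G u -> two_sided_ideal G v -> two_sided_ideal G (c *: u + v).
Proof.
move=> [n [x [g [y [Gg ->]]]]] [m [x' [g' [y' [Gg' ->]]]]].
pose pick T (f : 'I_n -> T) (f' : 'I_m -> T) (i : 'I_(n + m)) :=
  match fintype.split i with inl j => f j | inr j => f' j end.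
exists (n + m)%N, (pick _ (fun i => c *: x i) x'), (pick _ g g'), (pick _ y y'); split.
  by move=> i; rewrite /pick; case: fintype.split.
rewrite big_split_ord scaler_sumr; congr (_ + _); apply: eq_bigr => i _; rewrite /pick.
  by rewrite (unsplitK (inl i : 'I_n + 'I_m)) !scaleMl.
by rewrite (unsplitK (inr i : 'I_n + 'I_m)).
Qed.

Lemma two_sided_ideal0 G : two_sided_ideal G 0.
Proof. by exists 0, (fun=> 0), (fun=> 0), (fun=> 0); split=> [[]//|]; rewrite big_ord0. Qed.

Lemma two_sided_idealM G z z' u : two_sided_ideal G u -> two_sided_ideal G (z * u * z').
Proof.
move=> [n [x [g [y [Gg ->]]]]]; exists n, (fun i => z * x i), g, (fun i => y i * z'); split=> //.
by rewrite mulr_sumr mulr_suml; apply: eq_bigr => i _; rewrite !mulrA.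
Qed.

Variable S : cpa K Q.
Notation J := (jacobian_ideal S).

Lemma closed_jacobian : closed_subspace J.
Proof. by apply: closed_mclosure; [exact: two_sided_ideal0 | exact: two_sided_idealP]. Qed.

Lemma jacobianMl z u : J u -> J (z * u).
Proof.
apply: (mclosure_map z (clinMl z)) => v Gv; rewrite -[z * v]mulr1.
exact: two_sided_idealM.
Qed.

Lemma jacobianMr z u : J u -> J (u * z).
Proof.
apply: (mclosure_map z (clinMr z)) => v Gv; rewrite -[v]mul1r.
exact: two_sided_idealM.
Qed.

Lemma jacobian_cder a : J (cder S a).
Proof.
move=> n; exists (cder S a); last by rewrite subrr; exact: in_mpow0.
by rewrite -[cder S a]mulr1 -[cder S a]mul1r; apply: two_sided_ideal_gen; exists a.
Qed.

Lemma jacobian_ind (X : cpa K Q -> Prop) u : closed_subspace X ->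
  (forall p a q, X (p * cder S a * q)) -> J u -> X u.
Proof.
move=> Xc Xg Ju; have [_ _ Xcl] := Xc; apply: Xcl => n; have [v [m [x [g [y [Gg ->]]]]] uv] := Ju n.
exists (\sum_i x i * g i * y i) => //; apply: subspace_sum => // i.
by have [a ->] := Gg i; exact: Xg.
Qed.

End Jacobian.

(** * Undoing the bracket, and derivatives of bracketed potentials *)

Section PremutDerivatives.
Variables (K : fieldType) (I : finType) (Q : quiver I) (k : I).
Hypotheses (lfQ : loop_free Q) (acQ : two_acyclic Q).
Notation mQ := (premut_quiver k Q).
Notation hat := (idem_hat K k Q).

Lemma cder_support (Q' : quiver I) (U : cpa K Q') c q : cder U c q != 0 ->
  exists2 w, U w != 0 & forall x, x \in c :: q.2 -> x \in w.2.
Proof.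
rewrite [cder U c q]/(cder_coef U c q) /cder_coef.
case: ifP => [_|_ /eqP//] nz; apply: contrapT => nw; case/eqP: nz.
apply: big1 => j _; apply: big1 => t _; apply: big1 => i /eqP ti; apply: contrapT => /eqP nz.
by apply: nw; exists (j, val t) => // x; rewrite -ti mem_rot.
Qed.

Definition star (x : arrow mQ) := bracket_arrow x == None.
Definition star_free (u : cpa K mQ) := forall w, u w != 0 -> ~~ has star w.2.

Lemma star_free_bracket v : star_free (bracket k v).
Proof.
move=> [j t] nz; have wt : walk j t by apply: contraNT nz => nw; apply/eqP; exact: coef0P.
move: nz; rewrite bracketE //; case e: expand => [s|]; rewrite ?eqxx // => _.
elim: t s e {wt} => [|x t IH] s //= e; rewrite negb_or.
by move: e; rewrite /star; case: (bracket_arrow x) => // s1; case e': expand => [s2|] // _; exact: IH e'.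
Qed.

Lemma star_free_cder u c : star_free u -> star_free (cder u c).
Proof.
move=> su q /cder_support[w /su nw sub]; apply: contra nw => /hasP[x xq sx].
by apply/hasP; exists x => //; apply: sub; rewrite inE xq orbT.
Qed.

Lemma cder_star u c : star_free u -> star c -> cder u c = 0.
Proof.
move=> su sc; apply: cpaP => j s _; apply: contrapT => /eqP nz.
have [w /su nw sub] := cder_support nz; case/negP: nw.
by apply/hasP; exists c => //; apply: sub; rewrite inE eqxx.
Qed.

Definition unbracket (x : arrow mQ) : cpa K Q :=
  match x with
  | Old c => arr K (val c)
  | Comp b a => arr K (val b) * arr K (val a)
  | _ => 0
  end.

Lemma admissible_unbracket : admissible unbracket.
Proof.
split=> -[c|b a|a|b] /=; rewrite ?mulr0 ?mul0r ?mulrA ?idem_arr -?mulrA ?arr_idem //;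
  try exact: in_mpow0; try exact: in_mpow_arr.
by apply: in_mpowMr; exact: in_mpow_arr.
Qed.

Variable S : cpa K Q.
Hypothesis pS : potential S.
Notation omega := (subst unbracket).

(** Without stars there is no pair for [psi] to replace. Unlike [chi], the substitution [omega] is a
    homomorphism on the whole algebra, so the chain rule applies to it. *)
Lemma chi_unbracket u : star_free u -> chi S u = omega u.
Proof.
move=> su; apply: (clin_eq (clin_chi S k)); first exact: clin_subst.
move=> [j s] /su /= ns ws; have W := subst_hom admissible_unbracket.
elim: s j ns ws => [|x s IH] j /=; first by rewrite chi_idem // (hom_idem W).
rewrite negb_or => /andP[sx ns] /andP[/eqP hx ws].
rewrite monomial_cons hx eqxx (hom_mul W) (subst_arr admissible_unbracket) -(IH _ ns ws).
by case: x sx {hx ws} => //= [c|b a] _; rewrite ?chi_old // chi_comp // mulrA.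
Qed.

Lemma unbracketK v : hat * v * hat = v -> omega (bracket k v) = v.
Proof.
move=> vh; rewrite -chi_unbracket; last exact: star_free_bracket.
exact: chi_bracket.
Qed.

Lemma off_neq (c : off_arrow k Q) : [/\ hd (val c) != k & tl (val c) != k].
Proof. by have /andP[] := valP c. Qed.

Lemma hd_in (a : in_arrow k Q) : hd (val a) = k. Proof. exact/eqP/(valP a). Qed.
Lemma tl_out (b : out_arrow k Q) : tl (val b) = k. Proof. exact/eqP/(valP b). Qed.

Lemma off_out (c : off_arrow k Q) (b : out_arrow k Q) : val c != val b.
Proof.
have [_] := off_neq c; apply: contraNN => e; apply/eqP; rewrite -[RHS](tl_out b).
by congr tl; apply/eqP.
Qed.

Lemma off_in (c : off_arrow k Q) (a : in_arrow k Q) : val c != val a.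
Proof.
have [+ _] := off_neq c; apply: contraNN => e; apply/eqP; rewrite -[RHS](hd_in a).
by congr hd; apply/eqP.
Qed.

Lemma out_in (b : out_arrow k Q) (a : in_arrow k Q) : val b != val a.
Proof.
have := hd_out lfQ b; apply: contraNN => e; apply/eqP; rewrite -[RHS](hd_in a).
by congr hd; apply/eqP.
Qed.

Variable S0 : cpa K Q.
Hypotheses (pS0 : potential S0) (S0h : hat * S0 * hat = S0).

Lemma potential_bracket : potential (bracket k S0).
Proof.
move=> [j t] nz; have wt : walk j t by apply: contraNT nz => nw; apply/eqP; exact: coef0P.
move: nz; rewrite bracketE //; case e: expand => [s|]; rewrite ?eqxx // => /pS0 /and3P[_ tj s0].
rewrite /cyclic /is_path /= wt /word_tl /= -(expand_bracket_tl _ e) tj /=.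
by case: t e {wt} => // -[] sE; rewrite -sE in s0.
Qed.

Lemma ins_unbracket_out c v (x : arrow mQ) :
  c \notin (if bracket_arrow x is Some s then s else [::]) -> ins c (unbracket x) v = 0.
Proof.
case: x => [d|b a|a|b] /=; rewrite ?inE ?negb_or => nc.
- by rewrite ins_arr eq_sym (negbTE nc).
- case/andP: nc => cb ca; rewrite insM !ins_arr.
  by rewrite ![_ == c]eq_sym (negbTE cb) (negbTE ca) addr0.
- exact: clin0 (clin_ins_l c v).
- exact: clin0 (clin_ins_l c v).
Qed.

(** Chain rule for [S0 = omega (bracket k S0)]: among the images of the arrows under [omega], only
    that of [Old c] contains [c]. *)
Lemma cder_unbracket_off (c : off_arrow k Q) :
  omega (cder (bracket k S0) (Old c : arrow mQ)) = cder S0 (val c).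
Proof.
rewrite -{2}(unbracketK S0h) (cder_hom _ (subst_hom admissible_unbracket) potential_bracket).
rewrite (bigD1 (Old c : arrow mQ)) //= big1 ?addr0 => [|x xc]; rewrite (subst_arr admissible_unbracket).
  rewrite /= ins_arr eqxx -(hom_idem (subst_hom admissible_unbracket)) -(hom_mul (subst_hom admissible_unbracket)).
  rewrite (idem_cder (bracket k S0) (Old c : arrow mQ)).
  rewrite -(hom_idem (subst_hom admissible_unbracket)) -(hom_mul (subst_hom admissible_unbracket)).
  by rewrite (cder_idem (Old c : arrow mQ) potential_bracket).
apply: ins_unbracket_out; case: x xc => [d|b a|a|b] //= xc; rewrite !inE.
  by apply: contraNN xc => /eqP/val_inj ->.
by rewrite negb_or; apply/andP; split; [exact: off_out | exact: off_in].
Qed.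

(** Differentiating [omega (bracket k S0)] at [b] gives the sum over all [a'] of [a'] times the
    image of the derivative at [[ba']]; left division by [a] keeps the term [a' = a]. *)
Lemma cder_unbracket_comp (b : out_arrow k Q) (a : in_arrow k Q) :
  omega (cder (bracket k S0) (Comp b a : arrow mQ)) = cder2 S0 (val b) (val a).
Proof.
have W := subst_hom admissible_unbracket.
have ab : hd (val a) = tl (val b) by rewrite hd_in tl_out.
rewrite cder2_ldiv // -{2}(unbracketK S0h) (cder_hom _ W potential_bracket).
have F x : clin (ldiv x : cpa K Q -> _) := clin_ldiv K x.
have [g gE] := linear_bundle (F (val a)).1; rewrite -gE linear_sum.
have insb (a' : in_arrow k Q) V : ins (val b) (arr K (val b) * arr K (val a')) V =
    arr K (val a') * V * idem K (hd (val b)).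
  rewrite insM !ins_arr eqxx ifN; last by rewrite eq_sym; exact: out_in.
  have ia := idem_arr K (val a'); rewrite hd_in in ia.
  by rewrite addr0 tl_out !mulrA ia.
have lda (a' : in_arrow k Q) V : ldiv (val a) (arr K (val a') * V) = if a' == a then idem K (tl (val a)) * V else 0.
  by rewrite ldivM ldiv_arr coef_arr_nil scale0r addr0 val_eqE; case: eqP => [//|]; rewrite mul0r.
rewrite (bigD1 (Comp b a : arrow mQ)) //= big1 ?addr0 => [|x xc]; rewrite gE (subst_arr admissible_unbracket) /=.
  rewrite insb -mulrA lda eqxx -2!(hom_idem W) -2!(hom_mul W) mulrA.
  rewrite (idem_cder (bracket k S0) (Comp b a : arrow mQ)).
  by rewrite (cder_idem (Comp b a : arrow mQ) potential_bracket).
case: x xc => [d|b' a'|a'|b'] xc; try by rewrite ins_unbracket_out ?(clin0 (F _)).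
  rewrite ins_unbracket_out ?(clin0 (F _)) //= inE eq_sym; exact: off_out.
case: (eqVneq b' b) xc => [->|nb] xc.
  by rewrite insb -mulrA lda ifN //; apply: contraNN xc => /eqP->.
rewrite ins_unbracket_out ?(clin0 (F _)) //= !inE negb_or; apply/andP; split; last exact: out_in.
by apply: contraNN nb => /eqP/val_inj ->.
Qed.

End PremutDerivatives.

Section PremutPotential.
Variables (K : fieldType) (I : finType) (Q : quiver I) (k : I).
Hypotheses (lfQ : loop_free Q) (acQ : two_acyclic Q).
Notation mQ := (premut_quiver k Q).
Notation st a := (arr K (InStar a : arrow mQ)).
Notation ost b := (arr K (OutStar b : arrow mQ)).
Notation cmp b a := (arr K (Comp b a : arrow mQ)).

Definition triangle (b : out_arrow k Q) (a : in_arrow k Q) : cpa K mQ := ost b * cmp b a * st a.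

Lemma triangle_monomial b a : triangle b a =
  monomial K (k, [:: OutStar b : arrow mQ; Comp b a : arrow mQ; InStar a : arrow mQ]).
Proof.
rewrite /triangle !monomial_cons /= !eqxx -mulrA; congr (_ * (_ * _)).
by rewrite -[LHS](arr_idem K).
Qed.

Lemma potential_triangle b a : potential (triangle b a).
Proof.
by rewrite triangle_monomial; apply: potential_monomial; rewrite /cyclic /is_path /word_tl /= !eqxx.
Qed.

Lemma cder_triangle b a (x : arrow mQ) : cder (triangle b a) x =
  (if OutStar b == x :> arrow mQ then cmp b a * st a else 0)
  + (if Comp b a == x :> arrow mQ then st a * ost b else 0)
  + (if InStar a == x :> arrow mQ then ost b * cmp b a else 0).
Proof.
rewrite cder_ins; last exact: potential_triangle.
rewrite !insM !mulr1 mul1r !ins_arr.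
have E1 := idem_arr K (Comp b a : arrow mQ); have E2 := arr_idem K (InStar a : arrow mQ).
have E3 := idem_arr K (InStar a : arrow mQ); have E4 := arr_idem K (OutStar b : arrow mQ).
have E5 := idem_arr K (OutStar b : arrow mQ); have E6 := arr_idem K (Comp b a : arrow mQ).
rewrite /= in E1 E2 E3 E4 E5 E6.
congr (_ + _ + _); case: eqP => // <- /=.
- by rewrite mulrA E1 -mulrA E2.
- by rewrite mulrA E3 -mulrA E4.
- by rewrite mulrA E5 -mulrA E6.
Qed.

Variables (S S0 : cpa K Q).
Hypotheses (pS : potential S) (pS0 : potential S0) (S0h : idem_hat K k Q * S0 * idem_hat K k Q = S0).
Hypothesis SS0 : cyc_equiv S S0.
Notation mS := (premut_potential k S0).

Lemma premut_potentialE : mS = bracket k S0 + \sum_b \sum_a triangle b a.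
Proof. by []. Qed.

Lemma potential_premut : potential mS.
Proof.
have C := @closed_potential K I mQ.
have [_ + _] := C => /(_ 1 (bracket k S0)) H; rewrite premut_potentialE -[bracket k S0]scale1r.
apply: H; first exact: potential_bracket.
by do 2!apply: subspace_sum => // ?; exact: potential_triangle.
Qed.

Lemma cder_premut (x : arrow mQ) : cder mS x = cder (bracket k S0) x + \sum_b \sum_a cder (triangle b a) x.
Proof.
have [g gE] := linear_bundle (clin_cder K x).1.
rewrite premut_potentialE -gE linearD linear_sum gE; congr (_ + _); apply: eq_bigr => b _.
by rewrite linear_sum; apply: eq_bigr => a _; rewrite gE.
Qed.

Lemma cder_premut_off c : cder mS (Old c : arrow mQ) = cder (bracket k S0) (Old c : arrow mQ).
Proof.
rewrite cder_premut [X in _ + X]big1 ?addr0 // => b _; rewrite big1 // => a _.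
by rewrite cder_triangle !addr0.
Qed.

Lemma cder_premut_comp b a : cder mS (Comp b a : arrow mQ) =
  cder (bracket k S0) (Comp b a : arrow mQ) + st a * ost b.
Proof.
rewrite cder_premut; congr (_ + _); rewrite (bigD1 b) //= (bigD1 a) //= !big1 ?addr0.
- by rewrite cder_triangle eqxx add0r addr0.
- move=> b' nb; rewrite big1 // => a' _; rewrite cder_triangle add0r addr0.
  by case: eqP => // -[e _]; rewrite e eqxx in nb.
- move=> a' na; rewrite cder_triangle add0r addr0.
  by case: eqP => // -[e]; rewrite e eqxx in na.
Qed.

Lemma cder_premut_in a : cder mS (InStar a : arrow mQ) = \sum_b ost b * cmp b a.
Proof.
rewrite cder_premut cder_star ?add0r //; last exact: star_free_bracket.
apply: eq_bigr => b _; rewrite (bigD1 a) //= big1 ?addr0.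
  by rewrite cder_triangle eqxx !add0r.
move=> a' na; rewrite cder_triangle !add0r.
by case: eqP => // -[e]; rewrite e eqxx in na.
Qed.

Lemma cder_premut_out b : cder mS (OutStar b : arrow mQ) = \sum_a cmp b a * st a.
Proof.
rewrite cder_premut cder_star ?add0r //; last exact: star_free_bracket.
rewrite (bigD1 b) //= [X in _ + X]big1 ?addr0.
  by apply: eq_bigr => a _; rewrite cder_triangle eqxx !addr0.
move=> b' nb; rewrite big1 // => a _; rewrite cder_triangle !addr0.
by case: eqP => // -[e]; rewrite e eqxx in nb.
Qed.

Lemma chi_cder_off c : chi S (cder mS (Old c : arrow mQ)) = cder S (val c).
Proof.
rewrite cder_premut_off chi_unbracket //; last exact/star_free_cder/star_free_bracket.
by rewrite (cder_unbracket_off lfQ acQ pS) // (cder_cyc_equiv _ SS0).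
Qed.

(** The derivative is that of the bracketed potential plus a^* b^*. Under [chi] the first becomes
    the second derivative at [b a] and the other its negative: this cancellation dictates the sign
    in [psi]. *)
Lemma chi_cder_comp b a : chi S (cder mS (Comp b a : arrow mQ)) = 0.
Proof.
have [g gE] := linear_bundle (clin_chi S k).1.
rewrite cder_premut_comp -gE linearD !gE chi_unbracket //; last exact/star_free_cder/star_free_bracket.
have ab : hd (val a) = tl (val b) by rewrite hd_in tl_out.
rewrite (cder_unbracket_comp lfQ acQ pS) // cder2_ldiv // -(cder_cyc_equiv _ SS0) -cder2_ldiv //.
rewrite -[ost b](arr_idem K) chi_stars // chi_idem // mulNr (cder2_idem pS ab) subrr //.
Qed.


End PremutPotential.

(** * Solvable linear systems over a path algebra form a closed subspace *)

Section ClosedSystem.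
Variables (K : fieldType) (I : finType) (Q Q' : quiver I) (A B : finType).
Variables (L : A -> cpa K Q) (R : B -> cpa K Q) (X : A -> B -> cpa K Q' -> cpa K Q).
Variable J : cpa K Q -> Prop.
Hypotheses (Xc : forall r s, clin (X r s)) (Jc : closed_subspace J).

Lemma words_below n : exists s : seq (word Q), forall w, (size w.2 < n)%N -> w \in s.
Proof.
have [t tP] : exists t : seq (seq (arrow Q)), forall s, (size s < n)%N -> s \in t.
  elim: n => [|n [t IH]]; first by exists [::].
  exists ([::] :: [seq c :: s | c <- enum (arrow Q), s <- t]) => -[|c s] // ls.
  by rewrite inE orFb; apply/allpairsP; exists (c, s); split=> //=; [rewrite mem_enum | exact: IH].
exists [seq (j, s) | j <- enum I, s <- t] => -[j s] ls.
by apply/allpairsP; exists (j, s); split=> //=; [rewrite mem_enum | exact: tP].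
Qed.

(** The unknown series are encoded as arbitrary functions on words, to have a full product of copies
    of [K] as in [closed_image]; values outside the paths are discarded. *)
Definition cpa_of_coef (f : word Q -> K^o) (w : word Q) : K := if is_path w then f w else 0.
Lemma cpa_of_supported f : cpa_of_coef f \in path_supported K Q.
Proof. by apply/asboolP => w nw; rewrite /cpa_of_coef (negbTE nw). Qed.
Definition cpa_of f : cpa K Q := Cpa (cpa_of_supported f).

Lemma cpa_ofE f w : cpa_of f w = if is_path w then f w else 0. Proof. by []. Qed.

Lemma cpa_ofK (u : cpa K Q) : cpa_of u = u.
Proof. by apply: cpaP => j s ws; rewrite cpa_ofE /is_path /= ws. Qed.

Definition solvable (u : cpa K Q') : Prop := exists (y : B -> cpa K Q) (x : A -> cpa K Q),
  forall r s, J (X r s u - (L r * y s + x r * R s)).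

Let W1 : eqType := ((B * word Q) + (A * word Q))%type.
Let W2 : eqType := (A * B * word Q)%type.
Let yof (f : W1 -> K^o) s := cpa_of (fun w => f (inl (s, w))).
Let xof (f : W1 -> K^o) r := cpa_of (fun w => f (inr (r, w))).
Let Ffun (f : W1 -> K^o) : W2 -> K^o :=
  fun z => (L z.1.1 * yof f z.1.2 + xof f z.1.1 * R z.1.2) z.2.
Let JJ (g : W2 -> K^o) := forall r s, exists2 j, J j & forall w, g (r, s, w) = j w.

(** An instance of [closed_image]: [W1] indexes the coefficients of the unknown series, [W2] those
    of the equations, and a limit of solvable right-hand sides is solvable to every finite order. *)
Lemma closed_solvable : closed_subspace solvable.
Proof.
have [J0 JP Jcl] := Jc.
have XP r s c u v : X r s (c *: u + v) = c *: X r s u + X r s v by have [H _] := Xc r s; exact: H.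
split.
- exists (fun=> 0), (fun=> 0) => r s; rewrite mulr0 mul0r addr0 subr0.
  by rewrite (clin0 (Xc r s)).
- move=> c u v [y [x h]] [y' [x' h']]; exists (fun s => c *: y s + y' s), (fun r => c *: x r + x' r) => r s.
  rewrite XP mulrDr mulrDl scaleMr scaleMl.
  rewrite (_ : _ - _ = c *: (X r s u - (L r * y s + x r * R s)) + (X r s v - (L r * y' s + x' r * R s))).
    exact: JP.
  by rewrite [X in _ - X]addrACA -scalerDr opprD addrACA scalerBr.
move=> u cu.
have yofP c f g s : yof (c *: f + g) s = c *: yof f s + yof g s.
  by apply: cpaP => j t wt; rewrite coefD coefZ !cpa_ofE /is_path /= wt.
have xofP c f g r : xof (c *: f + g) r = c *: xof f r + xof g r.
  by apply: cpaP => j t wt; rewrite coefD coefZ !cpa_ofE /is_path /= wt.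
have FL : linear Ffun.
  move=> c f g; apply: funext => -[[r s] w]; rewrite /Ffun /= yofP xofP mulrDr mulrDl scaleMr scaleMl.
  rewrite addrACA -scalerDr coefD coefZ //.
have [F FE] := linear_bundle FL.
have Fc w : exists t, forall f, vanishes t f -> F f w = 0.
  case: w => [[r s] w].
  (* The coefficient of [L r * y s + x r * R s] at [w] involves [y s] only at the suffixes of [w]
     and [x r] only at its prefixes. *)
  exists ([seq inl (s, (word_tl (w.1, take i w.2), drop i w.2)) | i <- iota 0 (size w.2).+1]
    ++ [seq inr (r, (w.1, take i w.2)) | i <- iota 0 (size w.2).+1]) => f ft.
  rewrite FE /Ffun /= coefD !coefM /conv !big1 ?addr0 // => -[i li] _ /=; rewrite cpa_ofE.
    rewrite ft ?if_same ?mul0r // mem_cat; apply/orP; right; apply/mapP; exists i => //.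
    by rewrite mem_iota.
  rewrite ft ?if_same ?mulr0 // mem_cat; apply/orP; left; apply/mapP; exists i => //.
  by rewrite mem_iota.
have JJ0 : JJ 0 by move=> r s; exists 0.
have JJP c f g : JJ f -> JJ g -> JJ (c *: f + g).
  move=> jf jg r s; have [j Jj je] := jf r s; have [j' Jj' je'] := jg r s.
  by exists (c *: j + j'); [exact: JP | move=> w; rewrite coefD coefZ -je -je'].
pose v : W2 -> K^o := fun z => X z.1.1 z.1.2 u z.2.
have [||f Jf] := closed_image Fc JJ0 JJP (v := v).
- move=> g gJ r s.
  have g0 w : ~~ is_path w -> g (r, s, w) = 0.
    move=> nw; have [x xJ /(_ (r, s, w))] := gJ [:: (r, s, w)].
    rewrite mem_seq1 eqxx => /(_ isT) /eqP; rewrite -[(g - x) _]/(g _ - x _) subr_eq0 => /eqP ->.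
    by have [j _ ->] := xJ r s; exact: coef0P.
  exists (cpa_of (fun w => g (r, s, w))); last first.
    by move=> w; rewrite cpa_ofE; case: ifP => // /negbT /g0.
  apply: Jcl => n; have [t tP] := words_below n.
  have [x xJ vx] := gJ [seq (r, s, w) | w <- t]; have [j Jj je] := xJ r s.
  exists j => // w wn; rewrite coefD coefN -je cpa_ofE.
  case: ifP => [_|/negbT/g0 gw]; last first.
    have := vx (r, s, w); rewrite map_f ?tP // => /(_ isT).
    by rewrite -[(g - x) _]/(g _ - x _) gw.
  by apply: vx; rewrite map_f ?tP.
(* [n] exceeds the length of every word of [t]; [u] is then approximated by a solvable [u'] closely
   enough that every [X r s] takes values on both that agree below length [n]. *)
- move=> t; pose n := (\max_(z <- t) size z.2.2).+1.
  have /choice[N NP] : forall z : A * B, exists m, forall g, in_mpow m g -> in_mpow n (X z.1 z.2 g).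
    by move=> z; have [_ H] := Xc z.1 z.2; exact: H.
  have [u' [y [x h]] uu'] := cu (\max_z N z)%N.
  pose f : W1 -> K^o := fun z => match z with inl z => y z.1 z.2 | inr z => x z.1 z.2 end.
  have yE s : yof f s = y s by exact: (cpa_ofK (y s)).
  have xE r : xof f r = x r by exact: (cpa_ofK (x r)).
  exists f, (fun z => (X z.1.1 z.1.2 u' - (L z.1.1 * y z.1.2 + x z.1.1 * R z.1.2)) z.2).
    by move=> r s; eexists; first exact: h.
  move=> [[r s] w] wt; rewrite -[LHS]/(v _ - F f _ - _) FE /Ffun /v /= yE xE.
  rewrite [X in _ - X]coefD coefN opprB addrA subrK.
  have [H _] := Xc r s; have [g gE] := linear_bundle H.
  rewrite -coefN -coefD -!gE -linearB gE; apply: (NP (r, s)).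
    by apply: in_mpowS uu'; exact: leq_bigmax.
  by rewrite ltnS; apply: leq_bigmax_seq wt _.
exists (yof f), (xof f) => r s; have [j Jj je] := Jf r s.
rewrite (_ : _ - _ = j) //; apply: val_inj; apply: funext => w; rewrite -[RHS]/(j w) -je.
by rewrite -[RHS]/(v _ - F f _) FE.
Qed.

End ClosedSystem.

(** * Right-equivalences *)

Section AutomaticContinuity.
Variables (K : fieldType) (I : finType) (Q Q' : quiver I) (f : cpa K Q -> cpa K Q').
Hypotheses (fL : linear f) (fM : forall u v, f (u * v) = f u * f v).
Hypotheses (fe : forall j, f (idem K j) = idem K j) (lf : loop_free Q).

(** The image of [c] runs from its tail to its head; these vertices differ, so it has no trivial
    path. *)
Lemma hom_arr_loop_free c : in_mpow 1 (f (arr K c)).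
Proof.
rewrite -[arr K c](arr_idem K) -[arr K c](idem_arr K) !fM !fe => -[j [|//]] _.
rewrite Midem idemM /word_tl /=; case: (j =P hd c) => [->|_]; last by rewrite mul0rn.
by rewrite (negbTE (lf c)).
Qed.

(** Continuity is automatic: an element of order n + 1 is a finite sum of products of an arrow and
    an element of order n, so linearity and multiplicativity carry the order over by induction. *)
Lemma alg_hom_loop_free : alg_hom f.
Proof.
split=> //; last exact: hom_arr_loop_free.
have [g gE] := linear_bundle fL.
split=> // n; exists n => u; elim: n u => [|n IH] u un; first by move=> w.
rewrite [u]cpa_ldivE big1 ?add0r => [|j _]; last by rewrite un ?scale0r.
rewrite -gE linear_sum; apply: in_mpow_sum => c _; rewrite gE fM -add1n; apply: in_mpowM.
  exact: hom_arr_loop_free.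
apply: IH => -[j s] sn; rewrite -[LHS]/(ldiv_coef _ _ _) /ldiv_coef /=; case: eqP => // _.
by apply: un.
Qed.

End AutomaticContinuity.

Section RightEquivalence.
Variables (K : fieldType) (I : finType) (Q Q' : quiver I) (S : cpa K Q) (S' : cpa K Q').
Variable phi : {rmorphism cpa K Q -> cpa K Q'}.
Hypotheses (lf : loop_free Q) (lf' : loop_free Q').
Hypothesis phiP : right_equivalence S S' phi.

Lemma req_linear : linear phi.
Proof. by move=> c u v; rewrite rmorphD (req_scalable phiP). Qed.

Lemma req_hom : alg_hom phi.
Proof.
by apply: alg_hom_loop_free => //; [exact: req_linear | exact: rmorphM | exact: req_idem phiP].
Qed.

(** Apply the chain rule to [S = psi (phi S)]. The derivatives of [phi S] are those of [S'], and
    [phi] undoes [psi] on them after the insertion, leaving them multiplied on both sides. *)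
Lemma req_cder c : jacobian_ideal S' (phi (cder S c)).
Proof.
have [psi phiK psiK] := req_bij phiP.
have [p pE] := linear_bundle req_linear.
have Kp : cancel p psi by move=> u; rewrite pE.
have pK : cancel psi p by move=> u; rewrite pE.
have H : alg_hom psi.
  apply: alg_hom_loop_free => //; first exact: inverse_linear Kp pK.
    by move=> u v; apply: (can_inj phiK); rewrite rmorphM !psiK.
  by move=> j; rewrite -{1}(req_idem phiP) phiK.
have [h hE] := linear_bundle (clin_cder K c).1.
have Jc := closed_jacobian S'.
rewrite -{1}(phiK S) (cder_hom _ H (req_potential phiP)) -pE linear_sum.
apply: subspace_sum => // a; rewrite pE (cder_cyc_equiv _ (req_cyc phiP)).
have C : clin (fun v => phi (ins c v (psi (cder S' a)))).
  by apply: clin_comp (hom_clin req_hom) _; exact: clin_ins_l.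
apply: (clin_ind C Jc) => w _ pw; rewrite ins_monomial // -pE linear_sum.
apply: subspace_sum => // i; rewrite pE; case: ifP => _; last by rewrite raddf0; case: Jc.
by rewrite !rmorphM psiK; apply/jacobianMr/jacobianMl/jacobian_cder.
Qed.

End RightEquivalence.

(** * Embedding a path algebra along an inclusion of arrows *)

Section Relabelling.
Variables (K : fieldType) (I : finType) (Q Q' : quiver I).
Variables (g : arrow Q' -> option (seq (arrow Q))) (f : arrow Q -> arrow Q').

Record relabelling : Prop := Relabelling {
  relabel_some : forall c, g (f c) = Some [:: c];
  relabel_none : forall x, g x <> None -> exists c, x = f c;
  relabel_hd : forall c, hd (f c) = hd c;
  relabel_tl : forall c, tl (f c) = tl c }.
Hypothesis fP : relabelling.
Let gf := relabel_some fP.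
Let gN := relabel_none fP.
Let fhd := relabel_hd fP.
Let ftl := relabel_tl fP.

Lemma expand_map s : expand g (map f s) = Some s.
Proof. by elim: s => //= c s ->; rewrite gf. Qed.

Lemma expand_mapP t s : expand g t = Some s -> t = map f s.
Proof.
elim: t s => [|x t IH] s /=; first by case=> <-.
case gx: (g x) => [r|//]; have [|c xc] := gN (x := x); first by rewrite gx.
move: gx; rewrite xc gf => -[<-]; case e: expand => [s'|//] [<-] /=.
by rewrite (IH _ e).
Qed.

Lemma walk_map j s : walk j (map f s) = walk j s.
Proof. by elim: s j => //= c s IH j; rewrite fhd ftl IH. Qed.

Lemma relabel_map (u : cpa K Q) j s : relabel g u (j, map f s) = u (j, s).
Proof.
rewrite -[LHS]/(relabel_coef _ _ _) /relabel_coef /is_path /= walk_map expand_map.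
by case: ifP => // /negbT ns; rewrite [RHS]coef0P.
Qed.

Lemma relabel_support (u : cpa K Q) w : relabel g u w != 0 -> exists s, w.2 = map f s.
Proof.
rewrite -[relabel g u w]/(relabel_coef _ _ _) /relabel_coef.
case: ifP => _; last by rewrite eqxx.
by case e: expand => [s|]; [exists s; exact: expand_mapP | rewrite eqxx].
Qed.

Lemma clin_relabel : clin (relabel g : cpa K Q -> cpa K Q').
Proof.
split=> [c u v|n].
  apply: cpaP => j t wt; rewrite coefD coefZ -![relabel g _ _]/(relabel_coef _ _ _) /relabel_coef /is_path /= wt.
  by case: expand => [s|]; rewrite ?coefD ?coefZ // mulr0 addr0.
exists n => u un w wn; apply: contrapT => /eqP nz; have [s ws] := relabel_support nz.
case: w ws nz wn => j t /= ->; rewrite relabel_map size_map => /eqP nz sn.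
by apply: nz; exact: un.
Qed.

Lemma admissible_relabel : admissible (fun c => arr K (f c)).
Proof.
split=> x; first exact: in_mpow_arr; first by rewrite -fhd idem_arr.
by rewrite -ftl arr_idem.
Qed.

Lemma relabel_monomial j s : walk j s -> relabel g (monomial K (j, s)) = monomial K (j, map f s).
Proof.
move=> ws; apply: cpaP => i t _.
have [[r ->]|nt] := pselect (exists r, t = map f r).
  rewrite relabel_map !coef_monomial /is_path /= ws walk_map ws !andbT !xpair_eqE.
  by rewrite inj_eq //; apply: inj_map => c d e; have := gf c; rewrite e gf => -[].
have -> : relabel g (monomial K (j, s)) (i, t) = 0.
  by apply: contrapT => /eqP /relabel_support [r]; move=> e; apply: nt; exists r.
rewrite coef_monomial xpair_eqE; case: (t =P _) => [e|_]; last by rewrite andbF.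
by case: nt; exists s.
Qed.

Lemma relabel_subst u : relabel g u = subst (fun c => arr K (f c)) u.
Proof.
apply: (clin_eq clin_relabel (clin_subst _)) => -[j s] _ ws.
rewrite relabel_monomial // (subst_monomial admissible_relabel) // monomial_prod ?walk_map //.
by rewrite big_map.
Qed.

Lemma relabel_hom : alg_hom (relabel g : cpa K Q -> cpa K Q').
Proof.
have H := subst_hom admissible_relabel.
split; first exact: clin_relabel.
- by move=> u v; rewrite !relabel_subst (hom_mul H).
- by move=> j; rewrite relabel_subst (hom_idem H).
- by move=> c; rewrite relabel_subst; exact: hom_arr.
Qed.

Lemma relabel_arr c : relabel g (arr K c) = arr K (f c).
Proof. by rewrite relabel_subst (subst_arr admissible_relabel). Qed.

Lemma cder_relabel (S : cpa K Q) c : potential S ->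
  cder (relabel g S) (f c) = relabel g (cder S c).
Proof.
move=> pS; have H := relabel_hom; rewrite (cder_hom _ H pS) (bigD1 c) //= big1 ?addr0.
  rewrite relabel_arr ins_arr eqxx ftl fhd -2!(hom_idem H) -2!(hom_mul H).
  by rewrite idem_cder cder_idem.
move=> d dc; rewrite relabel_arr ins_arr ifN //; apply: contraNN dc => /eqP e.
by have := gf d; rewrite e gf => -[->].
Qed.

Lemma cder_relabel0 (S : cpa K Q) (x : arrow Q') : potential S ->
  (forall c, x != f c) -> cder (relabel g S) x = 0.
Proof.
move=> pS xf; rewrite (cder_hom _ relabel_hom pS) big1 // => d _.
by rewrite relabel_arr ins_arr eq_sym (negbTE (xf d)).
Qed.

Lemma restrict_supported (u : cpa K Q') :
  (fun w => u (w.1, map f w.2)) \in path_supported K Q.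
Proof. by apply/asboolP => -[j s] nw; apply: coef0P; rewrite /is_path /= walk_map. Qed.
Definition restrict u : cpa K Q := Cpa (restrict_supported u).

Lemma relabel_restrict u w : (u - relabel g (restrict u)) w != 0 -> forall s, w.2 <> map f s.
Proof.
case: w => j t /= nz s ts; move: nz.
by rewrite ts coefD coefN relabel_map subrr eqxx.
Qed.

End Relabelling.

(** * The triangle of a premutation *)

Section Subspaces.
Variable K : fieldType.

Lemma subspace_iso (U W : lmodType K) (A : submodClosed U) (B : submodClosed W)
    (f : {linear U -> W}) :
  bijective f -> (forall u, u \in A <-> f u \in B) ->
  exists2 g : {linear subspace A -> subspace B}, bijective g &
    forall x, val (g x) = f (val x).
Proof.
move=> [f' fK f'K] AB.
have gP (x : subspace A) : f (val x) \in B by apply/AB/(valP x).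
have gP' (y : subspace B) : f' (val y) \in A by apply/AB; rewrite f'K; exact: (valP y).
have gL : linear (fun x => Subspace (gP x) : subspace B).
  by move=> c x y; apply: val_inj; rewrite /= !linearP.
have [g gE] := linear_bundle gL; exists g; last by move=> x; rewrite gE.
exists (fun y => Subspace (gP' y)) => x; last by rewrite gE; apply: val_inj; rewrite /= f'K.
by rewrite gE; apply: val_inj; rewrite /= fK.
Qed.

Lemma quotient_proj_eq0 (U : lmodType K) (A : submodClosed U) x :
  quotient_proj A x = 0 <-> x \in A.
Proof.
by rewrite -[0](linear0 (quotient_proj A)) quotient_projE subr0.
Qed.

Lemma quotient_proj_surj (U : lmodType K) (A : submodClosed U) q :
  exists x, quotient_proj A x = q.
Proof. by exists (repr q); exact: quotient_projK. Qed.

Lemma mem_within (U : lmodType K) (A B : submodClosed U) (x : subspace A) :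
  (x \in within A B) = (val x \in B).
Proof. by []. Qed.

End Subspaces.

Section LinearPairs.
Variables (K : fieldType) (U V W : lmodType K).

Lemma linear_pair (f : U -> V) (g : U -> W) :
  linear f -> linear g -> linear (fun x => (f x, g x) : V * W).
Proof. by move=> fL gL c x y; rewrite fL gL. Qed.

Lemma linear_opp (f : U -> V) : linear f -> linear (fun x => - f x).
Proof. by move=> fL c x y; rewrite fL opprD scalerN. Qed.

Lemma linear_cst0 : linear (fun _ : U => 0 : V).
Proof. by move=> c x y; rewrite scaler0 addr0. Qed.

End LinearPairs.

(** * What the three descriptions of the dual triangle have in common *)

Section AbstractTriangle.
Variables (K : fieldType) (X A B V : lmodType K).
Variables (alpha : {linear A -> X}) (beta : {linear X -> B}) (gamma : {linear B -> A}).
Hypotheses (ag : forall y, alpha (gamma y) = 0) (gb : forall m, gamma (beta m) = 0).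

(* The properties of the triangle [(Y, al, be)] with [al : B -> Y], [be : Y -> A]
   which determine it up to isomorphism; they are shared by the three
   descriptions of the premutation. *)
Record dual_triangle (Y : lmodType K) (al : {linear B -> Y}) (be : {linear Y -> A}) :
    Prop := DualTriangle {
  dual_comp : forall y, be (al y) = - gamma y;
  dual_ker : forall y, al y = 0 <-> exists m, beta m = y;
  dual_im : forall x, (exists z, be z = x) <-> alpha x = 0;
  dual_rest : exists2 p : {linear subspace (ker be) -> V},
    forall v, exists x, p x = v & forall x, p x = 0 <-> val x \in im al }.

Definition dual_pair (Y : lmodType K) (a : B -> Y) (b : Y -> A) : Prop :=
  exists (al : {linear B -> Y}) (be : {linear Y -> A}), [/\ al =1 a, be =1 b & dual_triangle al be].

Variables (rho : {linear B -> subspace (ker gamma)}).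
Hypothesis rhoK : forall x : subspace (ker gamma), rho (val x) = x.
Notation H := (quotient (within (ker alpha) (im gamma))).
Variables (sigma : {linear H -> subspace (ker alpha)}).
Hypothesis sigmaK : forall x : H, quotient_proj _ (sigma x) = x.

Definition im_elt (y : B) : subspace (im gamma) :=
  @Subspace _ _ (im gamma) (gamma y) (asboolT (ex_intro _ y erefl)).

Lemma gamma_im_beta y : y \in im beta -> gamma y = 0.
Proof. by move/asboolP=> [m <-]. Qed.

Lemma mem_ker_gamma y : (y \in ker gamma) = (gamma y == 0). Proof. by []. Qed.
Lemma mem_ker_alpha y : (y \in ker alpha) = (alpha y == 0). Proof. by []. Qed.

Lemma rho_ker y : gamma y = 0 -> val (rho y) = y.
Proof.
move=> gy; have yk : y \in ker gamma by rewrite mem_ker_gamma gy.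
by have := rhoK (Subspace yk) => /(congr1 val).
Qed.

Lemma proj_rho_eq0 y : gamma y = 0 ->
  quotient_proj (within (ker gamma) (im beta)) (rho y) = 0 <-> y \in im beta.
Proof. by move=> gy; rewrite quotient_proj_eq0 mem_within rho_ker. Qed.

Lemma alpha_sigma q : alpha (val (sigma q)) = 0.
Proof. by apply/eqP; exact: (subspace_mem (sigma q)). Qed.

Lemma ker_alpha_decomp x : alpha x = 0 -> exists y q, x = gamma y + val (sigma q).
Proof.
move=> ax; have xk : x \in ker alpha by rewrite mem_ker_alpha ax.
pose q := quotient_proj (within (ker alpha) (im gamma)) (Subspace xk).
have : quotient_proj _ (sigma q) = q by rewrite sigmaK.
move/esym/quotient_projE; rewrite mem_within => /asboolP[y e].
by exists y, q; rewrite e linearB /= subrK.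
Qed.

(** The relation puts [sigma q] in [im gamma], and projecting it back to the quotient gives both 0
    and [q]. *)
Lemma gamma_sigma_eq0 y q : gamma y + val (sigma q) = 0 -> q = 0 /\ gamma y = 0.
Proof.
move=> e; have q0 : q = 0.
  rewrite -(sigmaK q); apply/quotient_proj_eq0; rewrite mem_within; apply/asboolP.
  by exists (- y); rewrite linearN; apply/eqP; rewrite eq_sym -addr_eq0 addrC; apply/eqP.
by split=> //; move: e; rewrite q0 linear0 addr0.
Qed.

Lemma im_elt_linear : linear im_elt.
Proof. by move=> c x y; apply: val_inj; rewrite /= linearP. Qed.

Lemma im_elt_eq0 y : im_elt y = 0 <-> gamma y = 0.
Proof. by split=> [[]//|e]; apply: val_inj. Qed.

Notation dualA := (quotient (within (ker gamma) (im beta)) * subspace (im gamma) * H * V)%type.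

Lemma dual_triangleA :
  @dual_pair dualA (fun y => (- quotient_proj _ (rho y), - im_elt y, 0, 0))
    (fun x => val x.1.1.2 + val (sigma x.1.2)).
Proof.
have aL : linear (fun y => (- quotient_proj _ (rho y), - im_elt y, 0, 0) : dualA).
  apply: linear_pair; last exact: linear_cst0.
  apply: linear_pair; last exact: linear_cst0.
  apply: linear_pair; apply: linear_opp; last exact: im_elt_linear.
  by move=> c x y; rewrite !linearP.
have bL : linear (fun x : dualA => val x.1.1.2 + val (sigma x.1.2)).
  by move=> c x y; rewrite /= !linearP /= scalerDr addrACA.
have [al alE] := linear_bundle aL; have [be beE] := linear_bundle bL.
exists al, be; split=> //; split=> [y|y|x|].
- by rewrite beE alE /= linear0 addr0.
- rewrite alE; split=> [[e1 e2]|].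
    have gy : gamma y = 0 by apply: oppr_inj; rewrite e2 oppr0.
    by apply/asboolP/(proj_rho_eq0 gy); apply: oppr_inj; rewrite e1 oppr0.
  move/asboolP => yb; have gy := gamma_im_beta yb.
  by rewrite (proj_rho_eq0 gy).2 // (im_elt_eq0 y).2 // !oppr0.
- split=> [[z <-]|/ker_alpha_decomp[y [q ->]]].
    rewrite beE /= linearD alpha_sigma addr0.
    by have /asboolP[y <-] := subspace_mem z.1.1.2.
  by exists (0, im_elt y, q, 0); rewrite beE.
have pL : linear (fun x : subspace (ker be) => (val x).2) by move=> c x y.
have [p pE] := linear_bundle pL; exists p => [v|x].
  have xk : (0, 0, 0, v) \in ker be by rewrite inE beE /= !linear0 addr0.
  by exists (Subspace xk); rewrite pE.
rewrite pE; split=> [|/asboolP[y <-]]; last by rewrite alE.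
case: x => -[[[r t] q] v] /= xk v0.
move: (xk); rewrite inE beE /= => /eqP e.
have /asboolP[y ty] := subspace_mem t.
have [q0 gy] : q = 0 /\ gamma y = 0 by apply: gamma_sigma_eq0; rewrite ty.
have t0 : t = 0 by apply: val_inj; rewrite /= -ty gy.
have [z zr] := quotient_proj_surj r.
have gz : gamma (val z) = 0 by apply/eqP; exact: (subspace_mem z).
(* The sign undoes the one in [al]. As [z] lies in [ker gamma], [rho] fixes it and the second
   component of [al] vanishes, so only the class [r] remains. *)
apply/asboolP; exists (- val z); rewrite alE !linearN /= rhoK opprK zr q0 t0 v0.
by rewrite (im_elt_eq0 _).2 ?oppr0 // linearN gz oppr0.
Qed.

Definition ker_elt (y : B) : subspace (ker alpha) :=
  @Subspace _ _ (ker alpha) (gamma y) (introT eqP (ag y)).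

Lemma ker_elt_linear : linear ker_elt.
Proof. by move=> c x y; apply: val_inj; rewrite /= linearP. Qed.

Lemma ker_elt_eq0 y : ker_elt y = 0 <-> gamma y = 0.
Proof. by split=> [[]//|e]; apply: val_inj. Qed.

Notation dualB := (quotient (within (ker gamma) (im beta)) * subspace (ker alpha) * V)%type.

Lemma dual_triangleB (g : B -> subspace (ker alpha)) : (forall y, val (g y) = gamma y) ->
  @dual_pair dualB (fun y => (- quotient_proj _ (rho y), - g y, 0)) (fun x => val x.1.2).
Proof.
move=> gE; have {gE} -> : g = ker_elt by apply/funext => y; apply/val_inj/gE.
have aL : linear (fun y => (- quotient_proj _ (rho y), - ker_elt y, 0) : dualB).
  apply: linear_pair; last exact: linear_cst0.
  apply: linear_pair; apply: linear_opp.
    by move=> c x y; rewrite !linearP.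
  exact: ker_elt_linear.
have bL : linear (fun x : dualB => val x.1.2) by move=> c x y.
have [al alE] := linear_bundle aL; have [be beE] := linear_bundle bL.
exists al, be; split=> //; split=> [y|y|x|].
- by rewrite beE alE.
- rewrite alE; split=> [[e1 e2]|].
    have gy : gamma y = 0 by apply: oppr_inj; rewrite e2 oppr0.
    by apply/asboolP/(proj_rho_eq0 gy); apply: oppr_inj; rewrite e1 oppr0.
  move/asboolP => yb; have gy := gamma_im_beta yb.
  by rewrite (proj_rho_eq0 gy).2 // (ker_elt_eq0 y).2 // !oppr0.
- split=> [[z <-]|ax].
    by rewrite beE; apply/eqP; exact: (subspace_mem z.1.2).
  have xk : x \in ker alpha by rewrite mem_ker_alpha ax.
  by exists (0, Subspace xk, 0); rewrite beE.
have pL : linear (fun x : subspace (ker be) => (val x).2) by move=> c x y.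
have [p pE] := linear_bundle pL; exists p => [v|x].
  have xk : (0, 0, v) \in ker be by rewrite inE; apply/eqP; rewrite beE.
  by exists (Subspace xk); rewrite pE.
rewrite pE; split=> [|/asboolP[y <-]]; last by rewrite alE.
case: x => -[[r t] v] /= xk v0.
move: (xk); rewrite inE beE /= => /eqP e.
have t0 : t = 0 by apply: val_inj.
have [z zr] := quotient_proj_surj r.
have gz : gamma (val z) = 0 by apply/eqP; exact: (subspace_mem z).
apply/asboolP; exists (- val z); rewrite alE !linearN /= rhoK opprK zr t0 v0.
by rewrite (ker_elt_eq0 _).2 ?oppr0 // linearN gz oppr0.
Qed.

(** Two representatives differ by an element of [im beta], on which [gamma] vanishes. *)
Lemma gamma_repr y : gamma (repr (quotient_proj (im beta) y)) = gamma y.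
Proof.
apply/eqP; rewrite -subr_eq0 -linearB; apply/eqP/gamma_im_beta.
by apply/quotient_projE; rewrite quotient_projK.
Qed.

Lemma gamma_repr_linear : linear (fun q : quotient (im beta) => gamma (repr q)).
Proof.
move=> c x y; have [x' <-] := quotient_proj_surj x; have [y' <-] := quotient_proj_surj y.
by rewrite -linearP !gamma_repr linearP.
Qed.

Notation dualC := (quotient (im beta) * H * V)%type.

Lemma dual_triangleC :
  @dual_pair dualC (fun y => (- quotient_proj _ y, 0, 0))
    (fun x => gamma (repr x.1.1) + val (sigma x.1.2)).
Proof.
have [gr grE] := linear_bundle gamma_repr_linear.
have aL : linear (fun y => (- quotient_proj _ y, 0, 0) : dualC).
  apply: linear_pair; last exact: linear_cst0.
  apply: linear_pair; last exact: linear_cst0.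
  by apply: linear_opp => c x y; rewrite linearP.
have bL : linear (fun x : dualC => gamma (repr x.1.1) + val (sigma x.1.2)).
  by move=> c x y; rewrite -!grE !linearP /= scalerDr addrACA.
have [al alE] := linear_bundle aL; have [be beE] := linear_bundle bL.
have g0 : gamma (repr (0 : quotient (im beta))) = 0 by rewrite -grE linear0.
exists al, be; split=> //; split=> [y|y|x|].
- by rewrite beE alE /= linear0 addr0 -linearN gamma_repr linearN.
- rewrite alE; split=> [[e1]|].
    have : y \in im beta by apply/quotient_proj_eq0/oppr_inj; rewrite e1 oppr0.
    by move/asboolP.
  by move/asboolP => yb; rewrite ((quotient_proj_eq0 (im beta) y).2 yb) oppr0.
- split=> [[z <-]|/ker_alpha_decomp[y [q ->]]].
    by rewrite beE /= linearD alpha_sigma addr0 ag.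
  by exists (quotient_proj _ y, q, 0); rewrite beE /= gamma_repr.
have pL : linear (fun x : subspace (ker be) => (val x).2) by move=> c x y.
have [p pE] := linear_bundle pL; exists p => [v|x].
  have xk : (0, 0, v) \in ker be by rewrite inE beE /= linear0 addr0 g0.
  by exists (Subspace xk); rewrite pE.
rewrite pE; split=> [|/asboolP[y <-]]; last by rewrite alE.
case: x => -[[r q] v] /= xk v0.
move: (xk); rewrite inE beE /= => /eqP.
have [y <-] := quotient_proj_surj r; rewrite gamma_repr => /gamma_sigma_eq0[q0 gy].
by apply/asboolP; exists (- y); rewrite alE linearN opprK q0 v0.
Qed.

End AbstractTriangle.

Section BarTriangle.
Variables (K : fieldType) (I : finType) (Q : quiver I) (S : cpa K Q).
Variables (qpS : is_QP S) (k : I) (M : dmod S).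

Definition MkL : lmodType K := subspace (at_vertex M k).
Definition MinL : lmodType K := M_in k M.
Definition MoutL : lmodType K := M_out k M.
Definition VkL : lmodType K := V_k k M.
Definition alpha_lin : {linear MinL -> MkL} := @alpha K I Q S k M.
Definition beta_lin : {linear MkL -> MoutL} := @beta K I Q S k M.
Definition gamma_lin : {linear MoutL -> MinL} := @gamma K I Q S k M.

Lemma gamma_beta (m : MkL) : gamma_lin (beta_lin m) = 0.
Proof.
apply: val_inj; apply/ffunP => a; rewrite !ffunE.
rewrite (eq_bigr (fun b : out_arrow k Q =>
  mact M (cder2 S (val b) (val a) * arr K (val b)) (val m))); last first.
  by move=> b _; rewrite ffunE [RHS]mactM.
rewrite -[LHS]mact_sum cder_sum_cder2 ?mact_cder //.
- exact: QP_potential qpS.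
- exact: QP_loop_free qpS.
- exact/eqP/(valP a).
Qed.

Definition bar_dual (B : bar_triangle k M) : Prop :=
  @dual_pair K MkL MinL MoutL VkL alpha_lin beta_lin gamma_lin (bar_Mk B) (bar_alpha B)
    (@bar_beta _ _ _ _ _ _ B).

Section Descriptions.
Variable s : splitting k M.

Let r : {linear MoutL -> subspace (ker gamma_lin)} := rho s.
Let rK (x : subspace (ker gamma_lin)) : r (val x) = x := rhoK s x.
Notation H := (quotient (within (ker alpha_lin) (im gamma_lin))).
Let sg : {linear H -> subspace (ker alpha_lin)} := sigma s.
Let sK (x : H) : quotient_proj _ (sg x) = x := sigmaK s x.
Let ag (y : MoutL) : alpha_lin (gamma_lin y) = 0 := alpha_gamma qpS y.

Lemma bar_dualA : bar_dual (bar_of qpS DescA s).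
Proof. have h := dual_triangleA VkL ag gamma_beta rK sK. refine h. Qed.

Lemma bar_dualB : bar_dual (bar_of qpS DescB s).
Proof.
have h := dual_triangleB VkL ag gamma_beta rK (g := @gamma_ker _ _ _ _ qpS k M) (fun=> erefl). refine h. Qed.

Lemma bar_dualC : bar_dual (bar_of qpS DescC s).
Proof. have h := dual_triangleC VkL ag gamma_beta sK. refine h. Qed.

End Descriptions.

Lemma bar_dualP d s : bar_dual (bar_of qpS d s).
Proof. by case: d; [exact: bar_dualA | exact: bar_dualB | exact: bar_dualC]. Qed.

End BarTriangle.

(** * Isomorphisms away from the mutated vertex *)

Section HatIso.
Variables (K : fieldType) (I : finType) (Q : quiver I) (S : cpa K Q) (k : I).
Notation hat := (idem_hat K k Q).
Implicit Types M N : dmod S.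

Lemma mact1 M m : mact M 1 m = m. Proof. exact: (act_one (dmodP M)). Qed.

Lemma mactD M u v m : mact M (u + v) m = mact M u m + mact M v m.
Proof. by have := act_linear_l (dmodP M) m 1 u v; rewrite !scale1r. Qed.

Lemma mactZ M c u m : mact M (c *: u) m = c *: mact M u m.
Proof.
have [L LE] := linear_bundle (act_linear_l (dmodP M) m).
have e : L (c *: u) = c *: L u by rewrite linearZ.
by rewrite !LE in e.
Qed.

Lemma mactN M u m : mact M (- u) m = - mact M u m.
Proof. by rewrite -[- u]scaleN1r mactZ scaleN1r. Qed.

Lemma mact0 M m : mact M 0 m = 0.
Proof. by rewrite -(scale0r (0 : cpa K Q)) mactZ scale0r. Qed.

Lemma mactDr M u m m' : mact M u (m + m') = mact M u m + mact M u m'.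
Proof. exact: linearD. Qed.

Lemma mact_r0 M u : mact M u 0 = 0.
Proof. exact: linear0. Qed.

Lemma at_vertexP M j m : reflect (mact M (idem K j) m = m) (m \in at_vertex M j).
Proof.
apply: (iffP (asboolP _)) => [[x <-]|e]; last by exists m.
by rewrite -mactM idem_idem eqxx.
Qed.

(* An isomorphism of the parts of [M] and [N] away from [k], written as a pair
   of maps on the whole spaces with [f g = g f = e_{\hat k}]. *)
Record hat_iso M N (f : {linear space M -> space N}) (g : {linear space N -> space M}) :
    Prop := HatIso {
  hat_isof : forall v m, hat * v * hat = v -> f (mact M v m) = mact N v (f m);
  hat_isog : forall v n, hat * v * hat = v -> g (mact N v n) = mact M v (g n);
  hat_isofK : forall m, g (f m) = mact M hat m;
  hat_isogK : forall n, f (g n) = mact N hat n }.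

Lemma hat_iso_sym M N f g : @hat_iso M N f g -> hat_iso g f.
Proof. by case. Qed.

Lemma hat_sandwich u : hat * (hat * u * hat) * hat = hat * u * hat.
Proof. by rewrite !mulrA hat_hat -!mulrA hat_hat. Qed.

Lemma idem_sandwich i j (u : cpa K Q) : i != k -> j != k ->
  idem K i * u * idem K j = u -> hat * u * hat = u.
Proof.
by move=> /negbTE ik /negbTE jk <-; rewrite !mulrA hat_idem ik -!mulrA idem_hatM jk.
Qed.

Lemma hat_iso_vertex M N f g j m : @hat_iso M N f g -> j != k ->
  m \in at_vertex M j -> f m \in at_vertex N j.
Proof.
move=> h jk /at_vertexP mj; apply/at_vertexP.
rewrite -(hat_isof h) ?mj //; apply: (@idem_sandwich j j) => //.
by rewrite !(idem_idem, eqxx).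
Qed.

Lemma hat_vertex M j m : j != k -> m \in at_vertex M j -> mact M hat m = m.
Proof.
by move=> /negbTE jk /at_vertexP <-; rewrite -mactM hat_idem jk.
Qed.

Lemma dsum_iso M N f g (F : finType) (h : F -> I) : @hat_iso M N f g -> (forall a, h a != k) ->
  exists2 f' : {linear subspace (dsum M h) -> subspace (dsum N h)}, bijective f' &
    forall x a, val (f' x) a = f (val x a).
Proof.
move=> fg hk.
have vP (M' : dmod S) (x : subspace (dsum M' h)) a : val x a \in at_vertex M' (h a).
  by have /asboolP := subspace_mem x; apply.
have mem (M1 M2 : dmod S) f1 f2 : hat_iso f1 f2 -> forall x : subspace (dsum M1 h),
    [ffun a => f1 (val x a)] \in dsum M2 h.
  move=> f12 x; apply/asboolP => a; rewrite ffunE.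
  exact: (hat_iso_vertex f12 (hk a) (vP _ _ _)).
pose f' x : subspace (dsum N h) := Subspace (mem _ _ _ _ fg x).
pose g' x : subspace (dsum M h) := Subspace (mem _ _ _ _ (hat_iso_sym fg) x).
have fL : linear f'.
  by move=> c x y; apply/val_inj/ffunP => a; rewrite linearP !ffunE /= linearP.
have [f1 fE] := linear_bundle fL; exists f1; last by move=> x a; rewrite fE ffunE.
exists g' => x; apply/val_inj/ffunP => a; rewrite ?fE !ffunE.
  by rewrite (hat_isofK fg); exact: (hat_vertex (hk a) (vP _ _ _)).
by rewrite (hat_isogK fg); exact: (hat_vertex (hk a) (vP _ _ _)).
Qed.

End HatIso.

(** * The action on a premutation *)

Section EtaTilde.
Variables (K : fieldType) (I : finType) (Q : quiver I) (S : cpa K Q).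
Variables (qpS : is_QP S) (k : I) (M : dmod S).
Notation mQ := (premut_quiver k Q).
Notation hat := (idem_hat K k Q).
Notation hatm := (idem_hat K k mQ).
Let lfQ : loop_free Q := QP_loop_free qpS.

Lemma val_to_hat (m : space M) : val (to_hat k m) = mact M hat m. Proof. by []. Qed.

Lemma hat_val (x : M_hat k M) : mact M hat (val x) = val x.
Proof.
have /asboolP[m e] := subspace_mem x; have {}e : mact M hat m = val x := e.
by rewrite -e -mactM hat_hat.
Qed.

Lemma to_hatK (x : M_hat k M) : to_hat k (val x) = x.
Proof. by apply: val_inj; rewrite val_to_hat hat_val. Qed.

Definition MhatL : lmodType K := M_hat k M.

Lemma to_hat_linear : linear (@to_hat K I Q S k M : space M -> MhatL).
Proof. by move=> c x y; apply: val_inj; rewrite /= linearP. Qed.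

Lemma out_inj_linear (b : out_arrow k Q) : linear (out_inj b : space M -> MoutL k M).
Proof.
move=> c x y; apply/val_inj/ffunP => b'; rewrite linearP !ffunE.
by case: eqP; rewrite ?linearP ?scaler0 ?addr0.
Qed.

Lemma out_inj_hat (b : out_arrow k Q) (m : space M) : out_inj b (mact M hat m) = out_inj b m.
Proof.
apply/val_inj/ffunP => b'; rewrite !ffunE; case: eqP => // _.
by rewrite -mactM idem_hatM (negbTE (hd_out lfQ b)).
Qed.

Lemma M_in_vertex (x : M_in k M) a : val x a \in at_vertex M (tl (val a)).
Proof. by have /asboolP := subspace_mem x; apply. Qed.

Lemma M_out_vertex (y : M_out k M) b : val y b \in at_vertex M (hd (val b)).
Proof. by have /asboolP := subspace_mem y; apply. Qed.

Lemma M_in_hat (x : M_in k M) a : mact M hat (val x a) = val x a.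
Proof. exact: (hat_vertex (tl_in lfQ a) (M_in_vertex x a)). Qed.

Lemma M_out_sum (y : MoutL k M) : y = \sum_b (out_inj b (val y b) : MoutL k M).
Proof.
have vL : linear (fun y : MoutL k M => val y : {ffun out_arrow k Q -> space M}) by [].
have [v vE] := linear_bundle vL.
apply/val_inj/ffunP => b; rewrite -[in RHS]vE linear_sum sum_ffunE (bigD1 b) //.
rewrite big1 ?addr0 => [|b' ne]; rewrite vE ffunE.
  by rewrite eqxx [RHS]addr0; apply/esym/at_vertexP/M_out_vertex.
by rewrite eq_sym (negbTE ne).
Qed.

Variables (B : bar_triangle k M) (al : {linear MoutL k M -> bar_Mk B})
  (be : {linear bar_Mk B -> MinL k M}).
Hypotheses (alE : al =1 bar_alpha B) (beE : be =1 @bar_beta _ _ _ _ _ _ B).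

Lemma eta_instarE a (m : M_bar B) : eta_arrow (InStar a) m = (to_hat k (val (be m.2) a), 0).
Proof. by rewrite beE. Qed.

Lemma eta_outstarE b (m : M_bar B) : eta_arrow (OutStar b) m = (0, al (out_inj b (val m.1))).
Proof. by rewrite alE. Qed.

Lemma Theta_instar v a (m : M_bar B) :
  Theta v (eta_arrow (InStar a) m) = (to_hat k (mact M (chi S v) (val (be m.2) a)), 0).
Proof. by rewrite eta_instarE /Theta /= -[mact M hat _]/(mact M hat (val (be m.2) a)) M_in_hat. Qed.

Lemma eta_outstar_Theta b w (m : M_bar B) :
  eta_arrow (OutStar b) (Theta w m) = (0, al (out_inj b (mact M (chi S w) (val m.1)))).
Proof. by rewrite eta_outstarE /Theta /= -[mact M hat _]/(mact M hat (mact M (chi S w) (val m.1))) out_inj_hat. Qed.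

(** The five kinds of terms form a matrix: its rows are the part away from [k] and the b^*, its
    columns the part away from [k] and the a^*. In this form an action can be compared, or shown to
    vanish, entry by entry. *)
Lemma eta_tildeE u (m : M_bar B) : eta_tilde u m =
  (to_hat k (mact M (chi S (comp_hat u)) (val m.1)
     + \sum_a mact M (chi S (comp_v u a)) (val (be m.2) a)),
   comp_z u *: m.2 + al (\sum_b out_inj b (mact M (chi S (comp_w u b)) (val m.1)
     + \sum_a mact M (chi S (comp_x u b a)) (val (be m.2) a)))).
Proof.
have [th thE] := linear_bundle to_hat_linear.
have oL b := linear_bundle (out_inj_linear b).
rewrite /eta_tilde.
under [\sum_a Theta _ _]eq_bigr => a _ do rewrite Theta_instar.
under [\sum_b eta_arrow _ _]eq_bigr => b _ do rewrite eta_outstar_Theta.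
under [\sum_a \sum_b _]eq_bigr => a _ do (under eq_bigr => b _ do rewrite Theta_instar eta_outstarE val_to_hat out_inj_hat).
rewrite exchange_big.
have e1 (J : finType) (F : J -> MhatL) :
    \sum_i ((F i, 0) : M_bar B) = (\sum_i F i, 0).
  apply/esym/(big_morph (fun x : MhatL => (x, 0) : M_bar B)) => // x y.
  by congr (_, _); rewrite addr0.
have e2 (J : finType) (F : J -> bar_Mk B) :
    \sum_i ((0, F i) : M_bar B) = (0, \sum_i F i).
  apply/esym/(big_morph (fun x : bar_Mk B => (0, x) : M_bar B)) => // x y.
  by congr (_, _); rewrite addr0.
rewrite e1 e2; under [X in _ + X]eq_bigr => b _ do rewrite e2.
rewrite e2 /eta_idem_k /Theta; congr (_, _).
  rewrite /= !addr0 add0r -!thE linearD linear_sum; congr (_ + _).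
  by apply: eq_bigr => a _; rewrite thE.
rewrite /= !addr0 -addrA -big_split; congr (_ + _).
rewrite [RHS]linear_sum; apply: eq_bigr => b _.
have [o oE] := oL b; rewrite /= -!oE linearD linearD linear_sum linear_sum; congr (_ + _).
by apply: eq_bigr => a _; rewrite oE.
Qed.

End EtaTilde.

Section EtaValues.
Variables (K : fieldType) (I : finType) (Q : quiver I) (S : cpa K Q).
Variables (qpS : is_QP S) (acQ : two_acyclic Q) (k : I) (M : dmod S).
Notation mQ := (premut_quiver k Q).
Notation hat := (idem_hat K k Q).
Notation hatm := (idem_hat K k mQ).
Let lfQ : loop_free Q := QP_loop_free qpS.
Let pS : potential S := QP_potential qpS.

Variables (B : bar_triangle k M) (al : {linear MoutL k M -> bar_Mk B})
  (be : {linear bar_Mk B -> MinL k M}).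
Hypotheses (alE : al =1 bar_alpha B) (beE : be =1 @bar_beta _ _ _ _ _ _ B).

Lemma chi0 : chi S (0 : cpa K mQ) = 0. Proof. exact: clin0 (clin_chi S k). Qed.

Lemma to_hat0 : to_hat k (0 : space M) = 0.
Proof. by have [th thE] := linear_bundle (@to_hat_linear _ _ _ S k M); rewrite -thE linear0. Qed.

Lemma out_inj0 (b : out_arrow k Q) : out_inj b (0 : space M) = 0 :> MoutL k M.
Proof. by have [o oE] := linear_bundle (@out_inj_linear _ _ _ S k M b); rewrite -oE linear0. Qed.

Lemma ldiv0 (c : arrow mQ) : ldiv c (0 : cpa K mQ) = 0. Proof. exact: clin0 (clin_ldiv K c). Qed.
Lemma eta_tilde_idem (m : M_bar B) : eta_tilde (idem K k) m = (0, m.2).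
Proof.
rewrite (eta_tildeE qpS alE beE).
have hi : hatm * idem K k = 0 by rewrite hat_idem eqxx.
have -> : comp_hat (idem K k : cpa K mQ) = 0 by rewrite /comp_hat hi mul0r.
have -> : comp_z (idem K k : cpa K mQ) = 1 by rewrite /comp_z coef_monomial eqxx.
have hv a : comp_v (idem K k : cpa K mQ) a = 0 by rewrite /comp_v rdiv_idem mulr0.
have hw b : comp_w (idem K k : cpa K mQ) b = 0 by rewrite /comp_w ldiv_idem mul0r.
have hx b a : comp_x (idem K k : cpa K mQ) b a = 0 by rewrite /comp_x rdiv_idem ldiv0.
rewrite chi0 mact0 add0r big1 => [|a _]; last by rewrite hv chi0 mact0.
rewrite to_hat0 scale1r big1 ?linear0 ?addr0 // => b _.
rewrite hw chi0 mact0 add0r big1 ?out_inj0 // => a _.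
by rewrite hx chi0 mact0.
Qed.

(** A bracketed series neither begins nor ends with a star, so only its part away from [k] acts, and
    [chi] gives back [v]. Hence the action on a premutation determines the action of [Q] away from
    [k]. *)
Lemma eta_tilde_bracket v (m : M_bar B) : hat * v * hat = v ->
  eta_tilde (bracket k v) m = (to_hat k (mact M v (val m.1)), 0).
Proof.
move=> hv; rewrite (eta_tildeE qpS alE beE); set u := bracket k v.
have hl : hatm * u = u.
  rewrite /u -[in RHS]hv -[in LHS]hv.
  rewrite /idem_hat mulrBl mul1r -bracket_idemM !mulrA idem_hatM eqxx !mul0r.
  by rewrite (clin0 (clin_bracket K k Q)) subr0.
have hr : u * hatm = u.
  rewrite /u -[in RHS]hv -[in LHS]hv.
  rewrite /idem_hat mulrBr mulr1 -bracketM_idem -!mulrA hat_idem eqxx !mulr0.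
  by rewrite (clin0 (clin_bracket K k Q)) subr0.
have -> : comp_hat u = u by rewrite /comp_hat hl hr.
have -> : comp_z u = 0 by rewrite /comp_z -hl /idem_hat mulrBl mul1r coefD coefN idemM eqxx subrr.
have rv a : rdiv (InStar a : arrow mQ) u = 0.
  apply: cpaP => j s _; rewrite -[LHS]/(u (j, rcons s _)) -[LHS]/(relabel_coef _ _ _).
  rewrite /relabel_coef; case: ifP => // _.
  have -> // : forall t, expand (bracket_arrow (Q := Q)) (rcons t (InStar a)) = None.
  by elim=> //= x t ->; case: (bracket_arrow x).
have lv b : ldiv (OutStar b : arrow mQ) u = 0.
  apply: cpaP => j s _; rewrite -[LHS]/(ldiv_coef _ _ _) /ldiv_coef; case: ifP => // _.
  by rewrite -[LHS]/(relabel_coef _ _ _) /relabel_coef; case: ifP.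
rewrite chi_bracket //.
rewrite big1 ?addr0 => [|a _]; last by rewrite /comp_v rv mulr0 chi0 mact0.
rewrite scale0r add0r big1 ?linear0 // => b _.
rewrite /comp_w lv mul0r chi0 mact0 add0r big1 ?out_inj0 // => a _.
by rewrite /comp_x rv ldiv0 chi0 mact0.
Qed.

Lemma eta_tilde_instar a (m : M_bar B) :
  eta_tilde (arr K (InStar a : arrow mQ)) m = (to_hat k (val (be m.2) a), 0).
Proof.
rewrite (eta_tildeE qpS alE beE); set u := arr K _.
have ur : u * hatm = 0 by rewrite /u -arr_idem -mulrA idem_hatM eqxx mulr0.
have -> : comp_hat u = 0 by rewrite /comp_hat -mulrA ur mulr0.
have -> : comp_z u = 0 by rewrite /comp_z coef_arr_nil.
have rv a' : rdiv (InStar a' : arrow mQ) u = if a == a' then idem K (tl (val a)) else 0.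
  rewrite rdiv_arr; case: (a =P a') => [->|ne]; first by rewrite eqxx.
  by case: eqP => // -[].
have lv b : ldiv (OutStar b : arrow mQ) u = 0 by rewrite ldiv_arr.
rewrite chi0 mact0 add0r (bigD1 a) //= big1 ?addr0 => [|a' ne]; last first.
  by rewrite /comp_v rv eq_sym (negbTE ne) mulr0 chi0 mact0.
rewrite /comp_v rv eqxx hat_idem (negbTE (tl_in lfQ a)) chi_idem //.
have /at_vertexP -> := M_in_vertex (be m.2) a.
rewrite scale0r add0r big1 ?linear0 // => b _.
rewrite /comp_w lv mul0r chi0 mact0 add0r big1 ?out_inj0 // => a' _.
by rewrite /comp_x rv; case: (a == a'); rewrite ?ldiv_idem ?ldiv0 chi0 mact0.
Qed.

Lemma eta_tilde_outstar b (m : M_bar B) :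
  eta_tilde (arr K (OutStar b : arrow mQ)) m = (0, al (out_inj b (val m.1))).
Proof.
rewrite (eta_tildeE qpS alE beE); set u := arr K _.
have ul : hatm * u = 0 by rewrite /u -idem_arr mulrA hat_idem eqxx mul0r.
have -> : comp_hat u = 0 by rewrite /comp_hat ul mul0r.
have -> : comp_z u = 0 by rewrite /comp_z coef_arr_nil.
have rv a : rdiv (InStar a : arrow mQ) u = 0 by rewrite rdiv_arr.
have lv b' : ldiv (OutStar b' : arrow mQ) u = if b == b' then idem K (hd (val b)) else 0.
  rewrite ldiv_arr; case: (b =P b') => [->|ne]; first by rewrite eqxx.
  by case: eqP => // -[].
rewrite chi0 mact0 add0r big1 => [|a _]; last by rewrite /comp_v rv mulr0 chi0 mact0.
rewrite to_hat0 scale0r add0r (bigD1 b) // [X in al (_ + X)]big1 ?addr0 => [|b' ne]; last first.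
  rewrite /comp_w lv eq_sym (negbTE ne) mul0r chi0 mact0 add0r big1 ?out_inj0 // => a _.
  by rewrite /comp_x rv ldiv0 chi0 mact0.
rewrite big1 ?addr0 => [|a _]; last by rewrite /comp_x rv ldiv0 chi0 mact0.
rewrite /comp_w lv eqxx idem_hatM (negbTE (hd_out lfQ b)) chi_idem //.
congr (_, al _); apply/val_inj/ffunP => b'; rewrite !ffunE; case: eqP => // _.
by rewrite -mactM idem_idem eqxx.
Qed.

End EtaValues.

(** * Isomorphisms of modules and of premutations *)

Section Generation.
Variables (K : fieldType) (I : finType) (Q : quiver I) (k : I).
Notation hat := (idem_hat K k Q).
Variable P : cpa K Q -> Prop.
Hypotheses (PD : forall u v, P u -> P v -> P (u + v)) (PM : forall u v, P u -> P v -> P (u * v)).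
Hypotheses (Phat : forall v, hat * v * hat = v -> P v) (Pk : forall c : K, P (c *: idem K k)).
Hypothesis lfQ : loop_free Q.
Hypotheses (Pin : forall a : in_arrow k Q, P (arr K (val a))).
Hypotheses (Pout : forall b : out_arrow k Q, P (arr K (val b))).

Let P0 : P 0. Proof. by rewrite -(scale0r (idem K k)). Qed.

Let Psum (J : Type) (r : seq J) (A : pred J) (F : J -> cpa K Q) :
  (forall i, A i -> P (F i)) -> P (\sum_(i <- r | A i) F i).
Proof. by move=> h; elim/big_ind: _. Qed.

Lemma one_hat : 1 = hat + idem K k :> cpa K Q.
Proof. by rewrite /idem_hat subrK. Qed.

Lemma idem_ldivE (u : cpa K Q) : idem K k * u = (u (k, [::]) : K) *: idem K k
  + \sum_(c | hd c == k) arr K c * ldiv c u.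
Proof.
rewrite {1}[u]cpa_ldivE mulrDr !mulr_sumr (bigD1 k) //= scaleMr idem_idem eqxx.
rewrite big1 ?addr0 => [|j ne]; last by rewrite scaleMr idem_idem (negbTE ne) scaler0.
congr (_ + _); rewrite [RHS]big_mkcond; apply: eq_bigr => c _.
rewrite mulrA -{1}idem_arr mulrA idem_idem.
by case: eqP => _; rewrite ?mul0r // idem_arr.
Qed.

Lemma rdiv_idemE (u : cpa K Q) : u * idem K k = (u (k, [::]) : K) *: idem K k
  + \sum_(c | tl c == k) rdiv c u * arr K c.
Proof.
rewrite {1}[u]cpa_rdivE mulrDl !mulr_suml (bigD1 k) //= scaleMl idem_idem eqxx.
rewrite big1 ?addr0 => [|j ne]; last by rewrite scaleMl idem_idem eq_sym (negbTE ne) scaler0.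
congr (_ + _); rewrite [RHS]big_mkcond; apply: eq_bigr => c _.
rewrite -mulrA -{1}arr_idem -mulrA idem_idem eq_sym.
by case: eqP => [e|_]; rewrite ?mulr0 // -e arr_idem.
Qed.

(** Splitting [1 = hat + e_k] on both sides and dividing by the arrows at [k] writes [u] as a finite
    combination of products of the generators; the sums are finite, so algebraic closure of [P]
    suffices. *)
Lemma cpa_generation u : P u.
Proof.
have Phl v : P (hat * v).
  rewrite -[hat * v]mulr1 one_hat mulrDr; apply: PD; first by apply: Phat; exact: hat_sandwich.
  rewrite -mulrA rdiv_idemE mulrDr scaleMr hat_idem eqxx scaler0 add0r mulr_sumr.
  apply: Psum => c hc; have -> : arr K c = hat * arr K c.
    by rewrite -idem_arr mulrA hat_idem; have /negbTE := lfQ c; rewrite (eqP hc) => ->.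
  rewrite !mulrA -[X in X * arr K c]mulrA; apply: PM; last exact: (Pout (exist _ c hc)).
  by apply: Phat; rewrite !mulrA hat_hat -!mulrA hat_hat.
rewrite -[u]mul1r one_hat mulrDl; apply: PD; first exact: Phl.
rewrite idem_ldivE; apply: PD => //; apply: Psum => c hc.
have -> : arr K c = arr K c * hat.
  by rewrite -arr_idem -mulrA idem_hatM; have /negbTE := lfQ c; rewrite (eqP hc) eq_sym => ->.
by rewrite -mulrA; apply: PM => //; exact: (Pin (exist _ c hc)).
Qed.

End Generation.

(** * Compatibility of the data away from [k] with the triangle maps *)

Section Mid.
Variables (K : fieldType) (I : finType) (Q : quiver I) (S : cpa K Q).
Variables (qpS : is_QP S) (acQ : two_acyclic Q) (k : I).
Notation hat := (idem_hat K k Q).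
Let lfQ : loop_free Q := QP_loop_free qpS.
Let pS : potential S := QP_potential qpS.
Implicit Types M N : dmod S.

(* Everything a decorated module and its premutation have in common: the part
   of the module away from [k], [ker alpha] and [im beta]. *)
Record away_iso M N (f : {linear space M -> space N}) (g : {linear space N -> space M})
    (Fi : {linear MinL k M -> MinL k N}) (Fo : {linear MoutL k M -> MoutL k N}) : Prop :=
  AwayIso {
  away_hat : hat_iso k f g;
  away_bij_in : bijective Fi;
  away_bij_out : bijective Fo;
  away_in : forall (x : MinL k M) a, val (Fi x) a = f (val x a);
  away_out : forall (y : MoutL k M) b, val (Fo y) b = f (val y b);
  away_ker : forall x, alpha_lin k M x = 0 <-> alpha_lin k N (Fi x) = 0;
  away_im : forall y, y \in im (beta_lin k M) <-> Fo y \in im (beta_lin k N) }.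

Definition VhatL M : lmodType K := V_hat k M.
Definition VbarkL M : lmodType K := V_bar_k k M.
Definition vhat_act M l (v : VhatL M) : VhatL M := (V_bar_act l (v, 0)).1.

Definition toMk M (m : space M) : MkL k M :=
  @Subspace _ _ (at_vertex M k) (mact M (idem K k) m) (mem_im (mact M (idem K k)) m).

Lemma toMk_linear M : linear (@toMk M).
Proof. by move=> c x y; apply: val_inj; rewrite /= linearP. Qed.

Lemma MkL_idem M (x : MkL k M) : mact M (idem K k) (val x) = val x.
Proof. exact/at_vertexP/(subspace_mem x). Qed.

Lemma toMkK M (x : MkL k M) : toMk (val x) = x.
Proof. by apply: val_inj; rewrite /= -[LHS]/(mact M (idem K k) (val x)) MkL_idem. Qed.

Lemma MkL_hat M (x : MkL k M) : mact M hat (val x) = 0.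
Proof. by rewrite -MkL_idem -mactM hat_idem eqxx mact0. Qed.

Lemma hat_out M b (m : space M) : tl b = k -> mact M (arr K b) m = mact M hat (mact M (arr K b) m).
Proof.
move=> tb; have hb : hd b != k by have := lfQ b; rewrite tb.
by rewrite -mactM -[in RHS]idem_arr mulrA hat_idem (negbTE hb) idem_arr.
Qed.

Lemma in_inj M (a : in_arrow k Q) (m : space M) : exists x : MinL k M,
  forall a', val x a' = if a' == a then mact M (idem K (tl (val a))) m else 0.
Proof.
have xP : [ffun a' => if a' == a then mact M (idem K (tl (val a))) m else 0]
    \in dsum M (fun a : in_arrow k Q => tl (val a)).
  apply/asboolP => a'; rewrite ffunE; case: eqP => [->|_]; last exact: rpred0.
  exact: mem_im.
by exists (Subspace xP) => a'; rewrite ffunE.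
Qed.

Lemma val_alpha M (x : MinL k M) :
  val (alpha_lin k M x) = \sum_a mact M (arr K (val a)) (val x a).
Proof. by []. Qed.

Lemma val_beta M (x : MkL k M) b : val (beta_lin k M x) b = mact M (arr K (val b)) (val x).
Proof. by rewrite ffunE. Qed.

Lemma val_gamma M (y : MoutL k M) a :
  val (gamma_lin k M y) a = \sum_b mact M (cder2 S (val b) (val a)) (val y b).
Proof. by rewrite ffunE. Qed.

Lemma alpha_in_inj M (a : in_arrow k Q) m (x : MinL k M) :
  (forall a', val x a' = if a' == a then mact M (idem K (tl (val a))) m else 0) ->
  alpha_lin k M x = toMk (mact M (arr K (val a)) m).
Proof.
move=> xE; apply: val_inj; rewrite val_alpha (bigD1 a) // big1 => [|a' ne].
  have e := idem_arr K (val a); rewrite (eqP (valP a)) in e.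
  by rewrite xE eqxx [LHS]addr0 /= -!mactM arr_idem e.
by rewrite xE (negbTE ne) linear0.
Qed.

(** The entries of [gamma] are second derivatives, whose paths have both ends away from [k], and [f]
    commutes with such series. *)
Lemma away_gamma M N f g Fi Fo y : @away_iso M N f g Fi Fo ->
  Fi (gamma_lin k M y) = gamma_lin k N (Fo y).
Proof.
move=> h; apply/val_inj/ffunP => a; rewrite (away_in h) !val_gamma linear_sum.
apply: eq_bigr => b _; rewrite (away_out h) (hat_isof (away_hat h)) //.
apply: (idem_sandwich (tl_in lfQ a) (hd_out lfQ b)).
by rewrite idem_cder2 cder2_idem //; exact: in_out.
Qed.

Lemma away_beta_alpha M N f g Fi Fo x : @away_iso M N f g Fi Fo ->
  Fo (beta_lin k M (alpha_lin k M x)) = beta_lin k N (alpha_lin k N (Fi x)).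
Proof.
move=> h; apply/val_inj/ffunP => b; rewrite (away_out h) !val_beta !val_alpha !linear_sum.
apply: eq_bigr => a _; rewrite (away_in h) -[X in f X]mactM -[RHS]mactM (hat_isof (away_hat h)) //.
apply: (idem_sandwich (hd_out lfQ b) (tl_in lfQ a)).
by rewrite mulrA idem_arr -mulrA arr_idem.
Qed.

End Mid.

Section ModuleIso.
Variables (K : fieldType) (I : finType) (Q : quiver I) (S : cpa K Q).
Variables (qpS : is_QP S) (acQ : two_acyclic Q) (k : I).
Notation hat := (idem_hat K k Q).
Let lfQ : loop_free Q := QP_loop_free qpS.
Let pS : potential S := QP_potential qpS.
Implicit Types M N : dmod S.

Definition vbar_proj M : {linear subspace (ker (beta_lin k M)) -> VbarkL k M} :=
  quotient_proj (within (ker (beta_lin k M)) (im (alpha_lin k M))).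

Lemma vbar_proj_surj M w : exists x, vbar_proj M x = w.
Proof. exact: quotient_proj_surj. Qed.

Lemma vbar_proj_eq0 M x : vbar_proj M x = 0 <-> val x \in im (alpha_lin k M).
Proof. exact: quotient_proj_eq0. Qed.

Lemma idem_in (a : in_arrow k Q) : idem K k * arr K (val a) = arr K (val a).
Proof. by have := idem_arr K (val a); rewrite (eqP (valP a)). Qed.

Lemma out_idem (b : out_arrow k Q) : arr K (val b) * idem K k = arr K (val b).
Proof. by have := arr_idem K (val b); rewrite (eqP (valP b)). Qed.

Section Glue.
Variables (M N : dmod S).
Variables (f : {linear space M -> space N}) (g : {linear space N -> space M}).
Variables (Fi : {linear MinL k M -> MinL k N}) (Fo : {linear MoutL k M -> MoutL k N}).
Hypothesis fg : away_iso f g Fi Fo.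
Variable fk : {linear MkL k M -> MkL k N}.
Hypotheses (fk_bij : bijective fk).
Hypotheses (fk_alpha : forall x, fk (alpha_lin k M x) = alpha_lin k N (Fi x)).
Hypotheses (fk_beta : forall x, beta_lin k N (fk x) = Fo (beta_lin k M x)).
Let h : hat_iso k f g := away_hat fg.

Definition glue (m : space M) : space N := f (mact M hat m) + val (fk (toMk k m)).

Lemma glue_linear : linear glue.
Proof.
have [t tE] := linear_bundle (@toMk_linear _ _ _ S k M).
by move=> c x y; rewrite /glue -!tE !linearP /= scalerDr addrACA.
Qed.

Lemma hat_hat_hat : hat * hat * hat = hat.
Proof. by rewrite !hat_hat. Qed.

Lemma glue_hat m : mact N hat (glue m) = f (mact M hat m).
Proof.
by rewrite /glue mactDr MkL_hat addr0 (hat_isof h) ?hat_hat_hat // -mactM hat_hat.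
Qed.

Lemma val_toMk (L : dmod S) (m : space L) : val (toMk k m) = mact L (idem K k) m.
Proof. by []. Qed.

Lemma glue_idem m : toMk k (glue m) = fk (toMk k m).
Proof.
apply: val_inj; rewrite val_toMk /glue mactDr MkL_idem.
by rewrite (hat_isof h) ?hat_hat_hat // -mactM idem_hatM eqxx mact0 add0r.
Qed.

Lemma glue_bij : bijective glue.
Proof.
have [fk' fkK fk'K] := fk_bij.
have split_hat (L : dmod S) (m : space L) : mact L hat m + val (toMk k m) = m.
  by rewrite val_toMk -mactD -one_hat mact1.
exists (fun n => g (mact N hat n) + val (fk' (toMk k n))) => m.
  by rewrite glue_hat glue_idem fkK (hat_isofK h) -mactM hat_hat split_hat.
rewrite /glue; set n' := g _ + _.
have e1 : mact M hat n' = g (mact N hat m).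
  by rewrite /n' mactDr MkL_hat addr0 (hat_isog h) ?hat_hat_hat // -mactM hat_hat.
have e2 : toMk k n' = fk' (toMk k m).
  apply: val_inj; rewrite val_toMk /n' mactDr MkL_idem.
  by rewrite (hat_isog h) ?hat_hat_hat // -mactM idem_hatM eqxx mact0 add0r.
by rewrite e1 e2 fk'K (hat_isogK h) -mactM hat_hat split_hat.
Qed.

(** By [cpa_generation] only four kinds of elements need checking: [fg] covers series away from [k],
    [glue_idem] multiples of e_k, and the relations of [fk] with [alpha] and [beta] the arrows at
    [k]. *)
Lemma glue_commute u m : glue (mact M u m) = mact N u (glue m).
Proof.
have [G GE] := linear_bundle glue_linear.
move: m; apply: (@cpa_generation K I Q k (fun u => forall m, glue (mact M u m) = mact N u (glue m))).
- by move=> v w hv hw m; rewrite !mactD -GE linearD !GE hv hw.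
- by move=> v w hv hw m; rewrite !mactM hv hw.
- move=> v hv m.
  have vh : v * hat = v by rewrite -hv -mulrA hat_hat.
  have hv' : hat * v = v by rewrite -hv !mulrA hat_hat.
  rewrite -[in RHS]vh [in RHS]mactM glue_hat -(hat_isof h) // -mactM vh /glue.
  have -> : toMk k (mact M v m) = 0.
    by apply: val_inj; rewrite val_toMk -mactM -hv' mulrA idem_hatM eqxx mul0r mact0.
  by rewrite linear0 addr0 -mactM hv'.
- move=> c m; rewrite !mactZ.
  have -> : mact N (idem K k) (glue m) = val (fk (toMk k m)) by rewrite -glue_idem.
  rewrite -GE linearZ GE; congr (_ *: _).
  by rewrite /glue -mactM hat_idem eqxx mact0 linear0 add0r -val_toMk toMkK.
- exact: lfQ.
(* For an arrow into [k], the vector [a m] is [alpha] of the family with the single component [m] at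
   [a]. *)
- move=> a m; have [x xE] := in_inj a m.
  have av := esym (idem_in a).
  rewrite /glue -(alpha_in_inj xE) fk_alpha.
  rewrite -mactM av mulrA hat_idem eqxx mul0r mact0 linear0 add0r val_alpha (bigD1 a) //.
  rewrite big1 => [|a' ne]; last by rewrite (away_in fg) xE (negbTE ne) linear0 mact_r0.
  rewrite (away_in fg) xE eqxx [LHS]addr0 -av.
  have ta := tl_in lfQ a.
  rewrite mactDr; have -> : mact N (arr K (val a)) (val (fk (toMk k m))) = 0.
    by rewrite -MkL_idem -mactM -arr_idem -mulrA idem_idem eq_sym (negbTE ta) mulr0 mact0.
  rewrite addr0 -(arr_idem K (val a)) 2!mactM; congr (mact N _ _).
  have ih : hat * idem K (tl (val a)) * hat = idem K (tl (val a)).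
    by rewrite hat_idem (negbTE ta) idem_hatM (negbTE ta).
  by rewrite -!(hat_isof h) // -!mactM idem_idem eqxx idem_hatM (negbTE ta).
(* For an arrow out of [k], the vector [b m] is the component at [b] of [beta] applied to
   [e_k m]. *)
- move=> b m; have bk := eqP (valP b).
  have bv := esym (out_idem b).
  rewrite /glue -hat_out //.
  have -> : toMk k (mact M (arr K (val b)) m) = 0.
    apply: val_inj; rewrite val_toMk -mactM -idem_arr mulrA idem_idem.
    by rewrite (negbTE (hd_out lfQ b)) mul0r mact0.
  rewrite linear0 addr0 mactDr.
  have -> : mact N (arr K (val b)) (f (mact M hat m)) = 0.
    by rewrite (hat_isof h) ?hat_hat_hat // -mactM bv -mulrA idem_hatM eqxx mulr0 mact0.
  have e := congr1 (fun y : MoutL k N => val y b) (fk_beta (toMk k m)).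
  rewrite (away_out fg) !val_beta in e.
  by rewrite add0r e val_toMk -mactM out_idem.
Qed.

End Glue.

Lemma module_iso_of_away M N f g Fi Fo : @away_iso _ _ _ _ k M N f g Fi Fo ->
  (exists h : {linear VbarkL k M -> VbarkL k N}, bijective h) ->
  exists F : {linear space M -> space N}, bijective F /\ forall u m, F (act u m) = act u (F m).
Proof.
move=> fg [h hb].
have [fk fk_bij [fk_a fk_b]] := triangle_iso (away_bij_in fg) (away_bij_out fg) hb
  (@vbar_proj_surj M) (@vbar_proj_eq0 M) (@vbar_proj_surj N) (@vbar_proj_eq0 N)
  (fun x => away_beta_alpha qpS x fg) (away_ker fg) (away_im fg).
have [F FE] := linear_bundle (@glue_linear M N f fk).
exists F; split=> [|u m]; last by rewrite !FE; exact: (glue_commute fg fk_a fk_b).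
by rewrite (funext FE); exact: (glue_bij fg fk_bij).
Qed.

Section Decorations.

Let ik : {ffun I -> K} := idem_fun K k.

Lemma ik_ik : ik * ik = ik.
Proof. by apply/ffunP => j; rewrite !ffunE -natrM mulnb andbb. Qed.

Lemma vactM M l l' v : vact M (l * l') v = vact M l (vact M l' v).
Proof. exact: (dact_mul (dmodP M)). Qed.

Lemma vactD M l l' v : vact M (l + l') v = vact M l v + vact M l' v.
Proof. exact: (dact_add (dmodP M)). Qed.

Lemma vactc M c v : vact M [ffun=> c] v = c *: v.
Proof. exact: (dact_const (dmodP M)). Qed.

Lemma vact1 M v : vact M 1 v = v.
Proof. by have := vactc (M := M) 1 v; rewrite scale1r. Qed.

Lemma vact_idem M l v : vact M l (vact M ik v) = l k *: vact M ik v.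
Proof.
rewrite -vactM -vactc -vactM; congr (vact M _ v); apply/ffunP => j; rewrite !ffunE.
by case: eqP => [->|_]; rewrite ?mulr0.
Qed.

End Decorations.

End ModuleIso.

(** * Splitting a decoration at [k] *)

Section DecorationIso.
Variables (K : fieldType) (I : finType) (Q : quiver I) (S : cpa K Q) (k : I).
Implicit Types M N : dmod S.
Notation ik := (idem_fun K k : {ffun I -> K}).

Definition toVhat M (v : deco M) : VhatL k M :=
  @Subspace _ _ (im (vact M (1 - ik))) (vact M (1 - ik) v) (mem_im (vact M (1 - ik)) v).
Definition toVk M (v : deco M) : VkL k M :=
  @Subspace _ _ (im (vact M ik)) (vact M ik v) (mem_im (vact M ik) v).

Lemma toVhat_linear M : linear (@toVhat M).
Proof. by move=> c x y; apply: val_inj; rewrite /= linearP. Qed.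
Lemma toVk_linear M : linear (@toVk M).
Proof. by move=> c x y; apply: val_inj; rewrite /= linearP. Qed.

Lemma val_toVhat M v : val (@toVhat M v) = vact M (1 - ik) v. Proof. by []. Qed.
Lemma val_toVk M v : val (@toVk M v) = vact M ik v. Proof. by []. Qed.

Lemma ffun_mulC (l l' : {ffun I -> K}) : l * l' = l' * l.
Proof. by apply/ffunP => j; rewrite !ffunE mulrC. Qed.

Lemma ikC : (1 - ik) * ik = 0.
Proof. by rewrite mulrBl mul1r ik_ik subrr. Qed.

Lemma ikC_idem : (1 - ik) * (1 - ik) = 1 - ik.
Proof. by rewrite mulrBr mulr1 ikC subr0. Qed.

Lemma vact0 M v : vact M 0 v = 0.
Proof.
have -> : (0 : {ffun I -> K}) = [ffun=> 0] by apply/ffunP => j; rewrite !ffunE.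
by rewrite vactc scale0r.
Qed.

Lemma vactDr M l v w : vact M l (v + w) = vact M l v + vact M l w.
Proof. exact: linearD. Qed.

Lemma Vk_idem M (x : VkL k M) : vact M ik (val x) = val x.
Proof.
have /asboolP[v e] := subspace_mem x; have {}e : vact M ik v = val x := e.
by rewrite -e -vactM ik_ik.
Qed.

Lemma Vhat_idem M (x : VhatL k M) : vact M (1 - ik) (val x) = val x.
Proof.
have /asboolP[v e] := subspace_mem x; have {}e : vact M (1 - ik) v = val x := e.
by rewrite -e -vactM ikC_idem.
Qed.

Lemma val_vhat_act M l (x : VhatL k M) : val (vhat_act l x) = vact M l (val x).
Proof.
have -> : val (vhat_act l x) = vact M (1 - ik) (vact M l (val x)) by [].
by rewrite -vactM ffun_mulC vactM Vhat_idem.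
Qed.

(** The decoration is the direct sum of its parts at [k] and away from [k]; at [k] the element [l]
    acts by the scalar [l k], so a bare linear isomorphism is already compatible. *)
Lemma deco_iso_of_mid M N :
  (exists h : {linear VkL k M -> VkL k N}, bijective h) ->
  (exists2 h : {linear VhatL k M -> VhatL k N}, bijective h &
       forall l v, h (vhat_act l v) = vhat_act l (h v)) ->
  exists g : {linear deco M -> deco N},
     bijective g /\ forall l v, g (dact l v) = dact l (g v).
Proof.
move=> [hk [hk' hkK hk'K]] [hh [hh' hhK hh'K] hhl].
have [th thE] := linear_bundle (@toVhat_linear M); have [tk tkE] := linear_bundle (@toVk_linear M).
have gL : linear (fun v => val (hh (toVhat v)) + val (hk (toVk v)) : deco N).
  by move=> c x y; rewrite -!thE -!tkE !linearP /= scalerDr addrACA.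
have [g gE] := linear_bundle gL.
have sumE (L : dmod S) (v : deco L) : val (toVhat v) + val (toVk v) = v.
  by rewrite val_toVhat val_toVk -vactD subrK vact1.
have hatE (L : dmod S) (x : VhatL k L) (y : VkL k L) : toVhat (val x + val y) = x.
  by apply: val_inj; rewrite val_toVhat vactDr Vhat_idem -Vk_idem -vactM ikC vact0 addr0.
have kE (L : dmod S) (x : VhatL k L) (y : VkL k L) : toVk (val x + val y) = y.
  by apply: val_inj; rewrite val_toVk vactDr Vk_idem -Vhat_idem -vactM ffun_mulC ikC vact0 add0r.
exists g; split=> [|l v].
  exists (fun w => val (hh' (toVhat w)) + val (hk' (toVk w))) => v; rewrite gE.
    by rewrite hatE kE hhK hkK sumE.
  by rewrite hatE kE hh'K hk'K sumE.
rewrite !gE -[dact l v]/(vact M l v) -[dact l (_ + _)]/(vact N l _) vactDr.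
have -> : toVhat (vact M l v) = vhat_act l (toVhat v).
  by apply: val_inj; rewrite val_vhat_act !val_toVhat -!vactM ffun_mulC.
have -> : toVk (vact M l v) = l k *: toVk v.
  by apply: val_inj; rewrite linearZ /= -[LHS]/(vact M ik (vact M l v)) -vactM ffun_mulC vactM vact_idem.
rewrite hhl val_vhat_act linearZ; congr (_ + _).
by rewrite linearZ /= -[in RHS]Vk_idem vact_idem Vk_idem.
Qed.

Lemma mid_of_deco_iso M N (g : {linear deco M -> deco N}) :
  bijective g -> (forall l v, g (dact l v) = dact l (g v)) ->
  (exists h : {linear VkL k M -> VkL k N}, bijective h) /\
  (exists2 h : {linear VhatL k M -> VhatL k N}, bijective h &
       forall l v, h (vhat_act l v) = vhat_act l (h v)).
Proof.
move=> gb gl; have gl' l v : g (vact M l v) = vact N l (g v) by exact: gl.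
have gim l v : v \in im (vact M l) <-> g v \in im (vact N l).
  have [g' gK g'K] := gb; split=> /asboolP[w e]; apply/asboolP.
    by exists (g w); rewrite -e; symmetry; exact: gl'.
  exists (g' w); apply: (can_inj gK); rewrite -e; transitivity (vact N l (g (g' w))); first exact: gl'.
  by rewrite g'K.
split.
  by have [h hb _] := subspace_iso gb (gim ik); exists h.
have [h hb hE] := subspace_iso gb (gim (1 - ik)); exists h => // l v.
apply: val_inj; rewrite hE; transitivity (g (vact M l (val v))); first by congr (g _); exact: val_vhat_act.
rewrite gl'; symmetry; transitivity (vact N l (val (h v))); first exact: val_vhat_act.
by rewrite hE.
Qed.

End DecorationIso.

(** * Isomorphisms of modules and premutations compared through the data away from [k] *)

Section PremutationIso.
Variables (K : fieldType) (I : finType) (Q : quiver I) (S : cpa K Q).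
Variables (qpS : is_QP S) (acQ : two_acyclic Q) (k : I) (M N : dmod S).
Notation hat := (idem_hat K k Q).
Notation mQ := (premut_quiver k Q).
Let lfQ : loop_free Q := QP_loop_free qpS.
Let pS : potential S := QP_potential qpS.

Lemma away_of_iso (F : {linear space M -> space N}) : bijective F ->
  (forall u m, F (mact M u m) = mact N u (F m)) ->
  (exists f g Fi Fo, @away_iso _ _ _ _ k M N f g Fi Fo) /\
  exists h : {linear VbarkL k M -> VbarkL k N}, bijective h.
Proof.
move=> Fb Fu; have [F' FK F'K] := Fb.
have [G GE] := linear_bundle (inverse_linear FK F'K).
have Gu u n : G (mact N u n) = mact M u (G n).
  by apply: (can_inj FK); rewrite Fu !GE !F'K.
have fL : linear (fun m => mact N hat (F m)) by move=> c x y; rewrite !linearP.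
have gL : linear (fun n => mact M hat (G n)) by move=> c x y; rewrite !linearP.
have [f fE] := linear_bundle fL; have [g gE] := linear_bundle gL.
have hvh v : hat * v * hat = v -> hat * v = v /\ v * hat = v.
  by move=> e; rewrite -e -{2}mulrA !mulrA hat_hat -!mulrA hat_hat.
have fg : hat_iso k f g.
  split=> [v m /hvh[hv vh]|v n /hvh[hv vh]|m|n]; rewrite ?fE ?gE.
  - by rewrite Fu -!mactM hv vh.
  - by rewrite Gu -!mactM hv vh.
  - by rewrite Gu -mactM hat_hat GE FK.
  - by rewrite Fu -mactM hat_hat GE F'K.
have [Fi Fib FiE] := dsum_iso fg (tl_in lfQ); have [Fo Fob FoE] := dsum_iso fg (hd_out lfQ).
have atk m : m \in at_vertex M k <-> F m \in at_vertex N k.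
  split=> /at_vertexP e; apply/at_vertexP; first by rewrite -Fu e.
  by apply: (can_inj FK); rewrite Fu.
have [fk fkb fkE] := subspace_iso Fb atk.
have aE (x : MinL k M) : fk (alpha_lin k M x) = alpha_lin k N (Fi x).
  apply: val_inj; rewrite [LHS]fkE !val_alpha linear_sum; apply: eq_bigr => a _.
  by rewrite [LHS]Fu FiE fE -[mact N hat _]Fu (M_in_hat qpS).
have bE (x : MkL k M) : beta_lin k N (fk x) = Fo (beta_lin k M x).
  apply/val_inj/ffunP => b; rewrite FoE !val_beta fkE fE -[mact N hat _]Fu.
  by rewrite -(hat_out qpS) ?(eqP (valP b)) // -Fu.
have [fk' fkK fk'K] := fkb; have [Fi' FiK Fi'K] := Fib; have [Fo' FoK Fo'K] := Fob.
split.
  exists f, g, Fi, Fo; split=> // [x|y].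
    rewrite -aE; split=> [->|e]; first exact: linear0.
    by apply: (can_inj fkK); rewrite e linear0.
  split=> /asboolP[x e]; apply/asboolP.
    by exists (fk x); rewrite bE e.
  by exists (fk' x); apply: (can_inj FoK); rewrite -bE fk'K.
have kb x : x \in ker (beta_lin k M) <-> fk x \in ker (beta_lin k N).
  split=> /eqP e; apply/eqP; first by rewrite bE e linear0.
  by apply: (can_inj FoK); rewrite -bE e linear0.
have [fb fbb fbE] := subspace_iso fkb kb.
apply: (quotient_iso (@vbar_proj_surj _ _ _ _ k M) (@vbar_proj_surj _ _ _ _ k N) fbb) => x.
rewrite !vbar_proj_eq0 fbE; split=> /asboolP[y e]; apply/asboolP.
  by exists (Fi y); rewrite -aE e.
by exists (Fi' y); apply: (can_inj fkK); rewrite aE Fi'K.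
Qed.

Section Bar.
Variables (B : bar_triangle k M) (al : {linear MoutL k M -> bar_Mk B})
  (be : {linear bar_Mk B -> MinL k M}).
Hypotheses (alE : al =1 bar_alpha B) (beE : be =1 @bar_beta _ _ _ _ _ _ B).
Hypothesis D : dual_triangle (VkL k M) (alpha_lin k M) (beta_lin k M) (gamma_lin k M) al be.
Variables (B' : bar_triangle k N) (al' : {linear MoutL k N -> bar_Mk B'})
  (be' : {linear bar_Mk B' -> MinL k N}).
Hypotheses (alE' : al' =1 bar_alpha B') (beE' : be' =1 @bar_beta _ _ _ _ _ _ B').
Hypothesis D' : dual_triangle (VkL k N) (alpha_lin k N) (beta_lin k N) (gamma_lin k N) al' be'.

Definition MbarL : lmodType K := M_bar B.
Definition NbarL : lmodType K := M_bar B'.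

(** [f] is only known to commute with series cut down on both sides; for an arbitrary [v] the
    comparison is made after projecting away from [k]. *)
Lemma hat_iso_fixed f g v m : @hat_iso _ _ _ S k M N f g -> mact M hat m = m ->
  f (mact M hat (mact M v m)) = mact N hat (mact N v (f m)).
Proof.
move=> fg e; have ef : mact N hat (f m) = f m by rewrite -(hat_isof fg) ?hat_hat_hat ?e.
have -> : mact M hat (mact M v m) = mact M (hat * v * hat) m by rewrite !mactM e.
by rewrite (hat_isof fg) ?hat_sandwich // !mactM ef.
Qed.

Lemma hat_iso_sum f g u (J : finType) (w : J -> cpa K Q) m (y : J -> space M) :
  @hat_iso _ _ _ S k M N f g -> mact M hat m = m -> (forall i, mact M hat (y i) = y i) ->
  f (mact M hat (mact M u m + \sum_i mact M (w i) (y i))) =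
  mact N hat (mact N u (f m) + \sum_i mact N (w i) (f (y i))).
Proof.
move=> fg em ey; rewrite linearD [mact N hat _]linearD linearD; congr (_ + _).
  exact: hat_iso_fixed fg em.
rewrite !linear_sum; apply: eq_bigr => i _.
exact: (hat_iso_fixed (w i) fg (ey i)).
Qed.

Lemma away_out_inj f g Fi Fo b m : @away_iso _ _ _ _ k M N f g Fi Fo ->
  Fo (out_inj b m) = out_inj b (f (mact M hat m)).
Proof.
move=> fg; apply/val_inj/ffunP => b'; rewrite (away_out fg) !ffunE.
case: eqP => _; last by rewrite linear0.
have hb : hat * idem K (hd (val b)) * hat = idem K (hd (val b)).
  by rewrite hat_idem (negbTE (hd_out lfQ b)) idem_hatM (negbTE (hd_out lfQ b)).
rewrite -(hat_isof (away_hat fg)) // -[X in _ = f X]mactM idem_hatM.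
by rewrite (negbTE (hd_out lfQ b)).
Qed.

(** [triangle_iso] is applied to the dual triangle, where [dual_ker] and [dual_im] convert [im beta]
    and [ker alpha] into the required kernel and image. The formula [eta_tildeE] only involves [f],
    [al] and [be], with which the pair commutes. *)
Lemma bar_iso_of_away f g Fi Fo : @away_iso _ _ _ _ k M N f g Fi Fo ->
  (exists h : {linear VkL k M -> VkL k N}, bijective h) ->
  exists F : {linear MbarL -> NbarL}, bijective F /\
    forall u m, F (eta_tilde u m) = eta_tilde u (F m).
Proof.
move=> fg [h hb]; have [p ps pk] := dual_rest D; have [p' ps' pk'] := dual_rest D'.
have fh := away_hat fg.
have e1 a : Fi (be (al a)) = be' (al' (Fo a)).
  by rewrite (dual_comp D) (dual_comp D') linearN (away_gamma qpS _ fg).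
have e2 a : al a = 0 <-> al' (Fo a) = 0.
  rewrite (dual_ker D) (dual_ker D'); have := away_im fg a.
  by split=> /asboolP h1; apply/asboolP; have := away_im fg a; case=> h2 h3; [exact: h2 | exact: h3].
have e3 b : b \in im be <-> Fi b \in im be'.
  have [i1 i2] := dual_im D b; have [i3 i4] := dual_im D' (Fi b); have [k1 k2] := away_ker fg b.
  by split=> /asboolP h1; apply/asboolP; [apply/i4/k1/i1 | apply/i2/k2/i3].
have [Fk [Fk' FkK Fk'K] [Fka Fkb]] :=
  triangle_iso (away_bij_out fg) (away_bij_in fg) hb ps pk ps' pk' e1 e2 e3.
have [tM tME] := linear_bundle (@to_hat_linear _ _ _ S k M).
have [tN tNE] := linear_bundle (@to_hat_linear _ _ _ S k N).
pose Ff (m : MbarL) : NbarL := (to_hat k (f (val m.1)), Fk m.2).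
have fhat (m : space M) : mact M hat m = m -> mact N hat (f m) = f m.
  by move=> e; rewrite -(hat_isof fh) ?hat_hat_hat ?e.
have ghat (n : space N) : mact N hat n = n -> mact M hat (g n) = g n.
  by move=> e; rewrite -(hat_isog fh) ?hat_hat_hat ?e.
have FL : linear Ff.
  have fL : linear (fun m : MbarL => to_hat k (f (val m.1)) : MhatL k N).
    move=> c x y; have -> : val (c *: x + y).1 = c *: val x.1 + val y.1 by [].
    by rewrite -!tNE !linearP.
  have kL : linear (fun m : MbarL => Fk m.2).
    by move=> c x y; rewrite [(_ + _).2](_ : _ = c *: x.2 + y.2) // linearP.
  exact: (linear_pair fL kL).
have [F FE] := linear_bundle FL; exists F; split.
  exists (fun n : NbarL => (to_hat k (g (val n.1)), Fk' n.2) : MbarL) => m; rewrite FE /Ff.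
    case: m => m1 m2 /=; rewrite FkK; congr (_, _); apply: val_inj.
    by rewrite val_to_hat [mact N hat _]fhat ?hat_val // (hat_isofK fh) -mactM hat_hat hat_val.
  case: m => m1 m2 /=; rewrite Fk'K; congr (_, _); apply: val_inj.
  by rewrite val_to_hat [mact M hat _]ghat ?hat_val // (hat_isogK fh) -mactM hat_hat hat_val.
move=> u m; have [m' m'E] : exists m' : M_bar B', m' = Ff m by exists (Ff m).
have v1 : val m'.1 = f (val m.1) by rewrite m'E [LHS]val_to_hat fhat ?hat_val.
have v2 : m'.2 = Fk m.2 by rewrite m'E.
have bb a : val (be' m'.2) a = f (val (be m.2) a) by rewrite v2 Fkb (away_in fg).
rewrite !FE -m'E (eta_tildeE qpS alE beE) (eta_tildeE qpS alE' beE') v1 {m'E}.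
rewrite (eq_bigr (fun a => mact N (chi S (comp_v u a)) (f (val (be m.2) a)))) => [|a _]; last by rewrite bb.
congr (_, _).
  apply: val_inj; rewrite [LHS]val_to_hat [RHS]val_to_hat -[f (val _)]/(f (mact M hat _)).
  rewrite (hat_iso_sum _ _ fh) ?hat_val // => [|i]; last exact: (M_in_hat qpS).
  by rewrite -mactM hat_hat.
rewrite linearD linearZ Fka v2 linear_sum; congr (_ + al' _); apply: eq_bigr => b _.
rewrite (away_out_inj _ _ fg) (hat_iso_sum _ _ fh) ?hat_val //; last first.
  by move=> i; exact: (M_in_hat qpS).
rewrite (out_inj_hat qpS); congr (out_inj b (_ + _)).
by apply: eq_bigr => a _; rewrite -bb v2.
Qed.

(** Commuting with e_k makes [F] block diagonal; commuting with bracketed series, a^* and b^* makes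
    its blocks compatible with the action away from [k], with [be] and with [al]. Then
    [im be = ker alpha] and [ker al = im beta] give the remaining data. *)
Lemma away_of_bar_iso (F : {linear MbarL -> NbarL}) : bijective F ->
  (forall u m, F (eta_tilde u m) = eta_tilde u (F m)) ->
  (exists f g Fi Fo, @away_iso _ _ _ _ k M N f g Fi Fo) /\
  exists h : {linear VkL k M -> VkL k N}, bijective h.
Proof.
move=> [F' FK F'K] Fe.
have [G GE] := linear_bundle (inverse_linear FK F'K).
have Ge u n : G (eta_tilde u n) = eta_tilde u (G n).
  by apply: (can_inj FK); rewrite Fe !GE !F'K.
have FG n : F (G n) = n by rewrite GE F'K.
have GF m : G (F m) = m by rewrite GE FK.
(* e_k acts as the projection onto the second summand, so [F] and [G] preserve both summands. *)
have F1 (x : bar_Mk B) : F (0, x) = (0, (F (0, x)).2).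
  by have := Fe (idem K k) (0, x); rewrite !(eta_tilde_idem qpS alE beE, eta_tilde_idem qpS alE' beE').
have F2 (m : MhatL k M) : F (m, 0) = ((F (m, 0)).1, 0).
  have := Fe (idem K k) (m, 0).
  rewrite (eta_tilde_idem qpS alE beE) (eta_tilde_idem qpS alE' beE') /= -[(0, 0)]/(0 : MbarL) linear0.
  by case: (F (m, 0)) => [n1 n2] [] /= <-.
have G1 (x : bar_Mk B') : G (0, x) = (0, (G (0, x)).2).
  by have := Ge (idem K k) (0, x); rewrite !(eta_tilde_idem qpS alE beE, eta_tilde_idem qpS alE' beE').
have G2 (m : MhatL k N) : G (m, 0) = ((G (m, 0)).1, 0).
  have := Ge (idem K k) (m, 0).
  rewrite (eta_tilde_idem qpS alE beE) (eta_tilde_idem qpS alE' beE') /= -[(0, 0)]/(0 : NbarL) linear0.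
  by case: (G (m, 0)) => [n1 n2] [] /= <-.
have [tM tME] := linear_bundle (@to_hat_linear _ _ _ S k M).
have [tN tNE] := linear_bundle (@to_hat_linear _ _ _ S k N).
have idL (L : lmodType K) : linear (fun x : L => x) by [].
have [iM iME] := linear_bundle (linear_pair (idL (MhatL k M)) (@linear_cst0 K _ (bar_Mk B))).
have [iN iNE] := linear_bundle (linear_pair (idL (MhatL k N)) (@linear_cst0 K _ (bar_Mk B'))).
have fL : linear (fun m : space M => val (F (to_hat k m, 0)).1 : space N).
  by move=> c x y; rewrite -!tME -!iME !linearP.
have gL : linear (fun m : space N => val (G (to_hat k m, 0)).1 : space M).
  by move=> c x y; rewrite -!tNE -!iNE !linearP.
have [f fE] := linear_bundle fL; have [g gE] := linear_bundle gL.
have fP m : F (to_hat k m, 0) = (to_hat k (f m), 0) by rewrite F2 fE to_hatK.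
have gP n : G (to_hat k n, 0) = (to_hat k (g n), 0) by rewrite G2 gE to_hatK.
have fh m : mact N hat (f m) = f m by rewrite fE hat_val.
have gh n : mact M hat (g n) = g n by rewrite gE hat_val.
have toL (L : dmod S) v (m : space L) : hat * v * hat = v ->
    mact L hat (mact L v m) = mact L v m /\ mact L v (mact L hat m) = mact L v m.
  by move=> e; rewrite -!mactM -e -{2}mulrA !mulrA hat_hat -!mulrA hat_hat.
have fg : hat_iso k f g.
  split=> [v m hv|v n hv|m|n].
  - have := Fe (bracket k v) (to_hat k m, 0).
    rewrite (eta_tilde_bracket qpS acQ alE beE) // (eta_tilde_bracket qpS acQ alE' beE') //.
    rewrite [val _](val_to_hat k m) (toL M v m hv).2 !fP => /(congr1 (fun x : NbarL => val x.1)).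
    by rewrite ![val _]val_to_hat fh => ->; rewrite fh (toL N _ _ hv).1.
  - have := Ge (bracket k v) (to_hat k n, 0).
    rewrite (eta_tilde_bracket qpS acQ alE beE) // (eta_tilde_bracket qpS acQ alE' beE') //.
    rewrite [val _](val_to_hat k n) (toL N v n hv).2 !gP => /(congr1 (fun x : MbarL => val x.1)).
    by rewrite ![val _]val_to_hat gh => ->; rewrite gh (toL M _ _ hv).1.
  - by rewrite gE -[X in G X]fP GF.
  - by rewrite fE -[X in F X]gP FG.
have [Fi Fib FiE] := dsum_iso fg (tl_in lfQ); have [Fo Fob FoE] := dsum_iso fg (hd_out lfQ).
have kL : linear (fun x : bar_Mk B => (F (0, x)).2).
  have [jM jME] := linear_bundle (linear_pair (@linear_cst0 K _ (MhatL k M)) (idL (bar_Mk B))).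
  by move=> c x y; rewrite -!jME !linearP.
have [Fk FkE] := linear_bundle kL.
have FkP x : F (0, x) = (0, Fk x) by rewrite F1 FkE.
have FkK : cancel Fk (fun x => (G (0, x)).2) by move=> x; rewrite -FkP GF.
have FkK' : cancel (fun x => (G (0, x)).2) Fk by move=> x; rewrite FkE -G1 FG.
have Fkb : bijective Fk by exists (fun x => (G (0, x)).2).
have bE x : be' (Fk x) = Fi (be x).
  apply/val_inj/ffunP => a; have := Fe (arr K (InStar a : arrow mQ)) (0, x).
  rewrite (eta_tilde_instar qpS acQ alE beE) (eta_tilde_instar qpS acQ alE' beE') fP FkP.
  move/(congr1 (fun x : NbarL => val x.1)); rewrite ![val _]val_to_hat fh FiE => ->.
  by rewrite -[RHS]/(mact N hat (val (be' (Fk x)) a)) (M_in_hat qpS).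
have aE1 b (m : space M) : Fk (al (out_inj b m)) = al' (out_inj b (f m)).
  have := Fe (arr K (OutStar b : arrow mQ)) (to_hat k m, 0).
  rewrite (eta_tilde_outstar qpS acQ alE beE) fP (eta_tilde_outstar qpS acQ alE' beE').
  rewrite [val _](val_to_hat k m) (out_inj_hat qpS) [val _](val_to_hat k (f m)) fh FkP.
  by move/(congr1 (fun x : NbarL => x.2)).
have aE y : Fk (al y) = al' (Fo y).
  rewrite {1}[y]M_out_sum [Fo y]M_out_sum !linear_sum; apply: eq_bigr => b _.
  by rewrite aE1 FoE.
have [Fi' FiK Fi'K] := Fib; have [Fo' FoK Fo'K] := Fob.
split.
  exists f, g, Fi, Fo; split=> // [x|y].
    have [i1 i2] := dual_im D x; have [i3 i4] := dual_im D' (Fi x).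
    split=> [/i2[z e]|/i4[z e]]; first by apply/i3; exists (Fk z); rewrite bE e.
    by apply/i1; exists ((G (0, z)).2); apply: (can_inj FiK); rewrite -bE FkK'.
  have [i1 i2] := dual_ker D y; have [i3 i4] := dual_ker D' (Fo y).
  split=> /asboolP e; apply/asboolP.
    by apply/i3; rewrite -aE (i2 e) linear0.
  by apply/i1; apply: (can_inj FkK); rewrite aE (i4 e) linear0.
have [p ps pk] := dual_rest D; have [p' ps' pk'] := dual_rest D'.
have kb x : x \in ker be <-> Fk x \in ker be'.
  split=> /eqP e; apply/eqP; first by rewrite bE e linear0.
  by apply: (can_inj FiK); rewrite -bE e linear0.
have [fb fbb fbE] := subspace_iso Fkb kb.
apply: (quotient_iso ps ps' fbb) => x.
rewrite pk pk' fbE; split=> /asboolP[y e]; apply/asboolP.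
  by exists (Fo y); rewrite -aE e.
by exists (Fo' y); apply: (can_inj FkK); rewrite aE Fo'K.
Qed.

End Bar.

End PremutationIso.

Section PremutationIff.
Variables (K : fieldType) (I : finType) (Q : quiver I) (S : cpa K Q).
Variables (qpS : is_QP S) (acQ : two_acyclic Q) (k : I) (M N : dmod S).
Notation ik := (idem_fun K k : {ffun I -> K}).

Definition VbarL (L : dmod S) : lmodType K := V_bar k L.

Lemma V_bar_actE (L : dmod S) l (v : VbarL L) : V_bar_act l v = (vhat_act l v.1, l k *: v.2).
Proof. by []. Qed.

Lemma V_bar_act_idem (L : dmod S) (v : VbarL L) : V_bar_act ik v = (0, v.2).
Proof.
rewrite V_bar_actE; congr (_, _); last by rewrite ffunE eqxx scale1r.
apply: val_inj; rewrite [LHS]val_vhat_act -Vhat_idem -vactM ffun_mulC ikC vact0.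
by rewrite linear0.
Qed.

Lemma V_bar_iso_of_mid :
  (exists h : {linear VbarkL k M -> VbarkL k N}, bijective h) ->
  (exists2 h : {linear VhatL k M -> VhatL k N}, bijective h &
       forall l v, h (vhat_act l v) = vhat_act l (h v)) ->
  exists g : {linear VbarL M -> VbarL N},
     bijective g /\ forall l v, g (V_bar_act l v) = V_bar_act l (g v).
Proof.
move=> [hb [hb' hbK hbK']] [hh [hh' hhK hhK'] hhl].
have gL : linear (fun v : VbarL M => (hh v.1, hb v.2) : VbarL N).
  apply: (linear_pair (V := VhatL k N) (W := VbarkL k N)).
    by move=> c x y; rewrite [(_ + _).1](_ : _ = c *: x.1 + y.1) // linearP.
  by move=> c x y; rewrite [(_ + _).2](_ : _ = c *: x.2 + y.2) // linearP.
have [g gE] := linear_bundle gL; exists g; split=> [|l v]; last first.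
  by rewrite !gE !V_bar_actE hhl linearZ.
exists (fun w : VbarL N => (hh' w.1, hb' w.2) : VbarL M) => -[v1 v2]; rewrite gE /=.
  by rewrite hhK hbK.
by rewrite hhK' hbK'.
Qed.

(** The idempotent of [k] acts as the projection onto the second summand, so [g] and its inverse are
    block diagonal, and their blocks are mutually inverse. *)
Lemma mid_of_V_bar_iso (g : {linear VbarL M -> VbarL N}) :
  bijective g -> (forall l v, g (V_bar_act l v) = V_bar_act l (g v)) ->
  (exists h : {linear VbarkL k M -> VbarkL k N}, bijective h) /\
  (exists2 h : {linear VhatL k M -> VhatL k N}, bijective h &
       forall l v, h (vhat_act l v) = vhat_act l (h v)).
Proof.
move=> [g' gK g'K] gl; have [G GE] := linear_bundle (inverse_linear gK g'K).
have Gl l v : G (V_bar_act l v) = V_bar_act l (G v).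
  by apply: (can_inj gK); rewrite gl !GE !g'K.
have gG v : g (G v) = v by rewrite GE g'K.
have Gg v : G (g v) = v by rewrite GE gK.
have g1 (w : VbarkL k M) : g (0, w) = (0, (g (0, w)).2).
  by have := gl ik (0, w); rewrite !V_bar_act_idem.
have g2 (v : VhatL k M) : g (v, 0) = ((g (v, 0)).1, 0).
  have := gl ik (v, 0); rewrite !V_bar_act_idem -[((v, 0) : VbarL M).2]/0 -[(0, 0)]/(0 : VbarL M) linear0.
  by case: (g (v, 0)) => [n1 n2] [] /= <-.
have G1 (w : VbarkL k N) : G (0, w) = (0, (G (0, w)).2).
  by have := Gl ik (0, w); rewrite !V_bar_act_idem.
have G2 (v : VhatL k N) : G (v, 0) = ((G (v, 0)).1, 0).
  have := Gl ik (v, 0); rewrite !V_bar_act_idem -[((v, 0) : VbarL N).2]/0 -[(0, 0)]/(0 : VbarL N) linear0.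
  by case: (G (v, 0)) => [n1 n2] [] /= <-.
have idL (L : lmodType K) : linear (fun x : L => x) by [].
have [j1 j1E] := linear_bundle (linear_pair (@linear_cst0 K _ (VhatL k M)) (idL (VbarkL k M))).
have [j2 j2E] := linear_bundle (linear_pair (idL (VhatL k M)) (@linear_cst0 K _ (VbarkL k M))).
have kL : linear (fun w : VbarkL k M => (g (0, w)).2 : VbarkL k N).
  by move=> c x y; rewrite -!j1E !linearP.
have hL : linear (fun v : VhatL k M => (g (v, 0)).1 : VhatL k N).
  by move=> c x y; rewrite -!j2E !linearP.
have [hk hkE] := linear_bundle kL; have [h hE] := linear_bundle hL.
split.
  exists hk; exists (fun w => (G (0, w)).2) => w; first by rewrite hkE -g1 Gg.
  by rewrite hkE -G1 gG.
exists h; first exists (fun v => (G (v, 0)).1) => v; rewrite ?hE -?g2 -?G2 ?Gg ?gG //.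
move=> l v; rewrite !hE.
have := gl l (v, 0); rewrite !V_bar_actE -[((v, 0) : VbarL M).2]/0 scaler0.
by move/(congr1 (fun x : VbarL N => x.1)).
Qed.

Variables (dM dN : description) (sM : splitting k M) (sN : splitting k N).

Lemma premutation_disomorphic :
  disomorphic (premutation qpS dM sM) (premutation qpS dN sN) <-> disomorphic M N.
Proof.
have [al [be [alE beE D]]] := bar_dualP qpS dM sM.
have [al' [be' [alE' beE' D']]] := bar_dualP qpS dN sN.
split=> [[[F [Fb Fe]] [G [Gb Ge]]]|[[F [Fb Fe]] [G [Gb Ge]]]].
  have [[f [g [Fi [Fo fg]]]] hk] := away_of_bar_iso qpS acQ alE beE D alE' beE' D' Fb Fe.
  have [hb hh] := mid_of_V_bar_iso Gb Ge.
  by split; [exact: (module_iso_of_away qpS fg hb) | exact: (deco_iso_of_mid hk hh)].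
have [[f [g [Fi [Fo fg]]]] hb] := away_of_iso qpS k Fb Fe.
have [hk hh] := mid_of_deco_iso k Gb Ge.
by split; [exact: (bar_iso_of_away qpS alE beE D alE' beE' D' fg hk) | exact: (V_bar_iso_of_mid hb hh)].
Qed.

End PremutationIff.

(** * Annihilation by the Jacobian ideal *)

Section Entries.
Variables (K : fieldType) (I : finType) (Q : quiver I) (k : I) (S S0 : cpa K Q).
Hypotheses (lfQ : loop_free Q) (acQ : two_acyclic Q).
Hypotheses (pS : potential S) (pS0 : potential S0) (S0h : idem_hat K k Q * S0 * idem_hat K k Q = S0).
Hypothesis SS0 : cyc_equiv S S0.
Notation mQ := (premut_quiver k Q).
Notation hat := (idem_hat K k mQ).
Notation mS := (premut_potential k S0).
Notation J := (jacobian_ideal S).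
Notation chi := (chi S (k := k)).
Notation st a := (arr K (InStar a : arrow mQ)).
Notation ost b := (arr K (OutStar b : arrow mQ)).
Notation cmp b a := (arr K (Comp b a : arrow mQ)).

(** Row and column operators of the component matrix: [None] keeps the part away from [k], while
    [Some] strips a leading b^* here and a trailing a^* in [compR]. *)
Definition compL (r : option (out_arrow k Q)) (u : cpa K mQ) : cpa K mQ :=
  if r is Some b then ldiv (OutStar b : arrow mQ) u else hat * u.
Definition compR (s : option (in_arrow k Q)) (u : cpa K mQ) : cpa K mQ :=
  if s is Some a then rdiv (InStar a : arrow mQ) u else u * hat.
Definition outL (r : option (out_arrow k Q)) : cpa K Q := if r is Some b then arr K (val b) else 0.
Definition inR (s : option (in_arrow k Q)) : cpa K Q := if s is Some a then arr K (val a) else 0.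
Definition entry r s u := chi (compL r (compR s u)).

Lemma clin_compL r : clin (compL r).
Proof. by case: r => [b|]; [exact: clin_ldiv | exact: clinMl]. Qed.
Lemma clin_compR s : clin (compR s).
Proof. by case: s => [a|]; [exact: clin_rdiv | exact: clinMr]. Qed.
Lemma clin_entry r s : clin (entry r s).
Proof. by apply: clin_comp (clin_chi S k) _; apply: clin_comp; [exact: clin_compL | exact: clin_compR]. Qed.

Lemma linear_hat0 (f : cpa K mQ -> cpa K mQ) :
  linear f -> (forall j, f (idem K j) = 0) -> f hat = 0.
Proof.
move=> /linear_bundle[g gE] f0.
by rewrite /idem_hat -(idem_sum K mQ) -gE linearB linear_sum gE f0 big1 ?subr0 // => j _; rewrite gE.
Qed.

Lemma ldiv_hat c : ldiv c hat = 0.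
Proof. by apply: linear_hat0; [exact: (clin_ldiv K c).1 | exact: ldiv_idem]. Qed.

Lemma rdiv_hat c : rdiv c hat = 0.
Proof. by apply: linear_hat0; [exact: (clin_rdiv K c).1 | exact: rdiv_idem]. Qed.

Lemma coef_hat_k : hat (k, [::]) = 0.
Proof. have e : (1 : cpa K mQ) (k, [::]) = 1 by [].
by rewrite /idem_hat coefD coefN e coef_monomial eqxx subrr. Qed.

Lemma coef_hatM u : (hat * u) (k, [::]) = 0.
Proof. by rewrite coefM conv_nil coef_hat_k mul0r. Qed.
Lemma coef_Mhat u : (u * hat) (k, [::]) = 0.
Proof. by rewrite coefM conv_nil coef_hat_k mulr0. Qed.

(** A cofactor of b^* has its head at the head of [b], which is not [k]. Hence whatever continues
    such a series to the right from [k] is preceded by an actual arrow with tail [k]. *)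
Lemma compL_const r u : compL r u (k, [::]) = 0.
Proof.
case: r => [b|]; last exact: coef_hatM.
rewrite /compL -[LHS]/(ldiv_coef _ _ _) /ldiv_coef /=; case: eqP => // e.
by have := hd_out lfQ b; rewrite -e eqxx.
Qed.

Lemma compR_const s u : compR s u (k, [::]) = 0.
Proof.
case: s => [a|]; last exact: coef_Mhat.
rewrite /compR -[LHS]/(u (k, [:: InStar a : arrow mQ])); apply: coef0P.
by rewrite /is_path /= andbT; exact: tl_in.
Qed.

Lemma compL_hatM r p t : compL r (p * (hat * t)) = compL r p * (hat * t).
Proof.
case: r => [b|]; last by rewrite /compL !mulrA.
rewrite /compL ldivM [ldiv _ (hat * t)]ldivM ldiv_hat mul0r add0r /=.
by rewrite coef_hat_k scale0r scaler0 addr0.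
Qed.
Lemma compR_hatM s t q : compR s (t * hat * q) = t * hat * compR s q.
Proof.
case: s => [a|]; last by rewrite /compR !mulrA.
rewrite /compR rdivM [rdiv _ (t * hat)]rdivM rdiv_hat mulr0 add0r /=.
by rewrite coef_hat_k scale0r scaler0 addr0.
Qed.

Lemma chi_sum (T : finType) (F : T -> cpa K mQ) : chi (\sum_i F i) = \sum_i chi (F i).
Proof.
have [g gE] := linear_bundle (clin_chi S k).1.
by rewrite -gE linear_sum; apply: eq_bigr => i _; rewrite gE.
Qed.

(** Inserting [hat] between the factors moves the condition from the head of [t] to the tail of the
    left factor, where [chiM] needs it. *)
Lemma chiMhat u t : hat * t = t -> chi (u * t) = chi (u * hat) * chi t.
Proof.
move=> ht; rewrite -chiM ?[u * hat * t]mulrAC -?mulrA ?ht // -?mulrA ?hat_hat //.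
Qed.

Lemma hat_st a : hat * st a = st a.
Proof.
by rewrite /arr hat_monomial ifN //; exact: tl_in.
Qed.

Lemma hat_cmp b a : hat * cmp b a = cmp b a.
Proof. by rewrite /arr hat_monomial ifN //; exact: hd_out. Qed.

Lemma hat_ost b : hat * ost b = 0.
Proof. by rewrite /arr hat_monomial /= eqxx. Qed.

Lemma st_hat a : st a * hat = 0.
Proof. by rewrite /arr monomial_hat /word_tl /= eqxx. Qed.

Lemma cmp_hat b a : cmp b a * hat = cmp b a.
Proof. by rewrite /arr monomial_hat ifN //; exact: tl_in. Qed.

Lemma jacobian_sum (T : finType) (P : pred T) (F : T -> cpa K Q) :
  (forall i, P i -> J (F i)) -> J (\sum_(i | P i) F i).
Proof.
move=> h; rewrite big_mkcond /=; apply: subspace_sum; first exact: closed_jacobian.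
by move=> i; case: ifP => [/h//|_]; have [J0] := closed_jacobian S.
Qed.

(** The arrows of [mQ] with tail [k] are the stars of the arrows a' into [k], so each b^* is
    preceded by some a'^*. The pair becomes minus the second derivative at [b a'], and summing
    against [b] gives minus the derivative of [S] at a'. *)
Lemma jacobian_through_in (L : cpa K mQ) a q : L (k, [::]) = 0 ->
  J (chi (L * ((\sum_b ost b * cmp b a) * q))).
Proof.
move=> L0; rewrite mulr_suml.
have -> : L * (\sum_b ost b * cmp b a * q) = \sum_(c | tl c == k) \sum_b rdiv c L * (arr K c * (ost b * (cmp b a * q))).
  rewrite exchange_big mulr_sumr; apply: eq_bigr => b _.
  have e := rdiv_idemE k L; rewrite L0 scale0r add0r in e.
  under eq_bigr do rewrite mulrA.
  rewrite -mulr_suml -e -[in LHS](mulr1 L) (one_hat K mQ k) mulrDr mulrDl -mulrA.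
  by rewrite [hat * _]mulrA [hat * _]mulrA hat_ost !mul0r mulr0 add0r !mulrA.
have [g gE] := linear_bundle (clin_chi S k).1.
rewrite -gE linear_sum; apply: jacobian_sum => -[c|b a'|a'|b] /= /eqP tk.
- by have [_] := off_neq c; rewrite tk eqxx.
- by have := tl_in lfQ a'; rewrite tk eqxx.
- rewrite gE chi_sum.
  have -> : \sum_b chi (rdiv (InStar a' : arrow mQ) L * (st a' * (ost b * (cmp b a * q)))) =
     - (chi (rdiv (InStar a' : arrow mQ) L * hat) * cder S (val a') * (arr K (val a) * chi q)).
    rewrite -(cder_sum_cder2 pS lfQ (hd_in a')) mulr_sumr mulr_suml -sumrN; apply: eq_bigr => b _.
    rewrite chiMhat; last by rewrite mulrA hat_st.
    by rewrite chi_stars // chi_comp // mulNr mulrN !mulrA.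
  have [J0 JP _] := closed_jacobian S; rewrite -[- _]addr0 -scaleN1r; apply: JP => //.
  by apply/jacobianMr/jacobianMl/jacobian_cder.
- by have := hd_out lfQ b; rewrite tk eqxx.
Qed.

(** Mirror image: each a^* is followed by some b'^*, and summing [a] against the second derivatives
    at [b' a] gives the derivative of [S] at b'. *)
Lemma jacobian_through_out (L : cpa K mQ) b (q : cpa K mQ) : q (k, [::]) = 0 ->
  J (chi (L * (\sum_a cmp b a * st a) * q)).
Proof.
move=> q0; rewrite -mulrA mulr_suml mulr_sumr.
have -> : \sum_a L * (cmp b a * st a * q) = \sum_(c | hd c == k) \sum_a L * (cmp b a * (st a * (arr K c * ldiv c q))).
  rewrite exchange_big; apply: eq_bigr => a _; rewrite -!mulr_sumr.
  have e := idem_ldivE k q; rewrite q0 scale0r add0r in e.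
  rewrite -e -[in LHS](mul1r q) (one_hat K mQ k) mulrDl -mulrA.
  by rewrite mulrDr [st a * (hat * q)]mulrA st_hat mul0r add0r.
have [g gE] := linear_bundle (clin_chi S k).1.
rewrite -gE linear_sum; apply: jacobian_sum => -[c|b' a'|a'|b'] /= /eqP hk.
- by have [] := off_neq c; rewrite hk eqxx.
- by have := hd_out lfQ b'; rewrite hk eqxx.
- by have := tl_in lfQ a'; rewrite hk eqxx.
- rewrite gE chi_sum.
  have -> : \sum_a chi (L * (cmp b a * (st a * (ost b' * ldiv (OutStar b' : arrow mQ) q)))) =
     - (chi (L * hat) * (arr K (val b) * cder S (val b')) * chi (ldiv (OutStar b' : arrow mQ) q)).
    rewrite -(sum_arr_cder2 (IsQP lfQ pS) (tl_out b')) mulr_sumr mulr_sumr mulr_suml -sumrN; apply: eq_bigr => a _.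
    rewrite chiMhat; last by rewrite mulrA hat_cmp.
    by rewrite chi_comp // chi_stars // mulNr !mulrN !mulrA.
  have [J0 JP _] := closed_jacobian S; rewrite -[- _]addr0 -scaleN1r; apply: JP => //.
  by apply/jacobianMr/jacobianMl/jacobianMl/jacobian_cder.
Qed.

Lemma hat_of_idem j u : j != k -> idem K j * u = u -> hat * u = u.
Proof. by move=> jk <-; rewrite mulrA hat_idem (negbTE jk). Qed.

Lemma hat_of_Midem j u : j != k -> u * idem K j = u -> u * hat = u.
Proof. by move=> jk <-; rewrite -mulrA idem_hatM (negbTE jk). Qed.

Notation solvable := (solvable outL inR entry J).
Let pmS : potential mS := potential_premut pS0.

(** No path of [p * u] has its tail at [k], so a trailing a^* always belongs to [q]. *)
Lemma compR_mid s p u q : u * hat = u -> compR s (p * u * q) = p * (u * compR s q).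
Proof. by move=> uh; rewrite -{1}uh mulrA compR_hatM -[p * u * hat]mulrA uh mulrA. Qed.

Lemma compL_mid r p u t : hat * u = u -> compL r (p * (u * t)) = compL r p * (u * t).
Proof. by move=> hu; rewrite -hu -[hat * u * t]mulrA compL_hatM. Qed.

Lemma chiZD (c : K) u v : chi (u + c *: v) = chi u + c *: chi v.
Proof.
have [g gE] := linear_bundle (clin_chi S k).1.
by rewrite -!gE linearD linearZ.
Qed.

Lemma solvable_away p u q : hat * u = u -> u * hat = u -> J (chi u) -> solvable (p * u * q).
Proof.
move=> hu uh Ju; exists (fun=> 0), (fun=> 0) => r s; rewrite mulr0 mul0r addr0 subr0.
rewrite /entry compR_mid // compL_mid // chiMhat; last by rewrite mulrA hu.
by rewrite [chi (u * _)]chiM //; apply: jacobianMl; exact: jacobianMr.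
Qed.

Lemma solvable_in p a q : solvable (p * (\sum_b ost b * cmp b a) * q).
Proof.
(* When [p] contributes its trivial path at [k], the b^* stripped on the left is that of the
   derivative itself; what is left is [[ba] q], which [chi] sends to [b] times this witness. *)
exists (fun s => (p (k, [::]) : K) *: (arr K (val a) * chi (compR s q))), (fun=> 0) => r s.
set u := \sum_b _; have uh : u * hat = u.
  by rewrite mulr_suml; apply: eq_bigr => b _; rewrite -mulrA cmp_hat.
have H := jacobian_through_in a (compR s q) (compL_const r p).
rewrite /entry compR_mid // mul0r addr0; case: r H => [b|] H /=; last first.
  by rewrite mul0r subr0 mulrA.
rewrite ldivM chiZD /= scaleMr.
suff -> : ldiv (OutStar b : arrow mQ) (u * compR s q) = cmp b a * compR s q by rewrite chi_comp // addrK.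
have [g gE] := linear_bundle (clin_ldiv K (OutStar b : arrow mQ)).1.
rewrite mulr_suml -gE linear_sum (bigD1 b) //= big1 ?addr0 => [|b' nb]; rewrite gE -mulrA ldivM ldiv_arr coef_arr_nil scale0r addr0.
  by rewrite eqxx mulrA; have := idem_arr K (Comp b a : arrow mQ) => ->.
by case: eqP => [[e]|_]; [rewrite e eqxx in nb | rewrite mul0r].
Qed.

Lemma solvable_out p b q : solvable (p * (\sum_a cmp b a * st a) * q).
Proof.
(* Symmetrically, the trivial path of [q] at [k] lets the a^* of the derivative be stripped, leaving
   [p [ba]], which [chi] sends to this witness times [a]. *)
exists (fun=> 0), (fun r => (q (k, [::]) : K) *: (chi (compL r p * hat) * arr K (val b))) => r s.
set u := \sum_a _; have hu : hat * u = u.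
  by rewrite mulr_sumr; apply: eq_bigr => a _; rewrite mulrA hat_cmp.
have H := jacobian_through_out (compL r p) b (compR_const s q).
have CL : compL r (p * u * compR s q) = compL r p * u * compR s q by rewrite -!mulrA compL_mid.
rewrite /entry mulr0 add0r; case: s H CL => [a|] H CL; last first.
  by rewrite mulr0 subr0 /compR -mulrA -[q * hat]/(compR None q) CL.
rewrite /compR rdivM -/(compR (Some a) q) /=.
have -> : rdiv (InStar a : arrow mQ) (p * u) = p * cmp b a.
  have [g gE] := linear_bundle (clin_rdiv K (InStar a : arrow mQ)).1.
  rewrite mulr_sumr -gE linear_sum (bigD1 a) //= big1 ?addr0 => [|a' na]; rewrite gE !mulrA rdivM rdiv_arr coef_arr_nil scale0r addr0.
    by rewrite eqxx -mulrA; have := arr_idem K (Comp b a : arrow mQ) => ->.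
  by case: eqP => [[e]|_]; [rewrite e eqxx in na | rewrite mulr0].
have [f fE] := linear_bundle (clin_compL r).1.
have CL' := compL_mid r p 1 (hat_cmp b a); rewrite !mulr1 in CL'.
rewrite -fE linearD linearZ !fE CL CL' chiZD.
suff -> : chi (compL r p * cmp b a) = chi (compL r p * hat) * (arr K (val b) * arr K (val a)).
  by rewrite scaleMl mulrA addrK.
rewrite chiMhat ?hat_cmp //; congr (_ * _).
rewrite -(arr_idem K (Comp b a : arrow mQ)) chi_comp // chi_idem //=.
by have := arr_idem K (val a) => ->.
Qed.

(* The derivatives at [InStar a] and [OutStar b] do not map into [J]: they
   produce the terms [outL r * y s] and [x r * inR s], which act as zero because
   they factor through [im beta] and through [alpha \o be]. *)
Lemma solvable_jacobian u : jacobian_ideal mS u -> solvable u.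
Proof.
apply: jacobian_ind => [|p x q].
  apply: closed_solvable; [exact: clin_entry | exact: closed_jacobian].
have hl := idem_cder mS x; have hr := cder_idem x pmS.
case: x hl hr => [c|b a|a|b] /= hl hr.
- have [hc tc] := off_neq c; apply: solvable_away.
  + exact: hat_of_idem hl.
  + exact: hat_of_Midem hr.
  + by rewrite (chi_cder_off lfQ acQ) //; exact: jacobian_cder.
- apply: solvable_away.
  + by apply: hat_of_idem hl; exact: tl_in.
  + by apply: hat_of_Midem hr; exact: hd_out.
  + by rewrite (chi_cder_comp lfQ acQ) //; have [] := closed_jacobian S.
- by rewrite (cder_premut_in S0); exact: solvable_in.
- by rewrite (cder_premut_out S0); exact: solvable_out.
Qed.

End Entries.

(** * The premuted Jacobian ideal acts as zero *)

Section Annihilation.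
Variables (K : fieldType) (I : finType).

Lemma in_mpow2_potential (Q : quiver I) (S : cpa K Q) : loop_free Q -> potential S -> in_mpow 2 S.
Proof.
move=> lf pS [j s] sz; apply: contrapT => /eqP /pS /and3P[].
case: s sz => [|c [|]] //= _; rewrite /is_path /= andbT /word_tl /= => /eqP hc /eqP tc _.
by have := lf c; rewrite hc tc eqxx.
Qed.

Lemma closed_in_mpow (Q : quiver I) n : closed_subspace (@in_mpow K I Q n).
Proof.
split=> [|c u v|u cu]; [exact: in_mpow0 | exact: in_mpowP|].
by have [v vn uv] := cu n; rewrite -(subrK v u); apply: in_mpowD.
Qed.

(** Without loops the cycles have length at least 2, so derivatives have no constant term. For the
    premuted quiver this kills the scalar component [comp_z]. *)
Lemma jacobian_mpow (Q : quiver I) (S u : cpa K Q) : loop_free Q -> potential S ->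
  jacobian_ideal S u -> in_mpow 1 u.
Proof.
move=> lf pS; apply: jacobian_ind; first exact: closed_in_mpow.
by move=> p a q; apply/in_mpowMr/in_mpowMl/in_mpow_cder/in_mpow2_potential.
Qed.

Variables (Q : quiver I) (S S0 : cpa K Q) (qpS : is_QP S) (acQ : two_acyclic Q) (k : I).
Hypotheses (pS0 : potential S0) (S0h : idem_hat K k Q * S0 * idem_hat K k Q = S0).
Hypothesis SS0 : cyc_equiv S S0.
Variable M : dmod S.
Notation mQ := (premut_quiver k Q).
Variables (B : bar_triangle k M) (al : {linear MoutL k M -> bar_Mk B})
  (be : {linear bar_Mk B -> MinL k M}).
Hypotheses (alE : al =1 bar_alpha B) (beE : be =1 @bar_beta _ _ _ _ _ _ B).
Hypothesis D : dual_triangle (VkL k M) (alpha_lin k M) (beta_lin k M) (gamma_lin k M) al be.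

Lemma out_inj_sum_beta (w : space M) :
  \sum_b out_inj b (mact M (arr K (val b)) w) = beta_lin k M (toMk k w) :> MoutL k M.
Proof.
rewrite [RHS]M_out_sum; apply: eq_bigr => b _; congr (out_inj b _).
rewrite val_beta -mactM; congr (mact M _ w).
have := arr_idem K (val b); rewrite (eqP (valP b)) => -> //.
Qed.

Lemma alpha_sum (n : MinL k M) (x : cpa K Q) : alpha_lin k M n = 0 ->
  \sum_a mact M (x * arr K (val a)) (val n a) = 0.
Proof.
move=> n0; under eq_bigr do rewrite mactM.
by rewrite -(linear_sum (mact M x)) -val_alpha n0; exact: mact_r0.
Qed.

Lemma eta_tilde_entry u (m : M_bar B) : eta_tilde u m =
  (to_hat k (mact M (entry S None None u) (val m.1)
     + \sum_a mact M (entry S None (Some a) u) (val (be m.2) a)),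
   comp_z u *: m.2 + al (\sum_b out_inj b (mact M (entry S (Some b) None u) (val m.1)
     + \sum_a mact M (entry S (Some b) (Some a) u) (val (be m.2) a)))).
Proof.
rewrite (eta_tildeE qpS alE beE).
have -> : comp_hat u = compL None (compR None u) by rewrite /= mulrA.
congr (_, _ + al _); apply: eq_bigr => b _; congr (out_inj b (_ + _)).
have -> // : comp_w u b = compL (Some b) (compR None u).
by rewrite /= ldivM ldiv_hat scaler0 addr0.
Qed.

Lemma eta_tildeD u v (m : M_bar B) : eta_tilde (u + v) m = eta_tilde u m + eta_tilde v m.
Proof.
have C r t : entry S r t (u + v) = entry S r t u + entry S r t v.
  have [g gE] := linear_bundle (clin_entry (k := k) S r t).1.
  by rewrite -!gE linearD.
have E r n : mact M (entry S r None (u + v)) n + \sum_a mact M (entry S r (Some a) (u + v)) (val (be m.2) a)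
   = (mact M (entry S r None u) n + \sum_a mact M (entry S r (Some a) u) (val (be m.2) a))
   + (mact M (entry S r None v) n + \sum_a mact M (entry S r (Some a) v) (val (be m.2) a)).
  rewrite C mactD addrACA -big_split; congr (_ + _); apply: eq_bigr => a _.
  by rewrite C mactD.
rewrite !eta_tilde_entry.
have [h hE] := linear_bundle (@to_hat_linear K I Q S k M).
have zD : comp_z (u + v) = comp_z u + comp_z v by [].
rewrite E -!hE linearD zD scalerDl; congr (_, _).
rewrite [RHS]/= -[RHS]/((_ + al _) + (_ + al _)) addrACA; congr (_ + _); rewrite -[RHS]linearD -big_split; congr (al _); apply: eq_bigr => b _.
have [o oE] := linear_bundle (@out_inj_linear K I Q S k M b).
by rewrite E -!oE -[RHS]linearD.
Qed.

Lemma eta_tilde_jacobian u (m : M_bar B) :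
  jacobian_ideal (premut_potential k S0) u -> eta_tilde u m = 0.
Proof.
move=> Ju; have [lf pS] := qpS.
have z0 : comp_z u = 0.
  apply: (jacobian_mpow _ _ Ju) => //; [exact: premut_loop_free | exact: potential_premut].
have [y [x h]] := solvable_jacobian lf acQ pS pS0 S0h SS0 Ju.
have act0 j n : jacobian_ideal S j -> mact M j n = 0.
  by move=> Jj; exact: (act_jacobian (dmodP M)).
have E r s n : mact M (entry S r s u) n = mact M (outL K r * y s + x r * inR K s) n.
  by have := act0 _ n (h r s); rewrite mactD mactN => /eqP; rewrite subr_eq0 => /eqP.
have n0 : alpha_lin k M (be m.2) = 0 by apply/(dual_im D); exists m.2.
rewrite eta_tilde_entry z0 scale0r add0r E /= mul0r mulr0 addr0 mact0 add0r.
have -> : \sum_a mact M (entry S None (Some a) u) (val (be m.2) a) = 0.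
  rewrite -[RHS](alpha_sum (x None) n0); apply: eq_bigr => a _.
  by rewrite E /= mul0r add0r.
rewrite to_hat0; congr (_, _).
(* The terms in [x] vanish because [alpha \o be = 0]. Those in [y] make the component at [b] equal
   to [b w], so together they form [beta] of the part of [w] at [k], which [al] kills. *)
pose w := mact M (y None) (val m.1) + \sum_a mact M (y (Some a)) (val (be m.2) a).
transitivity (al (\sum_b out_inj b (mact M (arr K (val b)) w) : MoutL k M)); last first.
  by rewrite out_inj_sum_beta; apply/(dual_ker D); eexists.
congr (al _); apply: eq_bigr => b _; congr (out_inj b _).
rewrite E /= mulr0 addr0 mactM mactDr; congr (_ + _).
rewrite linear_sum -[RHS]addr0 -[X in _ = _ + X](alpha_sum (x (Some b)) n0) -big_split; apply: eq_bigr => a _ /=.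
by rewrite E mactD mactM.
Qed.

End Annihilation.

(** * Reduction *)

Section TrivialPart.
Variables (K : fieldType) (I : finType) (Q1 Q2 : quiver I) (S1 : cpa K Q1) (T : cpa K Q2).
Hypotheses (p1 : potential S1) (p2 : potential T) (trivT : trivial T).
Notation Q12 := (quiver_sum Q1 Q2).
Let gl (c : arrow Q12) := if c is inl c then Some [:: c] else None.
Let gr (c : arrow Q12) := if c is inr c then Some [:: c] else None.

Lemma inlP : @relabelling I Q1 Q12 gl inl.
Proof. by split=> // -[d|//] _; exists d. Qed.

Lemma inrP : @relabelling I Q2 Q12 gr inr.
Proof. by split=> // -[//|d] _; exists d. Qed.

(** Derivatives at arrows of the second summand do not see [S1], so triviality of [T] passes to the
    sum. *)
Lemma arr_inr c : exists x : arrow Q2 -> K,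
  arr K (inr c : arrow Q12) = \sum_a x a *: cder (potential_sum S1 T) (inr a : arrow Q12).
Proof.
have [x xE] := trivT.2 c; exists x.
have [[L _] _ _ _] := relabel_hom K inrP; have [h hE] := linear_bundle L.
rewrite -[LHS](relabel_arr K inrP).
rewrite xE -hE linear_sum; apply: eq_bigr => a _; rewrite linearZ; congr (_ *: _).
have [D DE] := linear_bundle (clin_cder K (inr a : arrow Q12)).1.
rewrite hE -DE linearD !DE.
rewrite (cder_relabel0 inlP p1) //.
by rewrite add0r (cder_relabel inrP).
Qed.

Variables (Q : quiver I) (S : cpa K Q) (phi : {rmorphism cpa K Q12 -> cpa K Q}).
Hypotheses (lf1 : loop_free Q1) (lf2 : loop_free Q2) (lf : loop_free Q).
Hypothesis phiP : right_equivalence (potential_sum S1 T) S phi.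

Let lf12 : loop_free Q12. Proof. by case=> c; [exact: lf1 | exact: lf2]. Qed.

(** [v] collects the paths of the preimage of [u] that stay in [Q1]. Each other path contains an
    arrow of [Q2], a combination of derivatives by [arr_inr], and [phi] sends derivatives into the
    Jacobian ideal, which is closed. *)
Lemma reduction_generates u : exists v, jacobian_ideal S (u - phi (cpa_inl Q2 v)).
Proof.
have [psi _ psiK] := req_bij phiP; rewrite -(psiK u); set y := psi u.
exists (restrict inlP y); rewrite -rmorphB.
have Jc := closed_jacobian S.
apply: (clin_ind (hom_clin (req_hom lf12 phiP)) Jc) => -[j t] nz wt.
have nt := relabel_restrict nz.
rewrite /= in nt; clear nz.
(* A word that is not the image of a word of [Q1] is split at its first arrow of [Q2]. *)
have {nt} [s1 [c [s2 e]]] : exists s1 c s2, t = s1 ++ (inr c : arrow Q12) :: s2.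
  elim: t nt {wt} => [|[c|c] t IH] nt; first by case: (nt [::]).
    case: IH => [s ts|s1 [d [s2 ->]]]; first by apply: (nt (c :: s)); rewrite /= -ts.
    by exists (inl c :: s1), d, s2.
  by exists [::], c, t.
move: wt; rewrite e /is_path /= walk_cat => /andP[w1 /= /andP[/eqP hc w2]].
rewrite monomial_cat // monomial_cons ifT ?hc ?eqxx //; last exact/eqP.
rewrite !rmorphM; apply/jacobianMl/jacobianMr.
have [x ->] := arr_inr c.
have [p pE] := linear_bundle (req_linear phiP); rewrite -pE linear_sum.
apply: subspace_sum => // a; rewrite pE (req_scalable phiP).
have [J0 JP _] := Jc; rewrite -[_ *: _]addr0; apply: JP => //; exact: req_cder.
Qed.

End TrivialPart.

Lemma disomorphic_reduction (K : fieldType) (I : finType) (Q1 Q2 Q : quiver I)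
    (phi : cpa K (quiver_sum Q1 Q2) -> cpa K Q) (M N : drep K Q) :
  (forall u, exists v, (forall m : space M, act u m = act (phi (cpa_inl Q2 v)) m) /\
    (forall n : space N, act u n = act (phi (cpa_inl Q2 v)) n)) ->
  disomorphic (reduction phi M) (reduction phi N) <-> disomorphic M N.
Proof.
move=> h; split=> -[[F [Fb Fe]] G]; split=> //; exists F; split=> // u m; last exact: Fe.
by have [v [EM EN]] := h u; rewrite EM EN; exact: Fe.
Qed.

Section ReductionIff.
Variables (K : fieldType) (I : finType) (Q : quiver I) (S S0 : cpa K Q).
Variables (qpS : is_QP S) (acQ : two_acyclic Q) (k : I).
Hypotheses (pS0 : potential S0) (SS0 : cyc_equiv S S0) (startS0 : no_start_at k S0).
Notation mQ := (premut_quiver k Q).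

(** A cycle ends where it starts, so [startS0] excludes [k] at both ends. *)
Lemma no_start_hat : idem_hat K k Q * S0 * idem_hat K k Q = S0.
Proof.
have C : clin (fun u : cpa K Q => idem_hat K k Q * u * idem_hat K k Q).
  by apply: clin_comp (clinMr _) (clinMl _).
have H := clin_eq (u := S0) C (@clin_id K I Q); apply: H => w nz _; rewrite hat_monomial (negbTE (startS0 nz)).
have /and3P[_ /eqP tw _] := pS0 nz.
by rewrite monomial_hat tw (negbTE (startS0 nz)).
Qed.

Lemma premutation_actD (M : dmod S) (d : description) (s : splitting k M) u v (m : M_bar (bar_of qpS d s)) :
  eta_tilde (u + v) m = eta_tilde u m + eta_tilde v m.
Proof.
have [al [be [alE beE D]]] := bar_dualP qpS d s.
exact: (eta_tildeD qpS alE beE).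
Qed.

Lemma premutation_jacobian (M : dmod S) (d : description) (s : splitting k M) u m :
  jacobian_ideal (premut_potential k S0) u -> act (d := premutation qpS d s) u m = 0.
Proof.
have [al [be [alE beE D]]] := bar_dualP qpS d s.
by apply: (eta_tilde_jacobian qpS acQ pS0 no_start_hat SS0 alE beE D).
Qed.

Variables (Q1 Q2 : quiver I) (S1 : cpa K Q1) (T : cpa K Q2).
Hypotheses (qp1 : is_QP S1) (qpT : is_QP T) (trivT : trivial T).
Variable phi : {rmorphism cpa K (quiver_sum Q1 Q2) -> cpa K mQ}.
Hypothesis phiP : right_equivalence (potential_sum S1 T) (premut_potential k S0) phi.
Variables (M N : dmod S) (dM dN : description) (sM : splitting k M) (sN : splitting k N).

Lemma reduction_disomorphic :
  disomorphic (reduction phi (premutation qpS dM sM)) (reduction phi (premutation qpS dN sN)) <->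
  disomorphic (premutation qpS dM sM) (premutation qpS dN sN).
Proof.
apply: disomorphic_reduction => u.
have lm := premut_loop_free (k := k) (QP_loop_free qpS) acQ.
have [v Jv] := reduction_generates (QP_potential qp1) (QP_potential qpT) trivT (QP_loop_free qp1)
  (QP_loop_free qpT) lm phiP u.
have E (L : dmod S) d (s : splitting k L) n : act (d := premutation qpS d s) u n =
    act (d := premutation qpS d s) (phi (cpa_inl Q2 v)) n.
  rewrite -{1}(subrK (phi (cpa_inl Q2 v)) u).
  by rewrite [LHS]premutation_actD [X in X + _](premutation_jacobian n Jv) add0r.
by exists v.
Qed.

End ReductionIff.

Theorem theorem9p4 (K : fieldType) (I : finType) (k : I)
    (Q : quiver I) (S : cpa K Q) (qpS : is_QP S) (acycQ : two_acyclic Q)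
    (S0 : cpa K Q) (potS0 : potential S0) (cycS0 : cyc_equiv S S0)
    (startS0 : no_start_at k S0)
    (Qr : quiver I) (Sr : cpa K Qr) (qpSr : is_QP Sr) (redSr : reduced Sr)
    (C : quiver I) (T : cpa K C) (qpT : is_QP T) (trivT : trivial T)
    (phi : {rmorphism cpa K (quiver_sum Qr C) -> cpa K (premut_quiver k Q)})
    (phiP : right_equivalence (potential_sum Sr T) (premut_potential k S0) phi)
    (M N : dmod S)
    (dM dN : description) (sM : splitting k M) (sN : splitting k N) :
  let muM := premutation qpS dM sM in
  let muN := premutation qpS dN sN in
  (disomorphic (reduction phi muM) (reduction phi muN) <-> disomorphic muM muN)
  /\
  (disomorphic muM muN <-> disomorphic M N).
Proof.
split; last exact: premutation_disomorphic.
exact: (reduction_disomorphic qpS acycQ potS0 cycS0 startS0 qpSr qpT trivT phiP).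
Qed.
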